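(* Let $|\mu|<1$, $c>0$ and $0<p,q<1$. Then the $C^*$-algebra $C(S^2_{\mu c})$ of the Podleś sphere is isomorphic to $$C(D_p)\oplus_\phi C(D_q)=\{(f,g)\in C(D_p)\oplus C(D_q)\mid \phi_p(f)=\phi_q(g)\}.$$
   Context: For $0<q<1$, $P(D_q)$ is the unital $*$-algebra generated by $x,x^*$ with the relation $x^*x-qxx^*=(1-q)1$. The $C^*$-algebra $C(D_q)$ of the quantum disc is the completion of $P(D_q)$ in the norm $\|a\|=\sup_\rho\|\rho(a)\|$, the supremum over all bounded (unital) $*$-representations of $P(D_q)$ on Hilbert spaces (it is finite since $\|\rho(x)\|=1$ for every such $\rho$). $\phi_q:C(D_q)\to C(S^1)$ is the $C^*$-homomorphism with $\phi_q(x)=a$, where $a$ is the canonical unitary generator of $C(S^1)$ ($z\mapsto z$). $C(S^2_{\mu c})$ is the universal unital $C^*$-algebra generated by $A,B$ with relations $A=A^*$, $BA=\mu^2AB$, $B^*B=A-A^2+c1$, $BB^*=\mu^2A-\mu^4A^2+c1$. *)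

(* Defs.v *)
From HB Require Import structures.
From mathcomp Require Import all_boot all_order all_algebra.
From mathcomp Require Import all_classical all_reals all_analysis complex.

Set Implicit Arguments.
Unset Strict Implicit.
Unset Printing Implicit Defensive.

Import Order.TTheory GRing.Theory Num.Theory.
Import numFieldNormedType.Exports.

Local Open Scope classical_set_scope.
Local Open Scope ring_scope.

(** All algebras are unital and, as everywhere in MathComp's [algType],
    nonzero.  Leaving out the zero algebra does not change the universal
    properties below, since it receives exactly one unital map from anything. *)

HB.mixin Record isStarAlgebra (C : numClosedFieldType) A & GRing.Algebra C A := {
  star : A -> A;
  starK : involutive star;
  starD : {morph star : a b / a + b};
  starZ : forall (k : C) a, star (k *: a) = Num.conj k *: star a;
  starM : forall a b, star (a * b) = star b * star a
}.

#[short(type="starAlgType")]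
HB.structure Definition StarAlgebra (C : numClosedFieldType) :=
  {A of GRing.Algebra C A & isStarAlgebra C A}.

(** Norms on algebras are real-valued and carried by their own mixin: in MathComp's
    hierarchy the only join of rings with normed modules is [numDomainType]. *)
HB.mixin Record isNormedStarAlgebra (R : realType) A & StarAlgebra R[i] A := {
  anorm : A -> R;
  anormD : forall a b, anorm (a + b) <= anorm a + anorm b;
  anormZ : forall (k : R[i]) a, (anorm (k *: a))%:C%C = `|k| * (anorm a)%:C%C;
  anorm_eq0 : forall a, anorm a = 0 -> a = 0;
  anormM : forall a b, anorm (a * b) <= anorm a * anorm b
}.

#[short(type="normedStarAlgType")]
HB.structure Definition NormedStarAlgebra (R : realType) :=
  {A of StarAlgebra R[i] A & isNormedStarAlgebra R A}.

(** The normed module underlying an algebra, through which the library's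
    topological notions apply to it. *)
Definition normed_of (R : realType) (A : normedStarAlgType R) : Type := A.

Section NormedOf.
Variables (R : realType) (A : normedStarAlgType R).

HB.instance Definition _ := GRing.Lmodule.on (normed_of A).

Let cnorm (a : normed_of A) : R[i] := (anorm (a : A))%:C%C.

Fact cnormD a b : cnorm (a + b) <= cnorm a + cnorm b.
Proof. by rewrite /cnorm -rmorphD lecR; exact: anormD. Qed.

Fact cnormZ (k : R[i]) a : cnorm (k *: a) = `|k| * cnorm a.
Proof. exact: anormZ. Qed.

Fact cnorm_eq0 a : cnorm a = 0 -> a = 0.
Proof. by move=> /(congr1 (@complex.Re R)) /=; exact: anorm_eq0. Qed.

HB.instance Definition _ :=
  Lmodule_isNormed.Build R[i] (normed_of A) cnormD cnormZ cnorm_eq0.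

End NormedOf.

HB.mixin Record isCStarAlgebra (R : realType) A & NormedStarAlgebra R A := {
  cstar_identity : forall a : A, anorm (star a * a) = anorm a ^+ 2;
  cstar_complete :
    forall F : set_system (normed_of A), ProperFilter F -> cauchy F -> cvg F
}.

#[short(type="cstarAlgType")]
HB.structure Definition CStarAlgebra (R : realType) :=
  {A of NormedStarAlgebra R A & isCStarAlgebra R A}.

(** Unital *-homomorphisms.  Between C*-algebras these are the usual
    C*-homomorphisms: continuity is automatic. *)
Definition starhom (C : numClosedFieldType) (A B : starAlgType C)
    (f : A -> B) : Prop :=
  [/\ linear f, GRing.monoid_morphism f & {morph f : a / star a}].

Section DirectSum.
Variables (C : numClosedFieldType) (A B : starAlgType C).

Definition pair_star (u : A * B) : A * B := (star u.1, star u.2).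

Fact pair_starK : involutive pair_star.
Proof. by case=> a b; rewrite /pair_star /= !starK. Qed.

Fact pair_starD : {morph pair_star : u v / u + v}.
Proof. by case=> a b [a' b']; rewrite /pair_star /= !starD. Qed.

Fact pair_starZ (k : C) u : pair_star (k *: u) = Num.conj k *: pair_star u.
Proof. by case: u => a b; rewrite /pair_star /= !starZ. Qed.

Fact pair_starM u v : pair_star (u * v) = pair_star v * pair_star u.
Proof. by case: u v => a b [a' b']; rewrite /pair_star /= !starM. Qed.

HB.instance Definition _ := isStarAlgebra.Build C (A * B)%type
  pair_starK pair_starD pair_starZ pair_starM.

End DirectSum.

(** A is isomorphic, as a C*-algebra, to the *-subalgebra E of B; a bijective
    *-homomorphism between C*-algebras is automatically isometric. *)
Definition star_isomorphic_to_sub (C : numClosedFieldType) (A B : starAlgType C)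
    (E : set B) : Prop :=
  exists f : A -> B, [/\ starhom f, injective f & range f = E].

Section CircleAlgebra.
Variable R : realType.
Local Notation C := (R[i]).

(** The regular module [R[i]^o] is the complex plane with its usual topology. *)
Definition circle : set C^o := [set z | `|z| = 1].

Definition circle_alg : Type := continuousType circle C^o.

HB.instance Definition _ := Choice.on circle_alg.

Implicit Types f g : circle_alg.

Local Lemma conj_continuous : continuous (Num.conj : C^o -> C^o).
Proof.
move=> z; apply/(@cvgrPdist_lt C C^o _ (nbhs z) (@nbhs_filter C^o z)) => e e0.
have /(@cvgrPdist_lt C C^o _ (nbhs z) (@nbhs_filter C^o z)) /(_ e e0) :
  nbhs (z : C^o) --> z by exact: cvg_id.
by apply: filterS => t /= zt; rewrite -rmorphB norm_conjC.
Qed.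

Fact circle_add_cts f g : continuous (fun z => f z + g z : C^o).
Proof.
by move=> z; exact: (@cvgD C C^o _ (nbhs z) _ f g _ _ (@cts_fun _ _ f z)
  (@cts_fun _ _ g z)).
Qed.

Fact circle_opp_cts f : continuous (fun z => - f z : C^o).
Proof.
by move=> z; exact: (@cvgN C C^o _ (nbhs z) _ f _ (@cts_fun _ _ f z)).
Qed.

Fact circle_mul_cts f g : continuous (fun z => (f z : C) * g z : C^o).
Proof.
by move=> z; exact: (@cvgZ C C^o _ (nbhs z) _ f g _ _ (@cts_fun _ _ f z)
  (@cts_fun _ _ g z)).
Qed.

Fact circle_const_cts (k : C) : continuous (fun _ : circle => k : C^o).
Proof. exact: cst_continuous. Qed.

Fact circle_conj_cts f : continuous (fun z => Num.conj (f z : C) : C^o).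
Proof.
move=> z; apply: (@continuous_comp _ _ _ f (Num.conj : C^o -> C^o)).
  exact: cts_fun.
exact: conj_continuous.
Qed.

Fact circle_gen_cts : continuous (fun z : circle => set_val z : C^o).
Proof. exact: initial_continuous. Qed.

Definition circle_add f g : circle_alg := mkcts (@circle_add_cts f g).
Definition circle_opp f : circle_alg := mkcts (@circle_opp_cts f).
Definition circle_mul f g : circle_alg := mkcts (@circle_mul_cts f g).
Definition circle_const (k : C) : circle_alg := mkcts (@circle_const_cts k).
Definition circle_scale (k : C) f : circle_alg := circle_mul (circle_const k) f.
Definition circle_star f : circle_alg := mkcts (@circle_conj_cts f).
Definition circle_gen : circle_alg := mkcts circle_gen_cts.

Local Ltac pointwise :=
  repeat (let x := fresh in move=> x); apply/continuousEP => ? /=;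
  rewrite /mkcts /=.

Fact circle_addA : associative circle_add.
Proof. by pointwise; rewrite addrA. Qed.

Fact circle_addC : commutative circle_add.
Proof. by pointwise; rewrite addrC. Qed.

Fact circle_add0 : left_id (circle_const 0) circle_add.
Proof. by pointwise; rewrite add0r. Qed.

Fact circle_addN : left_inverse (circle_const 0) circle_opp circle_add.
Proof. by pointwise; rewrite addNr. Qed.

HB.instance Definition _ := GRing.isZmodule.Build circle_alg
  circle_addA circle_addC circle_add0 circle_addN.

Fact circle_mulA : associative circle_mul.
Proof. by pointwise; rewrite mulrA. Qed.

Fact circle_mulC : commutative circle_mul.
Proof. by pointwise; rewrite mulrC. Qed.

Fact circle_mul1 : left_id (circle_const 1) circle_mul.
Proof. by pointwise; rewrite mul1r. Qed.

Fact circle_mulDl : left_distributive circle_mul +%R.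
Proof. by pointwise; rewrite mulrDl. Qed.

Fact circle_1neq0 : circle_const 1 != 0.
Proof.
have c1 : (1 : C^o) \in circle by rewrite inE /circle /= normr1.
apply/eqP => /continuousEP /(_ (exist (fun z : C^o => z \in circle) 1 c1)) /=.
by rewrite /mkcts /=; apply/eqP; exact: oner_neq0.
Qed.

HB.instance Definition _ := GRing.Zmodule_isComNzRing.Build circle_alg
  circle_mulA circle_mulC circle_mul1 circle_mulDl circle_1neq0.

Fact circle_scaleA (k l : C) f :
  circle_scale k (circle_scale l f) = circle_scale (k * l) f.
Proof. by apply/continuousEP => z; rewrite /= /mkcts /= mulrA. Qed.

Fact circle_scale1 : left_id 1 circle_scale.
Proof. by pointwise; rewrite mul1r. Qed.

Fact circle_scaleDr : right_distributive circle_scale +%R.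
Proof. by pointwise; rewrite mulrDr. Qed.

Fact circle_scaleDl f : {morph circle_scale^~ f : k l / k + l}.
Proof. by move=> k l; apply/continuousEP => z; rewrite /= /mkcts /= mulrDl. Qed.

HB.instance Definition _ := GRing.Zmodule_isLmodule.Build C circle_alg
  circle_scaleA circle_scale1 circle_scaleDr circle_scaleDl.

Fact circle_scaleAl (k : C) f g : k *: (f * g) = (k *: f) * g.
Proof. by apply/continuousEP => z; rewrite /= /mkcts /= mulrA. Qed.

HB.instance Definition _ := GRing.Lmodule_isLalgebra.Build C circle_alg
  circle_scaleAl.
HB.instance Definition _ := GRing.Lalgebra_isComAlgebra.Build C circle_alg.

Fact circle_starK : involutive circle_star.
Proof. by pointwise; rewrite conjCK. Qed.

Fact circle_starD : {morph circle_star : f g / f + g}.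
Proof. by pointwise; rewrite rmorphD. Qed.

Fact circle_starZ (k : C) f :
  circle_star (k *: f) = Num.conj k *: circle_star f.
Proof. by apply/continuousEP => z; rewrite /= /mkcts /= rmorphM. Qed.

Fact circle_starM f g : circle_star (f * g) = circle_star g * circle_star f.
Proof. by apply/continuousEP => z; rewrite /= /mkcts /= rmorphM mulrC. Qed.

HB.instance Definition _ := isStarAlgebra.Build C circle_alg
  circle_starK circle_starD circle_starZ circle_starM.

End CircleAlgebra.

(** Norms in a normed module over [R[i]] are elements of [R[i]]. *)
Definition rnorm (R : realType) (V : normedModType R[i]) (v : V) : R :=
  complex.Re `|v|.

Record hilbert (R : realType) := Hilbert {
  hilbert_space :> completeNormedModType R[i];
  dot : {dot hilbert_space for Num.conj};
  hilbert_norm : forall v, `|v| ^+ 2 = dot v v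
}.

Definition opnorm (R : realType) (V : normedModType R[i]) (T : V -> V) : R :=
  sup [set rnorm (T v) | v in [set v | `|v| <= 1]].

Record bounded_rep (R : realType) (P : starAlgType R[i]) (H : hilbert R)
    (rho : P -> H -> H) : Prop := BoundedRep {
  rep_linear : forall a, linear (rho a);
  rep_bounded : forall a, continuous (rho a);
  rep_lin : forall (k : R[i]) a b v, rho (k *: a + b) v = k *: rho a v + rho b v;
  rep1 : forall v, rho 1 v = v;
  repM : forall a b v, rho (a * b) v = rho a (rho b v);
  rep_star : forall a v w, dot H (rho a v) w = dot H v (rho (star a) w)
}.

Section QuantumDisc.
Variables (R : realType) (q : R).

Definition disc_relation (A : starAlgType R[i]) (x : A) : Prop :=
  star x * x - q%:C%C *: (x * star x) = (1 - q)%:C%C *: 1.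

(** (P, x) is the unital *-algebra P(D_q) with its generator. *)
Definition is_disc_polynomials (P : starAlgType R[i]) (x : P) : Prop :=
  disc_relation x /\
  forall (A : starAlgType R[i]) (y : A), disc_relation y ->
    exists! f : P -> A, starhom f /\ f x = y.

(** For 0 < q < 1 and P = P(D_q) the supremum is over a nonempty bounded set. *)
Definition rep_norm (P : starAlgType R[i]) (a : P) : R :=
  sup [set r | exists (H : hilbert R) (rho : P -> H -> H),
                 bounded_rep rho /\ r = opnorm (rho a)].

(** (D, x) is the completion C(D_q) of P(D_q) with its generator. *)
Definition is_quantum_disc (D : cstarAlgType R) (x : D) : Prop :=
  exists (P : starAlgType R[i]) (y : P) (iota : P -> D),
    [/\ is_disc_polynomials y, starhom iota, iota y = x,
        closure (range iota : set (normed_of D)) = setT &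
        forall a, anorm (iota a) = rep_norm a].

End QuantumDisc.

Section PodlesSphere.
Variables (R : realType) (mu c : R).

Definition podles_relations (S : starAlgType R[i]) (A B : S) : Prop :=
  [/\ A = star A,
      B * A = (mu ^+ 2)%:C%C *: (A * B),
      star B * B = A - A ^+ 2 + c%:C%C *: 1 &
      B * star B = (mu ^+ 2)%:C%C *: A - (mu ^+ 4)%:C%C *: A ^+ 2 + c%:C%C *: 1].

Definition is_podles_sphere (S : cstarAlgType R) (A B : S) : Prop :=
  podles_relations A B /\
  forall (D : cstarAlgType R) (A' B' : D), podles_relations A' B' ->
    exists! f : S -> D, [/\ starhom f, f A = A' & f B = B'].

End PodlesSphere.

Definition disc_pullback (R : realType) (Dp Dq : cstarAlgType R)
    (phip : Dp -> circle_alg R) (phiq : Dq -> circle_alg R) : set (Dp * Dq) :=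
  [set u | phip u.1 = phiq u.2].

(* Main.v *)
(* In the algebra of a quantum disc, x^* x is bounded below by 1 - q, so x has a polar
   decomposition x = s |x| with s an isometry.  This s generates the algebra, and 1 - s s^* <> 0
   because of the Fock representation: every disc is the Toeplitz algebra, whatever q is.
   Likewise the sphere is generated by the isometry W = B^* (B B^* )^(-1/2) and a projection
   P <= 1 - W W^*, from which A is recovered as the fixpoint of
   A = u P + v (1 - W W^* - P) + mu^2 W A W^*, where u > 0 > v are the roots of t^2 - t = c.
   By universality there are homomorphisms f_1, f_2 from the sphere to the two discs with
   W |-> s, P |-> 1 - s s^* and W |-> t, P |-> 0.

   Injectivity: positivity of a combination of words W^i D W^*j is governed by its two matrices
   of coefficients at P and at 1 - W W^* - P, which must be positive semidefinite.  These matrices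
   are the compressions of the images under f_1 and f_2, so (f_1, f_2) is isometric.

   Surjectivity: modulo the image of ker f_1, every polynomial in t is a Laurent polynomial
   in t, and the norm of such an element is controlled by its symbol on the circle, because the
   Toeplitz matrix of a nonnegative symbol is positive semidefinite.  Hence the image of
   (f_1, f_2), which is closed, is dense in the pullback. *)

Require Import Defs.
From HB Require Import structures.
From mathcomp Require Import all_boot all_order all_algebra.
From mathcomp Require Import cyclic separable cyclotomic.
From mathcomp Require Import all_classical all_reals all_analysis complex.
From mathcomp Require Import ring lra.

Set Implicit Arguments.
Unset Strict Implicit.
Unset Printing Implicit Defensive.

Import Order.TTheory GRing.Theory Num.Theory.
Import numFieldNormedType.Exports.
Local Open Scope classical_set_scope.
Local Open Scope ring_scope.

(** The argument avoids spectra altogether. Positivity is a norm condition, square roots and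
    inverses come from explicit iterations, and commutation is carried along by quantifying over all
    closed subalgebras. Contractivity of homomorphisms and continuity of characters are
    consequences. The sphere and the discs are given by universal properties only, so two facts have
    to be extracted from these. Generation follows by comparing the identity with the map through a
    subalgebra. That [p = 1 - s * star s] is nonzero is the one fact for which a Hilbert space is
    built. Elsewhere matrix entries are read inside the algebra, by compressing with [p]: an entry
    [k] appears as [k *: p], and [p != 0] gives it back. The obstacle to injectivity is that cutting
    an infinite positive matrix to a corner destroys words such as [w]. Fejér-type averages of
    corners keep positivity and converge to the word. The roots [u], [v] enter because [B * star B]
    factors as [(u - mu^2 A)(mu^2 A - v)], with both factors bounded below by positive constants
    even when [mu = 0]. *)

Section SequentialCompleteness.
Variables (R : realType) (V : normedModType R[i]).

(** The norm is [R[i]]-valued, but [e] ranges over [R], so that estimates take place in an ordered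
    field. All limits constructed later are limits of sequences, whereas completeness in the
    definitions speaks of Cauchy filters. *)
Definition sconv (u : nat -> V) (l : V) :=
  forall e : R, 0 < e -> exists N, forall n, (N <= n)%N -> `|u n - l| <= e%:C%C.

Definition scauchy (u : nat -> V) :=
  forall e : R, 0 < e -> exists N, forall m n, (N <= m)%N -> (N <= n)%N ->
    `|u m - u n| <= e%:C%C.

Lemma gt0_complexE (e : R[i]) : 0 < e -> exists2 r : R, 0 < r & e = r%:C%C.
Proof.
case: e => a b; rewrite ltcE /= => /andP[/eqP -> a0]; exists a => //.
Qed.

Lemma scauchy_cvg :
  (forall F : set_system V, ProperFilter F -> cauchy F -> cvg F) ->
  forall u, scauchy u -> exists l, sconv u l.
Proof.
move=> comp u uC.
have FF : ProperFilter (u n @[n --> \oo]) by exact: fmap_proper_filter.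
suff /(comp _ FF)/cvg_ex[l ul] : cauchy (u n @[n --> \oo]).
  exists l => e e0.
  have := ul (ball l e%:C%C); case.
    by apply: nbhsx_ballx; rewrite ltcR.
  move=> N _ NP; exists N => n Nn; have := NP n Nn.
  by rewrite /= -ball_normE /ball_ /= distrC => /ltW.
apply/cauchy_ballP => e /gt0_complexE[r r0 ->].
have r20 : 0 < r / 2 by rewrite divr_gt0.
have [N NP] := uC _ r20.
exists ([set v | exists2 n, (N <= n)%N & v = u n],
        [set v | exists2 n, (N <= n)%N & v = u n])%classic.
  split => /=; exists N => //= n Nn; exists n => //.
case=> v w /= [[m Nm ->] [n Nn ->]].
rewrite -ball_normE /ball_ /=; apply: le_lt_trans (NP _ _ Nm Nn) _.
by rewrite ltcR ltr_pdivrMr // ltr_pMr // ltr1n.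
Qed.

(** Pick [x n] whose ball of radius [1 / (n + 1)] belongs to [F]. Members of a proper filter meet,
    so [x] is Cauchy, and [F] converges to its limit because small balls of [F] lie close to it. *)
Lemma sconv_complete :
  (forall u, scauchy u -> exists l, sconv u l) ->
  forall F : set_system V, ProperFilter F -> cauchy F -> cvg F.
Proof.
move=> comp F FF Fc.
have FE : forall e : R, 0 < e -> exists x, F (ball x e%:C%C).
  by move=> e e0; have /cauchyP := Fc; apply; rewrite ltcR.
have eps n : 0 < (n.+1%:R^-1 : R) by rewrite invr_gt0.
have [x xP] := choice (fun n => FE _ (eps n)).
have [l lP] : exists l, sconv x l.
  apply: comp => e e0.
  have [N NP] : exists N, (N.+1%:R^-1 : R) < e / 2.
    have e20 : 0 < e / 2 by rewrite divr_gt0.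
    have := near_infty_natSinv_lt (PosNum e20) => -[N _ NP].
    by exists N; apply: NP => /=.
  exists N => m n Nm Nn.
  have [z [zm zn]] := filter_ex (filterI (xP m) (xP n)).
  move: zm zn; rewrite -!ball_normE /ball_ /= => zm zn.
  have le_N k : (N <= k)%N -> (k.+1%:R^-1 : R) <= e / 2.
    move=> Nk; apply: ltW; apply: le_lt_trans NP.
    by rewrite lef_pV2 ?posrE ?ltr0n // ler_nat.
  apply: (le_trans (ler_distD z _ _)).
  have -> : e%:C%C = (e / 2)%:C%C + (e / 2)%:C%C.
    by rewrite -rmorphD -splitr.
  apply: lerD.
    by apply: (le_trans (ltW zm)); rewrite lecR le_N.
  by rewrite distrC; apply: (le_trans (ltW zn)); rewrite lecR le_N.
apply/cvg_ex; exists l => A /nbhs_ballP[e /gt0_complexE[r r0 ->]] lA.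
have r20 : 0 < r / 2 by rewrite divr_gt0.
have r40 : 0 < r / 4 by rewrite divr_gt0.
have [N NP] := lP _ r40.
have [M MP] : exists M, (M.+1%:R^-1 : R) < r / 2.
  have := near_infty_natSinv_lt (PosNum r20) => -[M _ MP].
  by exists M; apply: MP => /=.
pose K := maxn M N.
apply: (filterS _ (xP K)) => z zK; apply: lA.
move: zK; rewrite -!ball_normE /ball_ /= => zK.
apply: (le_lt_trans (ler_distD (x K) _ _)).
have : `|l - x K| <= (r / 4)%:C%C by rewrite distrC NP // leq_maxr.
have : `|x K - z| < (r / 2)%:C%C.
  apply: lt_le_trans zK _; rewrite lecR; apply: ltW; apply: le_lt_trans MP.
  by rewrite lef_pV2 ?posrE ?ltr0n // ler_nat ltnS leq_maxl.
move=> h1 h2; apply: (lt_le_trans (ler_ltD h2 h1)).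
by rewrite -rmorphD lecR; lra.
Qed.

(** The majorant method: increments are compared with those of a bounded real sequence, which is
    then nondecreasing and convergent. No geometric rate is asked for; the square root at norm
    exactly [1] has none. *)
Lemma majorant_scauchy (u : nat -> V) (eta : nat -> R) (M : R) :
  (forall n, `|u n.+1 - u n| <= (eta n.+1 - eta n)%:C%C) ->
  (forall n, eta n <= M) -> scauchy u.
Proof.
move=> ueta etaM.
have mono m n : (m <= n)%N -> `|u n - u m| <= (eta n - eta m)%:C%C.
  move=> /subnK <-; elim: (n - m)%N => [|k IH]; first by rewrite !subrr normr0.
  rewrite addSn; apply: (le_trans (ler_distD (u (k + m)%N) _ _)).
  have -> : eta (k + m).+1 - eta m =
    (eta (k + m).+1 - eta (k + m)%N) + (eta (k + m)%N - eta m) by lra.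
  by rewrite rmorphD lerD.
have eta_nd : {homo eta : m n / (m <= n)%N >-> m <= n}.
  move=> m n /mono h; have := le_trans (normr_ge0 _) h.
  by rewrite -(rmorph0 (real_complex R)) lecR subr_ge0.
have /cvg_ex[l /(@cvgrPdist_le R R^o _ eventually _) le] : cvgn eta.
  apply: nondecreasing_is_cvgn => //; exists M => _ [n _ <-]; exact: etaM.
move=> e e0.
have e20 : 0 < e / 2 by rewrite divr_gt0.
have [N _ NP] := le _ e20; exists N => m n Nm Nn.
have h k l' : (N <= k)%N -> (k <= l')%N -> `|u l' - u k| <= e%:C%C.
  move=> Nk kl; apply: (le_trans (mono _ _ kl)); rewrite lecR.
  have := NP k Nk; have := NP l' (leq_trans Nk kl).
  by rewrite /= !ler_norml => /andP[? ?] /andP[? ?]; lra.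
by case: (leqP m n) => [mn|/ltnW nm]; [rewrite distrC|]; exact: h.
Qed.

Lemma sconv_uniq u l m : sconv u l -> sconv u m -> l = m.
Proof.
move=> ul um; apply/eqP; rewrite -subr_eq0 -normr_le0; apply/ler_addgt0Pl => z.
move=> /gt0_complexE[e e0 ->]; rewrite addr0.
have e20 : 0 < e / 2 by rewrite divr_gt0.
have [N1 h1] := ul _ e20; have [N2 h2] := um _ e20; pose n := (N1 + N2)%N.
apply: (le_trans (ler_distD (u n) _ _)).
have -> : e%:C%C = (e / 2)%:C%C + (e / 2)%:C%C by rewrite -rmorphD -splitr.
by rewrite lerD // ?[`|l - _|]distrC ?h1 ?h2 // ?leq_addr ?leq_addl.
Qed.

Lemma sconvD u v l m : sconv u l -> sconv v m -> sconv (fun n => u n + v n) (l + m).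
Proof.
move=> ul vm e e0.
have e20 : 0 < e / 2 by rewrite divr_gt0.
have [N1 h1] := ul _ e20; have [N2 h2] := vm _ e20.
exists (maxn N1 N2) => n; rewrite geq_max => /andP[/h1 g1 /h2 g2].
rewrite opprD addrACA; apply: (le_trans (ler_normD _ _)).
have -> : e%:C%C = (e / 2)%:C%C + (e / 2)%:C%C by rewrite -rmorphD -splitr.
exact: lerD.
Qed.

Lemma sconvZ (k : R[i]) u l : sconv u l -> sconv (fun n => k *: u n) (k *: l).
Proof.
move=> ul e e0.
pose r := complex.Re `|k| + 1.
have kr : `|k| <= r%:C%C.
  by rewrite -[leLHS](RRe_real (normr_real k)) lecR /r lerDl ler01.
have r0 : 0 < r.
  have : 0 <= complex.Re `|k| by have := normr_ge0 k; rewrite lecE /= => /andP[].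
  by rewrite /r; lra.
have [N h] := ul _ (divr_gt0 e0 r0); exists N => n /h g.
rewrite -scalerBr normrZ.
have -> : e%:C%C = r%:C%C * (e / r)%:C%C :> R[i].
  by rewrite -rmorphM mulrC divfK // gt_eqF.
exact: ler_pM.
Qed.

Lemma eq_sconv u v l : u =1 v -> sconv u l -> sconv v l.
Proof. by move=> uv ul e /ul[N h]; exists N => n; rewrite -uv; exact: h. Qed.

Lemma sconv_shift u l : sconv (fun n => u n.+1) l <-> sconv u l.
Proof.
split=> ul e /ul[N h]; last by exists N => n Nn; apply: h; exact: leqW.
by exists N.+1 => -[|n] // Nn; exact: h.
Qed.

End SequentialCompleteness.

(** * Elementary algebra of the involution, of homomorphisms and of the C*-norm *)

Section StarBasics.
Variables (R : realType) (A : starAlgType R[i]).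
Implicit Types a b : A.

Lemma star0 : star (0 : A) = 0.
Proof. by rewrite -[in LHS](scale0r (0 : A)) starZ rmorph0 scale0r. Qed.

Lemma starN a : star (- a) = - star a.
Proof. by rewrite -scaleN1r starZ rmorphN rmorph1 scaleN1r. Qed.

Lemma starB a b : star (a - b) = star a - star b.
Proof. by rewrite starD starN. Qed.

Lemma star1 : star (1 : A) = 1.
Proof. by rewrite -[RHS](starK (1 : A)) -[in RHS](mulr1 (star 1)) starM starK mulr1. Qed.

Lemma conjc_R (r : R) : Num.conj (r%:C%C : R[i]) = r%:C%C.
Proof. exact: conjc_real. Qed.

Lemma starZr (r : R) a : star (r%:C%C *: a) = r%:C%C *: star a.
Proof. by rewrite starZ conjc_R. Qed.

Lemma star_sum (I : Type) (r : seq I) (P : pred I) (F : I -> A) :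
  star (\sum_(i <- r | P i) F i) = \sum_(i <- r | P i) star (F i).
Proof. by elim/big_ind2: _ => [|x x' y y' <- <-|//]; rewrite ?star0 ?starD. Qed.

Lemma starX a n : star (a ^+ n) = star a ^+ n.
Proof.
by elim: n => [|n IH]; rewrite ?expr0 ?star1 // exprS starM IH -exprSr.
Qed.

Definition sc (r : R) : A := r%:C%C *: 1.

Lemma sc0 : sc 0 = 0. Proof. by rewrite /sc scale0r. Qed.
Lemma sc1 : sc 1 = 1. Proof. by rewrite /sc scale1r. Qed.
Lemma scD r s : sc (r + s) = sc r + sc s.
Proof. by rewrite /sc rmorphD scalerDl. Qed.
Lemma star_sc r : star (sc r) = sc r.
Proof. by rewrite /sc starZr star1. Qed.

Lemma realZA (r s : R) a : r%:C%C *: (s%:C%C *: a) = (r * s)%:C%C *: a.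
Proof. by rewrite scalerA rmorphM. Qed.

Lemma scScale r s : r%:C%C *: sc s = sc (r * s).
Proof. by rewrite /sc realZA. Qed.

Definition re_part a := 2^-1%:C%C *: (a + star a).
Definition im_part a := 2^-1%:C%C *: ('i *: (star a - a)).

Lemma re_im_part a : a = re_part a + 'i *: im_part a.
Proof.
rewrite /re_part /im_part !scalerA (mulrC 'i) -mulrA -expr2 sqrCi mulrN1 scaleNr.
rewrite -scalerBr opprB addrACA subrr addr0 -mulr2n -(scaler_nat 2 a) scalerA.
have -> : (2^-1%:C)%C * 2%:R = 1 :> R[i].
  by rewrite -(rmorph_nat (real_complex R)) -rmorphM /= mulVf ?rmorph1.
by rewrite scale1r.
Qed.

Lemma star_re_part a : star (re_part a) = re_part a.
Proof. by rewrite /re_part starZr starD starK addrC. Qed.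

Lemma star_im_part a : star (im_part a) = im_part a.
Proof.
by rewrite /im_part starZr starZ conjCi starB starK scaleNr -scalerN opprB.
Qed.

End StarBasics.
Arguments sc {R} A r.

Section Starhom.
Variables (R : realType) (A B : starAlgType R[i]) (f : A -> B).
Hypothesis hf : starhom f.

Lemma homD a b : f (a + b) = f a + f b.
Proof. by case: hf => fl _ _; have := fl 1 a b; rewrite !scale1r. Qed.
Lemma hom0 : f 0 = 0.
Proof. by apply: (addrI (f 0)); rewrite -homD !addr0. Qed.
Lemma homZ k a : f (k *: a) = k *: f a.
Proof. by case: hf => fl _ _; have := fl k a 0; rewrite hom0 !addr0. Qed.
Lemma homN a : f (- a) = - f a.
Proof. by rewrite -scaleN1r homZ scaleN1r. Qed.
Lemma homB a b : f (a - b) = f a - f b.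
Proof. by rewrite homD homN. Qed.
Lemma hom1 : f 1 = 1. Proof. by case: hf => _ []. Qed.
Lemma homM a b : f (a * b) = f a * f b. Proof. by case: hf => _ []. Qed.
Lemma hom_star a : f (star a) = star (f a). Proof. by case: hf. Qed.
Lemma hom_sc r : f (sc A r) = sc B r.
Proof. by rewrite /sc homZ hom1. Qed.
Lemma homX a n : f (a ^+ n) = f a ^+ n.
Proof. by elim: n => [|n IH]; rewrite ?expr0 ?hom1 // !exprS homM IH. Qed.
Lemma hom_sum (I : Type) (r : seq I) (P : pred I) (F : I -> A) :
  f (\sum_(i <- r | P i) F i) = \sum_(i <- r | P i) f (F i).
Proof. by elim/big_ind2: _ => [|x x' y y' <- <-|//]; rewrite ?hom0 ?homD. Qed.

End Starhom.

Section NormBasics.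
Variables (R : realType) (A : cstarAlgType R).
Implicit Types a b : A.

Lemma anormZc (k : R[i]) a : anorm (k *: a) = complex.Re `|k| * anorm a.
Proof.
have := anormZ k a; rewrite normc_def -rmorphM /= => /(congr1 (@complex.Re R)) /=.
by [].
Qed.

Lemma anormZr (r : R) a : anorm (r%:C%C *: a) = `|r| * anorm a.
Proof.
by rewrite anormZc normc_def /= expr0n /= addr0 sqrtr_sqr.
Qed.

Lemma anorm0 : anorm (0 : A) = 0.
Proof. by rewrite -(scale0r (0 : A)) -(rmorph0 (real_complex R)) anormZr normr0 mul0r. Qed.

Lemma anormN a : anorm (- a) = anorm a.
Proof. by rewrite -scaleN1r -(rmorphN1 (real_complex R)) anormZr normrN1 mul1r. Qed.

Lemma anorm_ge0 a : 0 <= anorm a.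
Proof. by have := anormD a (- a); rewrite subrr anorm0 anormN; lra. Qed.

Lemma anormB a b : anorm (a - b) <= anorm a + anorm b.
Proof. by rewrite -[anorm b]anormN anormD. Qed.

Lemma anormBC a b : anorm (a - b) = anorm (b - a).
Proof. by rewrite -anormN opprB. Qed.

Lemma anorm_dist a b c : anorm (a - c) <= anorm (a - b) + anorm (b - c).
Proof.
by have -> : a - c = (a - b) + (b - c); [rewrite addrA subrK|exact: anormD].
Qed.

Lemma anormZi a : anorm ('i *: a) = anorm a.
Proof. by rewrite anormZc normCi mul1r. Qed.

Lemma anorm1 : anorm (1 : A) = 1.
Proof.
have := cstar_identity (1 : A); rewrite star1 mul1r expr2 => h.
have /eqP : anorm (1 : A) * (anorm (1 : A) - 1) = 0 by rewrite mulrBr mulr1 -h subrr.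
rewrite mulf_eq0 subr_eq0 => /orP[/eqP/anorm_eq0/eqP|/eqP //].
by rewrite oner_eq0.
Qed.

Lemma anorm_sc r : anorm (sc A r) = `|r|.
Proof. by rewrite /sc anormZr anorm1 mulr1. Qed.

Lemma anorm_star a : anorm (star a) = anorm a.
Proof.
suff le b : anorm b <= anorm (star b).
  by apply/eqP; rewrite eq_le le -[X in _ <= anorm X]starK le.
have := cstar_identity b; have := anormM (star b) b.
have [->|b0] := eqVneq (anorm b) 0; first by rewrite anorm_ge0.
have b0' : 0 < anorm b by rewrite lt_def b0 anorm_ge0.
by move=> h1 h2; move: h1; rewrite h2 expr2 ler_pM2r.
Qed.

Lemma anorm_sqr a : star a = a -> anorm (a * a) = anorm a ^+ 2.
Proof. by move=> sa; rewrite -cstar_identity sa. Qed.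

Lemma eq_anorm_small a b : (forall e, 0 < e -> anorm (a - b) <= e) -> a = b.
Proof.
move=> h; apply/eqP; rewrite -subr_eq0; apply/eqP/anorm_eq0.
apply/eqP; rewrite eq_le anorm_ge0 andbT; apply/ler_addgt0Pl => e e0.
by rewrite addr0 h.
Qed.

Definition aconv (u : nat -> A) (l : A) :=
  forall e : R, 0 < e -> exists N, forall n, (N <= n)%N -> anorm (u n - l) <= e.

Lemma anorm_complete (u : nat -> A) :
  (forall e : R, 0 < e -> exists N, forall m n, (N <= m)%N -> (N <= n)%N ->
    anorm (u m - u n) <= e) -> exists l, aconv u l.
Proof.
move=> uC.
have [|l lP] := scauchy_cvg (@cstar_complete R A) (u := u : nat -> normed_of A).
  move=> e e0; have [N NP] := uC e e0; exists N => m n Nm Nn.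
  by have := NP m n Nm Nn; rewrite -lecR.
exists l => e e0; have [N NP] := lP e e0; exists N => n Nn.
by have := NP n Nn; rewrite -lecR.
Qed.

Lemma majorant_cvg (u : nat -> A) (eta : nat -> R) (M : R) :
  (forall n, anorm (u n.+1 - u n) <= eta n.+1 - eta n) ->
  (forall n, eta n <= M) -> exists l, aconv u l.
Proof.
move=> ueta etaM; apply: anorm_complete => e e0.
have uV n : `|(u n.+1 : normed_of A) - u n| <= (eta n.+1 - eta n)%:C%C.
  by have := ueta n; rewrite -lecR.
have [N NP] := majorant_scauchy uV etaM e0; exists N => m n Nm Nn.
by have := NP m n Nm Nn; rewrite -lecR.
Qed.

End NormBasics.

(** * A decision procedure for identities in noncommutative algebras *)

Section NoncommutativeRing.
Variables (K : comNzRingType) (A : algType K).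

Inductive nc_expr :=
  NcAtom of nat | Nc0 | Nc1 | NcAdd of nc_expr & nc_expr | NcOpp of nc_expr
| NcMul of nc_expr & nc_expr | NcScale of K & nc_expr.

Variable env : seq A.

Fixpoint nc_eval e : A :=
  match e with
  | NcAtom n => nth 0 env n | Nc0 => 0 | Nc1 => 1
  | NcAdd e1 e2 => nc_eval e1 + nc_eval e2
  | NcOpp e1 => - nc_eval e1
  | NcMul e1 e2 => nc_eval e1 * nc_eval e2
  | NcScale k e1 => k *: nc_eval e1
  end.

Definition nc_poly := seq (K * seq nat).

Fixpoint nc_mono (m : seq nat) : A :=
  if m is n :: m' then nth 0 env n * nc_mono m' else 1.

Fixpoint nc_val (p : nc_poly) : A :=
  if p is (k, m) :: p' then k *: nc_mono m + nc_val p' else 0.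

(** Comparison and concatenation of words are spelled out so that [cbv] with a fixed list of names
    computes the words and leaves the coefficients symbolic. *)
Fixpoint nc_same (m1 m2 : seq nat) : bool :=
  match m1, m2 with
  | [::], [::] => true
  | n1 :: m1', n2 :: m2' => if eqn n1 n2 then nc_same m1' m2' else false
  | _, _ => false
  end.

Fixpoint nc_insert (k : K) (m : seq nat) (p : nc_poly) : nc_poly :=
  if p is (k', m') :: p' then
    if nc_same m m' then (k + k', m') :: p' else (k', m') :: nc_insert k m p'
  else [:: (k, m)].

Fixpoint nc_add (p q : nc_poly) : nc_poly :=
  if p is (k, m) :: p' then nc_insert k m (nc_add p' q) else q.

Fixpoint nc_app (m1 m2 : seq nat) : seq nat :=
  if m1 is n :: m1' then n :: nc_app m1' m2 else m2.

Fixpoint nc_monomul (k : K) (m : seq nat) (p : nc_poly) : nc_poly :=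
  if p is (k', m') :: p' then (k * k', nc_app m m') :: nc_monomul k m p' else [::].

Fixpoint nc_mul (p q : nc_poly) : nc_poly :=
  if p is (k, m) :: p' then nc_add (nc_monomul k m q) (nc_mul p' q) else [::].

Fixpoint nc_norm e : nc_poly :=
  match e with
  | NcAtom n => [:: (1, [:: n])] | Nc0 => [::] | Nc1 => [:: (1, [::])]
  | NcAdd e1 e2 => nc_add (nc_norm e1) (nc_norm e2)
  | NcOpp e1 => nc_monomul (-1) [::] (nc_norm e1)
  | NcMul e1 e2 => nc_mul (nc_norm e1) (nc_norm e2)
  | NcScale k e1 => nc_monomul k [::] (nc_norm e1)
  end.

(** A conjunction instead of a boolean, since scalars of [R[i]] do not compute: every collected
    coefficient becomes a goal for [ring] or [field]. *)
Fixpoint nc_zero (p : nc_poly) : Prop :=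
  if p is (k, _) :: p' then k = 0 /\ nc_zero p' else True.

Lemma nc_sameP m1 m2 : nc_same m1 m2 -> m1 = m2.
Proof.
by elim: m1 m2 => [|n m IH] [|n' m'] //=; case: eqnP => // -> /IH ->.
Qed.

Lemma nc_insertE k m p : nc_val (nc_insert k m p) = k *: nc_mono m + nc_val p.
Proof.
elim: p => [|[k' m'] p IH] //=.
case: ifP => [/nc_sameP <-|_] /=; first by rewrite scalerDl addrA.
by rewrite IH addrCA.
Qed.

Lemma nc_addE p q : nc_val (nc_add p q) = nc_val p + nc_val q.
Proof.
by elim: p => [|[k m] p IH] /=; rewrite ?add0r // nc_insertE IH addrA.
Qed.

Lemma nc_monomulE k m p : nc_val (nc_monomul k m p) = (k *: nc_mono m) * nc_val p.
Proof.
have app m1 m2 : nc_mono (nc_app m1 m2) = nc_mono m1 * nc_mono m2.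
  by elim: m1 => [|n m1 IH] /=; rewrite ?mul1r // IH mulrA.
elim: p => [|[k' m'] p IH] /=; first by rewrite mulr0.
rewrite IH mulrDr app; congr (_ + _).
by rewrite -scalerAr -scalerAl scalerA mulrC.
Qed.

Lemma nc_mulE p q : nc_val (nc_mul p q) = nc_val p * nc_val q.
Proof.
elim: p => [|[k m] p IH] /=; first by rewrite mul0r.
by rewrite nc_addE nc_monomulE IH mulrDl.
Qed.

Lemma nc_normE e : nc_val (nc_norm e) = nc_eval e.
Proof.
elim: e => [n||  |e1 IH1 e2 IH2|e IH|e1 IH1 e2 IH2|k e IH] //=.
- by rewrite mulr1 scale1r addr0.
- by rewrite scale1r addr0.
- by rewrite nc_addE IH1 IH2.
- by rewrite nc_monomulE IH /= scaleN1r mulN1r.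
- by rewrite nc_mulE IH1 IH2.
- by rewrite nc_monomulE IH /= -scalerAl mul1r.
Qed.

Lemma nc_correct e1 e2 : nc_zero (nc_norm (NcAdd e1 (NcOpp e2))) ->
  nc_eval e1 = nc_eval e2.
Proof.
move=> h; apply/eqP; rewrite -subr_eq0; apply/eqP.
rewrite -[LHS](nc_normE (NcAdd e1 (NcOpp e2))).
by elim: (nc_norm _) h => [|[k m] p IH] //= [-> /IH ->]; rewrite scale0r addr0.
Qed.

End NoncommutativeRing.

Ltac nc_index x env :=
  lazymatch env with
  | x :: _ => constr:(0%N)
  | _ :: ?env' => let n := nc_index x env' in constr:(n.+1)
  end.
Ltac nc_insert_atom x env :=
  let rec mem l := lazymatch l with
    | nil => constr:(false) | x :: _ => constr:(true) | _ :: ?l' => mem l' end in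
  lazymatch mem env with true => env | false => constr:(x :: env) end.
Ltac nc_atoms t env :=
  lazymatch t with
  | (?a + ?b)%R => let env1 := nc_atoms a env in nc_atoms b env1
  | (- ?a)%R => nc_atoms a env
  | (?a * ?b)%R => let env1 := nc_atoms a env in nc_atoms b env1
  | (_ *: ?a)%R => nc_atoms a env
  | sc _ _ => env
  | (?a ^+ 2)%R => nc_atoms a env
  | (?a *+ 2)%R => nc_atoms a env
  | (0)%R => env
  | (1)%R => env
  | ?x => nc_insert_atom x env
  end.
Ltac nc_reify K t env :=
  lazymatch t with
  | (?a + ?b)%R => let e1 := nc_reify K a env in let e2 := nc_reify K b env in
                   constr:(NcAdd e1 e2)
  | (- ?a)%R => let e1 := nc_reify K a env in constr:(NcOpp e1)
  | (?a * ?b)%R => let e1 := nc_reify K a env in let e2 := nc_reify K b env in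
                   constr:(NcMul e1 e2)
  | (?k *: ?a)%R => let e1 := nc_reify K a env in constr:(@NcScale K k e1)
  | sc _ ?r => constr:(@NcScale K (r%:C%C) (@Nc1 K))
  | (?a ^+ 2)%R => let e1 := nc_reify K a env in constr:(NcMul e1 e1)
  | (?a *+ 2)%R => let e1 := nc_reify K a env in constr:(NcAdd e1 e1)
  | (0)%R => constr:(@Nc0 K)
  | (1)%R => constr:(@Nc1 K)
  | ?x => let n := nc_index x env in constr:(@NcAtom K n)
  end.
Ltac ncnorm R :=
  lazymatch goal with
  | |- @eq ?A ?a ?b =>
    let env0 := nc_atoms a (@nil A) in
    let env := nc_atoms b env0 in
    let ea := nc_reify (R[i] : comNzRingType) a env in
    let eb := nc_reify (R[i] : comNzRingType) b env in
    apply: (@nc_correct _ _ env ea eb);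
    cbv [nc_norm nc_add nc_monomul nc_mul nc_insert nc_same nc_app nc_zero eqn];
    repeat (split; [|]); try exact: I
  end.
Ltac ncring R := ncnorm R; rewrite /=; try ring.
Ltac ncfield R := ncnorm R; rewrite /=; try (by field).

(** * Positive elements of a C*-algebra *)

Section Positivity.
Variables (R : realType) (A : cstarAlgType R).
Implicit Types a b c h x y : A.

(** Norm-closed unital subalgebras as predicates. The clause [forall E, closed_alg E -> E a -> E h]
    says that [h] is a limit of polynomials in [a]; taking for [E] the commutant of [b], it makes
    [h] commute with [b] as soon as [a] does. *)
Record closed_alg (E : A -> Prop) : Prop := ClosedAlg {
  calg1 : E 1;
  calgD : forall a b, E a -> E b -> E (a + b);
  calgZ : forall (k : R[i]) a, E a -> E (k *: a);
  calgM : forall a b, E a -> E b -> E (a * b);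
  calg_lim : forall a, (forall e, 0 < e -> exists2 b, E b & anorm (a - b) <= e) -> E a
}.

Section ClosedAlg.
Variables (E : A -> Prop) (EE : closed_alg E).

Lemma calg0 : E 0.
Proof. by rewrite -(scale0r (1 : A)); apply: calgZ => //; exact: calg1. Qed.
Lemma calgN a : E a -> E (- a).
Proof. by move=> Ea; rewrite -scaleN1r; exact: calgZ. Qed.
Lemma calgB a b : E a -> E b -> E (a - b).
Proof. by move=> Ea Eb; apply: calgD => //; exact: calgN. Qed.
Lemma calg_sc r : E (sc A r).
Proof. by apply: calgZ => //; exact: calg1. Qed.
Lemma calg_aconv (u : nat -> A) (l : A) : aconv u l -> (forall n, E (u n)) -> E l.
Proof.
move=> ul Eu; apply: calg_lim => // e /ul[N NP]; exists (u N) => //.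
by rewrite anormBC NP.
Qed.
End ClosedAlg.

Lemma commZ (k : R[i]) a b : GRing.comm b a -> GRing.comm b (k *: a).
Proof. by rewrite /GRing.comm -scalerAl -scalerAr => ->. Qed.

Lemma closed_alg_comm b : closed_alg (GRing.comm b).
Proof.
split; [exact: commr1|move=> *; exact: commrD|move=> *; exact: commZ|
  move=> *; exact: commrM|].
move=> a h; apply: eq_anorm_small => e e0.
pose M := 2 * anorm b + 1.
have M0 : 0 < M by have := anorm_ge0 b; rewrite /M; lra.
have [c bc ac] := h (e / M) (divr_gt0 e0 M0).
have -> : b * a - a * b = b * (a - c) - (a - c) * b.
  by rewrite mulrBr mulrBl bc opprB addrA subrK.
apply: (le_trans (anormB _ _)).
have h1 := anormM b (a - c); have h2 := anormM (a - c) b.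
have h3 : anorm b * anorm (a - c) <= anorm b * (e / M).
  by rewrite ler_wpM2l ?anorm_ge0.
have h4 : M * (e / M) = e by rewrite mulrC divfK // gt_eqF.
have h5 : 0 < e / M by exact: divr_gt0.
by rewrite (mulrC (anorm (a - c))) in h2; move: h4; rewrite /M mulrDl mul1r; lra.
Qed.

Lemma aconv_eq (u v : nat -> A) (l m : A) : aconv u l -> aconv v m ->
  (forall e : R, 0 < e -> exists N, forall n, (N <= n)%N -> anorm (u n - v n) <= e) ->
  l = m.
Proof.
move=> ul vm uv; apply: eq_anorm_small => e e0.
have e30 : 0 < e / 3 by rewrite divr_gt0.
have [N1 h1] := ul _ e30; have [N2 h2] := vm _ e30; have [N3 h3] := uv _ e30.
pose n := (N1 + N2 + N3)%N.
have {}h1 := h1 n; have {}h2 := h2 n; have {}h3 := h3 n.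
move: (h1 (leq_trans (leq_addr _ _) (leq_addr _ _))).
move: (h2 (leq_trans (leq_addl _ _) (leq_addr _ _))) (h3 (leq_addl _ _)).
rewrite (anormBC (u n) l) => g2 g3 g1.
apply: (le_trans (anorm_dist _ (u n) _)).
have := anorm_dist (u n) (v n) m; lra.
Qed.

Lemma aconv_uniq (u : nat -> A) (l m : A) : aconv u l -> aconv u m -> l = m.
Proof.
move=> ul um; apply: (aconv_eq ul um) => e e0; exists 0%N => n _.
by rewrite subrr anorm0 ltW.
Qed.

(** The equation for [y] means [(1 - y)^2 = 1 - x]. The majorant [eta] is the same iteration in the
    scalar case [x = 1], which increases and stays below [1]; this covers norm exactly [1]. *)
Lemma sqrt_iteration x : anorm x <= 1 -> exists y, [/\ anorm y <= 1,
  y = 2^-1%:C%C *: (x + y * y), star x = x -> star y = y &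
  forall E, closed_alg E -> E x -> E y].
Proof.
move=> x1.
pose u := fix u n := if n is n'.+1 then 2^-1%:C%C *: (x + u n' * u n') else 0 : A.
pose eta := fix eta n := if n is n'.+1 then 2^-1 * (1 + eta n' * eta n') else 0 : R.
have uE E : closed_alg E -> E x -> forall n, E (u n).
  move=> EE Ex; elim=> [|n IH] /=; first exact: calg0.
  by apply: calgZ => //; apply: calgD => //; exact: calgM.
(* All iterates lie in the closed algebra of [x], hence commute, so a difference of two squares
   factors as difference times sum. *)
have ucomm m n : GRing.comm (u m) (u n).
  apply: (uE _ (closed_alg_comm _)); apply: commr_sym.
  by apply: (uE _ (closed_alg_comm _)).
have eta_ge0 n : 0 <= eta n.
  elim: n => [|n IH] //=.
  by rewrite mulr_ge0 // addr_ge0 // mulr_ge0.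
have eta_le1 n : eta n <= 1.
  elim: n => [|n IH] //=.
  have := eta_ge0 n; have : eta n * eta n <= 1 * 1 by rewrite ler_pM.
  lra.
have u_le n : anorm (u n) <= eta n.
  elim: n => [|n IH] /=; first by rewrite anorm0.
  rewrite anormZr ger0_norm // ler_wpM2l //.
  apply: (le_trans (anormD _ _)); apply: lerD => //.
  by apply: (le_trans (anormM _ _)); rewrite ler_pM ?anorm_ge0.
have du n : anorm (u n.+1 - u n) <= eta n.+1 - eta n.
  elim: n => [|n IH].
    by rewrite /= !mulr0 !addr0 !subr0 anormZr ger0_norm // ler_wpM2l.
  have -> : u n.+2 - u n.+1 = 2^-1%:C%C *: ((u n.+1 - u n) * (u n.+1 + u n)).
    rewrite [u n.+2]/= [X in _ - X]/= -/(u n) -/(u n.+1) -scalerBr; congr (_ *: _).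
    rewrite mulrBl !mulrDr (ucomm n n.+1) opprD addrACA subrr add0r opprD.
    by rewrite -addrA addNKr.
  have -> : eta n.+2 - eta n.+1 = 2^-1 * ((eta n.+1 - eta n) * (eta n.+1 + eta n)).
    have etaS k : eta k.+1 = 2^-1 * (1 + eta k * eta k) by [].
    by rewrite (etaS n.+1) [X in _ - X = _]etaS; ring.
  rewrite anormZr ger0_norm // ler_wpM2l //.
  apply: (le_trans (anormM _ _)); rewrite ler_pM ?anorm_ge0 //.
  by apply: (le_trans (anormD _ _)); rewrite lerD.
have [y uy] := majorant_cvg du eta_le1.
have y1 : anorm y <= 1.
  apply/ler_addgt0Pl => e e0; have [N /(_ N (leqnn _))] := uy _ e0.
  have := u_le N; have := eta_le1 N; have := anorm_dist y (u N) 0.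
  by rewrite !subr0 anormBC; lra.
exists y; split => //.
- apply: (@aconv_eq (fun n => u n.+1) (fun n => u n.+1)).
  + by move=> e /uy[N NP]; exists N => n Nn; apply: NP; exact: leqW.
  + move=> e /uy[N NP]; exists N => n Nn /=.
    rewrite -scalerBr opprD addrACA subrr add0r anormZr ger0_norm //.
    have -> : u n * u n - y * y = (u n - y) * u n + y * (u n - y).
      by rewrite mulrBl mulrBr addrA subrK.
    apply: (@le_trans _ _ (2^-1 * (e + e))); last by lra.
    rewrite ler_wpM2l // (le_trans (anormD _ _)) // lerD //.
      apply: (le_trans (anormM _ _)); rewrite -[leRHS]mulr1 ler_pM ?anorm_ge0 ?NP //.
      exact: le_trans (u_le n) (eta_le1 n).
    by apply: (le_trans (anormM _ _)); rewrite -[leRHS]mul1r ler_pM ?anorm_ge0 ?NP.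
  + by move=> e e0; exists 0%N => n _; rewrite subrr anorm0 ltW.
- move=> sx; apply: (@aconv_uniq u) => //.
  have su n : star (u n) = u n.
    by elim: n => [|n IH] /=; rewrite ?star0 // starZr starD starM sx IH.
  move=> e /uy[N NP]; exists N => n Nn.
  by rewrite -su -starB anorm_star NP.
- by move=> E EE Ex; apply: calg_aconv uy (uE _ EE Ex).
Qed.

(* [h + i k] is [r] times a unitary, and [h] is its real part. *)
Lemma unitary_trick (h k : A) (r : R) : star h = h -> star k = k ->
  GRing.comm h k -> 0 <= r -> h * h + k * k = sc A (r ^+ 2) -> anorm h <= r.
Proof.
move=> sh sk hk r0 e.
pose v := h + 'i *: k.
have sv : star v = h - 'i *: k.
  by rewrite /v starD starZ sh sk conjCi scaleNr.
have nv : anorm v = r.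
  apply/eqP; rewrite -(@eqrXn2 _ 2) ?anorm_ge0 //; apply/eqP.
  rewrite -cstar_identity sv /v mulrBl !mulrDr -!scalerAl -!scalerAr hk scalerA.
  rewrite -(expr2 'i) sqrCi scaleN1r opprD opprK addrA addrK e anorm_sc.
  by rewrite ger0_norm // exprn_ge0.
have -> : h = 2^-1%:C%C *: (v + star v).
  rewrite sv /v addrACA subrr addr0 -mulr2n -(scaler_nat 2 h) scalerA.
  rewrite -(rmorph_nat (real_complex R)) -rmorphM /= mulVf ?rmorph1 ?scale1r //.
rewrite anormZr ger0_norm //.
have := anormD v (star v); rewrite anorm_star nv; lra.
Qed.

(* Positivity without spectra: a self-adjoint [a] has spectrum in [0, +oo) iff [‖t - a‖ <= t]
   for some [t >= 0]. *)
Definition pos a := star a = a /\ exists2 t : R, 0 <= t & anorm (sc A t - a) <= t.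

Lemma pos_star a : pos a -> star a = a. Proof. by case. Qed.

(** Here [a = t (1 - x)] with [x = 1 - a / t] of norm at most [1], and the iteration takes the root
    of [1 - x]. The witness [t = 0], which forces [a = 0], is treated apart because of the
    division. *)
Lemma pos_sqrt a : pos a -> exists h, [/\ pos h, h * h = a &
  forall E, closed_alg E -> E a -> E h].
Proof.
case=> sa [t]; rewrite le_eqVlt => /predU1P[<-|t0].
  rewrite sc0 sub0r anormN => a0.
  have {a0}-> : a = 0 by apply/anorm_eq0/eqP; rewrite eq_le a0 anorm_ge0.
  exists 0; split; [|by rewrite mulr0|by move=> E EE _; exact: calg0].
  by split; [exact: star0|exists 0; rewrite // sc0 subr0 anorm0].
move=> ta.
have tn0 : t != 0 by rewrite gt_eqF.
pose x := 1 - t^-1%:C%C *: a.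
have x1 : anorm x <= 1.
  have -> : x = t^-1%:C%C *: (sc A t - a).
    by rewrite scalerBr scScale mulVf // sc1.
  by rewrite anormZr ger0_norm ?invr_ge0 ?(ltW t0) // ler_pdivrMl // mulr1.
have sx : star x = x by rewrite /x starB star1 starZr sa.
have [y [y1 ye sy Ey]] := sqrt_iteration x1.
pose s := Num.sqrt t.
have s0 : 0 <= s by exact: sqrtr_ge0.
have ss : s * s = t by rewrite -expr2 sqr_sqrtr // ltW.
exists (s%:C%C *: (1 - y)); split.
- split; first by rewrite starZr starB star1 sy.
  exists s => //.
  have -> : sc A s - s%:C%C *: (1 - y) = s%:C%C *: y.
    by rewrite scalerBr opprB addrC subrK.
  by rewrite anormZr ger0_norm // -[leRHS]mulr1 ler_wpM2l.
- rewrite -scalerAl -scalerAr realZA ss.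
  have -> : (1 - y) * (1 - y) = 1 - x.
    have : 2%:R%:C%C *: y = x + y * y.
      by rewrite [in LHS]ye realZA mulfV // scale1r.
    rewrite rmorph_nat scaler_nat mulr2n => h.
    have -> : x = y + y - y * y by rewrite h addrK.
    ncring R.
  by rewrite /x opprB addrC subrK realZA mulfV // scale1r.
- move=> E EE Ea; apply: calgZ => //; apply: calgB => //; first exact: calg1.
  apply: Ey => //; apply: calgB => //; first exact: calg1.
  exact: calgZ.
Qed.

(** Let [k] be a square root of [1 - h^2 / t] commuting with [h]. Then [h] and [sqrt t k] are the
    two parts of [sqrt t] times a unitary, so [sqrt t k] has norm at most [sqrt t]; its square is
    [t - h^2]. *)
Lemma pos_sqr_le h t : star h = h -> anorm h ^+ 2 <= t ->
  anorm (sc A t - h * h) <= t.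
Proof.
move=> sh ht.
have [T0|T0] := eqVneq t 0.
  have h0 : anorm h = 0.
    apply/eqP; rewrite -sqrf_eq0 eq_le sqr_ge0 andbT; by rewrite T0 in ht.
  by rewrite (anorm_eq0 _ h0) mulr0 subr0 anorm_sc T0 normr0.
have t0 : 0 < t by rewrite lt_def T0 (le_trans (sqr_ge0 _) ht).
have tn0 : t != 0 by rewrite gt_eqF.
pose x := t^-1%:C%C *: (h * h).
have x1 : anorm x <= 1.
  rewrite /x anormZr ger0_norm ?invr_ge0 ?(ltW t0) // ler_pdivrMl // mulr1.
  by rewrite anorm_sqr.
have sx : star x = x by rewrite /x starZr starM sh.
have pk : pos (1 - x).
  split; first by rewrite starB star1 sx.
  by exists 1 => //; rewrite sc1 opprB addrC subrK.
have [k [[sk _] kk Ek]] := pos_sqrt pk.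
pose s := Num.sqrt t.
have s0 : 0 < s by rewrite sqrtr_gt0.
have ss : s * s = t by rewrite -expr2 sqr_sqrtr // ltW.
have hk : GRing.comm h k.
  apply: (Ek _ (closed_alg_comm _)); apply: commrB; first exact: commr1.
  by apply: commZ; apply: commrM.
have nk : anorm (s%:C%C *: k) <= s.
  apply: (@unitary_trick (s%:C%C *: k) h) => //; rewrite ?starZr ?sk ?(ltW s0) //.
    by apply: commr_sym; exact: commZ.
  rewrite -scalerAl -scalerAr realZA ss kk scalerBr /x realZA mulfV // scale1r.
  by rewrite subrK expr2 ss.
have -> : sc A t - h * h = (s%:C%C *: k) * (s%:C%C *: k).
  by rewrite -scalerAl -scalerAr realZA ss kk scalerBr /x realZA mulfV // scale1r.
by apply: (le_trans (anormM _ _)); rewrite -ss ler_pM ?anorm_ge0.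
Qed.

Lemma pos_sqr h : star h = h -> pos (h * h).
Proof.
move=> sh; split; first by rewrite starM sh.
by exists (anorm h ^+ 2); rewrite ?sqr_ge0 // pos_sqr_le.
Qed.

(** Any [t] above the norm is a witness for [pos]. This independence of the witness makes positivity
    stable under limits. *)
Lemma pos_bound a t : pos a -> anorm a <= t -> anorm (sc A t - a) <= t.
Proof.
move=> /pos_sqrt[h [[sh _] <- _]]; rewrite anorm_sqr //.
exact: pos_sqr_le.
Qed.

Lemma posD a b : pos a -> pos b -> pos (a + b).
Proof.
move=> [sa [s s0 sP]] [sb [t t0 tP]]; split; first by rewrite starD sa sb.
exists (s + t); first exact: addr_ge0.
rewrite scD opprD addrACA; apply: (le_trans (anormD _ _)); exact: lerD.
Qed.

Lemma posZ (r : R) a : 0 <= r -> pos a -> pos (r%:C%C *: a).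
Proof.
move=> r0 [sa [t t0 tP]]; split; first by rewrite starZr sa.
exists (r * t); first exact: mulr_ge0.
by rewrite -scScale -scalerBr anormZr ger0_norm // ler_wpM2l.
Qed.

Lemma pos0 : pos 0.
Proof. by rewrite -(mulr0 0); apply: pos_sqr; exact: star0. Qed.

Lemma pos1 : pos 1.
Proof. by rewrite -(mulr1 1); apply: pos_sqr; exact: star1. Qed.

Lemma pos_sc r : 0 <= r -> pos (sc A r).
Proof. by move=> r0; apply: posZ => //; exact: pos1. Qed.

Lemma pos_sum (I : Type) (r : seq I) (P : pred I) (F : I -> A) :
  (forall i, P i -> pos (F i)) -> pos (\sum_(i <- r | P i) F i).
Proof. by move=> EF; elim/big_ind: _ => //; [exact: pos0|exact: posD]. Qed.

Lemma posM a b : pos a -> pos b -> GRing.comm a b -> pos (a * b).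
Proof.
move=> /pos_sqrt[h [[sh _] ha Eh]] /pos_sqrt[k [[sk _] kb Ek]] ab.
have hk : GRing.comm h k.
  apply: (Ek _ (closed_alg_comm _)); apply: commr_sym.
  by apply: (Eh _ (closed_alg_comm _)); apply: commr_sym.
have -> : a * b = (h * k) * (h * k).
  by rewrite -ha -kb !mulrA -(mulrA h k h) -hk !mulrA.
by apply: pos_sqr; rewrite starM sh sk hk.
Qed.

(** The commuting product [(r - a)(r + a)] is positive; with [z] its square root, [a + i z] is [r]
    times a unitary. *)
Lemma pos_norm_le a r : star a = a -> 0 <= r -> pos (sc A r - a) ->
  pos (sc A r + a) -> anorm a <= r.
Proof.
move=> sa r0 p1 p2.
have c : GRing.comm (sc A r - a) (sc A r + a).
  apply: commr_sym; apply: commrB.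
    apply: commr_sym; apply: commrD; first by [].
    by apply: commr_sym; apply: commZ; exact: commr1.
  apply: commr_sym; apply: commrD => //.
  by apply: commZ; exact: commr1.
have /pos_sqrt[z [[sz _] zz Ez]] := posM p1 p2 c.
have az : GRing.comm a z.
  have asc : GRing.comm a (sc A r) by apply: commZ; exact: commr1.
  apply: (Ez _ (closed_alg_comm _)); apply: commrM.
    exact: commrB.
  exact: commrD.
apply: (unitary_trick sa sz az) => //.
rewrite zz; ncring R.
Qed.

Lemma norm_le_pos a r : star a = a -> anorm a <= r -> pos (sc A r - a).
Proof.
move=> sa ar; split; first by rewrite starB star_sc sa.
exists r; first exact: le_trans (anorm_ge0 _) ar.
by rewrite opprB addrC subrK.
Qed.

Lemma norm_le_posD a r : star a = a -> anorm a <= r -> pos (sc A r + a).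
Proof.
move=> sa ar; rewrite -[a]opprK; apply: norm_le_pos; last by rewrite anormN.
by rewrite starN sa.
Qed.

Lemma pos_le_norm a r : 0 <= r -> pos a -> pos (sc A r - a) -> anorm a <= r.
Proof.
move=> r0 pa pra; apply: pos_norm_le => //; first by case: pa.
by apply: posD => //; exact: pos_sc.
Qed.

Lemma pos_lim a : (forall e, 0 < e -> exists2 b, pos b & anorm (a - b) <= e) -> pos a.
Proof.
move=> h; split.
  apply: eq_anorm_small => e e0.
  have e20 : 0 < e / 2 by rewrite divr_gt0.
  have [b [sb _] ab] := h _ e20.
  apply: (le_trans (anorm_dist _ b _)).
  by rewrite -{1}sb -starB anorm_star (anormBC b); lra.
have := anorm_ge0 a => a0.
exists (anorm a + 1); first by lra.
apply/ler_addgt0Pl => e e0.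
(* The cap by [1] keeps the norm of every approximant below [anorm a + 1], so one witness serves all
   of them. *)
have e10 : 0 < Num.min e 1 by rewrite lt_min e0 ltr01.
have [b pb ab] := h _ e10.
have := ab; rewrite le_min => /andP[ab1 ab2].
apply: (le_trans (anorm_dist _ b _)).
rewrite addrC; apply: lerD; first by rewrite anormBC.
apply: pos_bound => //.
have := anorm_dist b a 0; rewrite !subr0 anormBC; lra.
Qed.

Lemma pos_sqr_eq0 a : star a = a -> a * a = 0 -> a = 0.
Proof.
move=> sa aa; apply/anorm_eq0/eqP; rewrite -sqrf_eq0 -anorm_sqr // aa anorm0 //.
Qed.

End Positivity.

(** * Positivity of [star b * b], inverses and inverse square roots *)

Section StarPositivity.
Variables (R : realType) (A : cstarAlgType R).
Implicit Types a b c h x y : A.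

(* With [T = ‖c‖^2], [e = c c^*] is positive of norm [T], so [e (T + e)^2] dominates [2 T e^2],
   whose norm is [2 T^3]; but [e (T + e)^2 = c (T + c^* c)^2 c^*] has norm at most [T^3], as
   [0 <= - c^* c <= T]. *)
Lemma neg_star_mul_eq0 c : pos (- (star c * c)) -> c = 0.
Proof.
set d := - (star c * c) => pd.
pose T := anorm c ^+ 2.
have T0 : 0 <= T by exact: sqr_ge0.
pose e := c * star c.
have ncc : anorm (star c * c) = T by rewrite cstar_identity.
have ne : anorm e = T.
  by rewrite /e -{1}[c]starK cstar_identity anorm_star.
have se : star e = e by rewrite /e starM starK.
have pe : pos e.
  have [x [y [sx sy cE]]] : exists x y, [/\ star x = x, star y = y & c = x + 'i *: y].
    exists (re_part c), (im_part c); split; last exact: re_im_part.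
      exact: star_re_part.
    exact: star_im_part.
  have -> : e = 2%:R%:C%C *: (x * x + y * y) + d.
    have scE : star c = x - 'i *: y.
      by rewrite cE starD starZ conjCi scaleNr sx sy.
    apply/eqP; rewrite /d eq_sym subr_eq /e scE cE; apply/eqP.
    have i2 : 'i * 'i = -1 :> R[i] by rewrite -expr2 sqrCi.
    rewrite -(scale1r (y * y)) -[X in X *: (y * y)]opprK -i2.
    by ncring R; rewrite rmorph_nat; ring.
  by apply: posD => //; apply: posZ => //; apply: posD; exact: pos_sqr.
have Td : anorm (sc A T - d) <= T by apply: pos_bound; rewrite // /d anormN ncc.
pose w := e * ((sc A T + e) * (sc A T + e)).
have cT (k : R[i]) (z : A) : GRing.comm z (k *: 1) by apply: commZ; exact: commr1.
have eT : GRing.comm e (sc A T + e) by apply: commrD => //; exact: cT.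
have nw : anorm w <= T * T * T.
  have -> : w = c * ((sc A T - d) * (sc A T - d)) * star c.
    by rewrite /w /e /d opprK; ncring R.
  have h1 := anormM (c * ((sc A T - d) * (sc A T - d))) (star c).
  have h2 := anormM c ((sc A T - d) * (sc A T - d)).
  have h3 := anormM (sc A T - d) (sc A T - d).
  rewrite anorm_star in h1; apply: (le_trans h1).
  have -> : T * T * T = anorm c * (T * T) * anorm c by rewrite /T; ring.
  rewrite ler_wpM2r ?anorm_ge0 //; apply: (le_trans h2).
  rewrite ler_wpM2l ?anorm_ge0 //; apply: (le_trans h3).
  by rewrite ler_pM ?anorm_ge0.
have pTe : pos (sc A T + e) by apply: posD => //; exact: pos_sc.
have sw : star w = w.
  rewrite /w (starM e) (starM (_ + _)) (starD (sc A T)) star_sc se.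
  by rewrite (commrM eT eT).
have pee : pos (e * e) by exact: pos_sqr.
have h : anorm ((2 * T)%:C%C *: (e * e)) <= T * T * T.
  apply: pos_le_norm; [exact: mulr_ge0 (mulr_ge0 T0 T0) T0| |].
    by apply: posZ => //; rewrite mulr_ge0.
  have -> : sc A (T * T * T) - (2 * T)%:C%C *: (e * e) =
     (sc A (T * T * T) - w) + ((T * T)%:C%C *: e + e * (e * e)).
    by rewrite /w; ncring R.
  apply: posD; first exact: norm_le_pos.
  apply: posD; first by apply: posZ => //; rewrite mulr_ge0.
  by apply: posM => //; exact: commrM.
have h2 := anorm_sqr se; rewrite ne in h2.
move: h; rewrite anormZr h2 ger0_norm; last by rewrite mulr_ge0.
move=> h.
have : T * T * T <= 0 by move: h; rewrite expr2; lra.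
have [T00|T1] := eqVneq T 0; last first.
  have T1' : 0 < T by rewrite lt_def T1.
  by rewrite leNgt (mulr_gt0 (mulr_gt0 T1' T1') T1').
by move=> _; apply/anorm_eq0/eqP; rewrite -sqrf_eq0 -/T T00.
Qed.

(** With [m = |a|] for [a = star b * b], the element [n = (m - a) / 2] is the negative part of [a],
    and [n a n = - m n^2]. So [- star (b n) * (b n)] is positive, whence [b n = 0] by
    [neg_star_mul_eq0]; then [n^3 = 0], so [n = 0] and [a = m]. *)
Lemma pos_star_mul b : pos (star b * b).
Proof.
pose a := star b * b.
have sa : star a = a by rewrite /a starM starK.
have [m [pm mm Em]] := pos_sqrt (pos_sqr sa).
have am : a * m = m * a.
  by apply: (Em _ (closed_alg_comm _)); exact: commrM.
have sm := pos_star pm.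
have [n nE] : exists n, n = 2^-1%:C%C *: (m - a) by eexists.
have sn : star n = n by rewrite nE starZr starB sm sa.
have nn : n * n = 2^-1%:C%C *: (a * a - m * a).
  transitivity (4^-1%:C%C *: (m * m - a * m - m * a + a * a)); first by rewrite nE; ncfield R.
  by rewrite am mm; ncfield R.
have mn : m * n = n * n.
  by rewrite nn nE -scalerAr mulrBr mm.
have nm : n * m = m * n by rewrite nE -!scalerAr -scalerAl mulrBl mulrBr am.
have h : n * a * n = - (m * (n * n)).
  have -> : a = m - 2%:R%:C%C *: n by rewrite nE; ncfield R.
  rewrite mulrBr mulrBl nm mn -scalerAr -scalerAl.
  have -> : m * (n * n) = n * n * n by rewrite mulrA mn.
  by ncring R.
have bn0 : b * n = 0.
  apply: neg_star_mul_eq0.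
  rewrite starM sn -!mulrA (mulrA (star b)) mulrA -/a h opprK.
  by apply: posM; [|exact: pos_sqr|apply: commrM; rewrite /GRing.comm nm].
have n0 : n = 0.
  have : m * (n * n) = 0.
    by apply: oppr_inj; rewrite -h oppr0 /a -(mulrA n) -(mulrA (star b)) bn0 !mulr0.
  rewrite mulrA mn => n3.
  apply: pos_sqr_eq0 => //; apply: pos_sqr_eq0; first by rewrite starM sn.
  by rewrite (mulrA (n * n)) n3 mul0r.
have -> : star b * b = m.
  apply/eqP; rewrite -/a eq_sym -subr_eq0; apply/eqP.
  transitivity (2%:R%:C%C *: n); first by rewrite nE; ncfield R.
  by rewrite n0 scaler0.
exact: pm.
Qed.

Lemma pos_mul_star b : pos (b * star b).
Proof. by have := pos_star_mul (star b); rewrite starK. Qed.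

Lemma pos_conj a b : pos a -> pos (star b * a * b).
Proof.
move=> /pos_sqrt[h [[sh _] <- _]].
have -> : star b * (h * h) * b = star (h * b) * (h * b).
  by rewrite starM sh !mulrA.
exact: pos_star_mul.
Qed.

Lemma pos_conjr a b : pos a -> pos (b * a * star b).
Proof. by move=> /(pos_conj (star b)); rewrite starK. Qed.

Lemma norm_le_star_mul a r : 0 <= r -> pos (sc A (r ^+ 2) - star a * a) -> anorm a <= r.
Proof.
move=> r0 h; rewrite -(@ler_pXn2r _ 2) ?nnegrE ?anorm_ge0 // -cstar_identity.
by apply: pos_le_norm => //; [exact: sqr_ge0|exact: pos_star_mul].
Qed.

Lemma star_mul_le_norm a r : anorm a <= r -> pos (sc A (r ^+ 2) - star a * a).
Proof.
move=> ar; apply: norm_le_pos; first by rewrite starM starK.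
by rewrite cstar_identity ler_pXn2r ?nnegrE ?anorm_ge0 // (le_trans (anorm_ge0 a)).
Qed.

Lemma neumann x : anorm x < 1 -> exists b, [/\ (1 - x) * b = 1, b * (1 - x) = 1 &
  forall E, closed_alg E -> E x -> E b].
Proof.
move=> x1.
pose u := fix u n := if n is n'.+1 then 1 + x * u n' else 0 : A.
pose eta := fix eta n := if n is n'.+1 then 1 + anorm x * eta n' else 0 : R.
have x0 := anorm_ge0 x.
have eta_le n : eta n <= (1 - anorm x)^-1.
  elim: n => [|n IH] /=; first by rewrite invr_ge0 subr_ge0 ltW.
  have : anorm x * eta n <= anorm x * (1 - anorm x)^-1 by rewrite ler_wpM2l.
  have : (1 - anorm x) * (1 - anorm x)^-1 = 1 by rewrite mulfV // subr_eq0 gt_eqF.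
  lra.
have du n : anorm (u n.+1 - u n) <= eta n.+1 - eta n.
  elim: n => [|n IH]; first by rewrite /= !mulr0 !addr0 !subr0 anorm1.
  have -> : u n.+2 - u n.+1 = x * (u n.+1 - u n).
    have uS k : u k.+1 = 1 + x * u k by [].
    by rewrite (uS n.+1) [X in _ - X = _]uS; ncring R.
  have -> : eta n.+2 - eta n.+1 = anorm x * (eta n.+1 - eta n).
    have uS k : eta k.+1 = 1 + anorm x * eta k by [].
    by rewrite (uS n.+1) [X in _ - X = _]uS; ring.
  by apply: (le_trans (anormM _ _)); rewrite ler_wpM2l.
have [b ub] := majorant_cvg du eta_le.
have Eb E : closed_alg E -> E x -> E b.
  move=> EE Ex; apply: calg_aconv ub _ => //; elim=> [|n IH] /=; first exact: calg0.
  by apply: calgD => //; [exact: calg1|exact: calgM].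
have bE : b = 1 + x * b.
  apply: (@aconv_eq _ _ (fun n => u n.+1) (fun n => u n.+1)).
  - by move=> e /ub[N NP]; exists N => n Nn; apply: NP; exact: leqW.
  - move=> e /ub[N NP]; exists N => n Nn /=.
    have -> : 1 + x * u n - (1 + x * b) = x * (u n - b) by ncring R.
    apply: (le_trans (anormM _ _)).
    by rewrite -[leRHS]mul1r ler_pM ?anorm_ge0 ?(ltW x1) ?NP.
  - by move=> e e0; exists 0%N => n _; rewrite subrr anorm0 ltW.
have bx : x * b = b * x.
  by apply: (Eb _ (closed_alg_comm _)).
have b1 : (1 - x) * b = 1 by rewrite mulrBl mul1r {1}bE addrK.
by exists b; split => //; rewrite mulrBr mulr1 -bx -[X in X - _]mul1r -mulrBl.
Qed.

(** If [t] witnesses [h - d >= 0], then [h = (t + d)(1 - x)] with [x] of norm at most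
    [t / (t + d) < 1], and the Neumann series inverts [h]. The inverse root is [k = g b], with [g]
    the root of [h] and [b] its inverse. *)
Lemma pos_inv_sqrt h (d : R) : 0 < d -> pos (h - sc A d) ->
  exists g k, [/\ pos g, pos k, g * g = h, g * k = 1 & k * g = 1] /\
    forall E, closed_alg E -> E h -> E g /\ E k.
Proof.
move=> d0 phd.
have ph : pos h by rewrite -(subrK (sc A d) h); apply: posD => //; apply: pos_sc; exact: ltW.
have sh := pos_star ph.
have [_ [t t0 ht]] := phd.
have [g [pg gg Eg]] := pos_sqrt ph.
have td0 : 0 < t + d by lra.
pose x := 1 - (t + d)^-1%:C%C *: h.
have x1 : anorm x < 1.
  have -> : x = (t + d)^-1%:C%C *: (sc A t - (h - sc A d)).
    rewrite /x opprB addrA -scD scalerBr scScale mulVf ?sc1 // gt_eqF //.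
  rewrite anormZr ger0_norm ?invr_ge0 ?(ltW td0) // ltr_pdivrMl // mulr1.
  by lra.
have [b0 [b1 _ Eb0]] := neumann x1.
pose b := (t + d)^-1%:C%C *: b0.
have hb : h * b = 1.
  by rewrite -b1 /x /b; ncring R.
have Eb E : closed_alg E -> E h -> E b.
  move=> EE Eh; apply: calgZ => //; apply: Eb0 => //; apply: calgB => //.
    exact: calg1.
  exact: calgZ.
have bh : b * h = 1.
  by rewrite -[RHS]hb; apply: esym; apply: (Eb _ (closed_alg_comm _)).
have sb : star b = b.
  have : star b * h = 1 by rewrite -[RHS](star1 A) -hb starM sh.
  by move=> h1; rewrite -[RHS]mul1r -h1 -mulrA hb mulr1.
have gb : g * b = b * g.
  apply: (Eb _ (closed_alg_comm _)).
  by apply: commr_sym; apply: (Eg _ (closed_alg_comm _)).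
have sg := pos_star pg.
have pb : pos b.
  have -> : b = (g * b) * (g * b).
    by rewrite -[RHS]mulrA (mulrA b) -gb -(mulrA g b b) (mulrA g g) gg mulrA hb mul1r.
  by apply: pos_sqr; rewrite starM sg sb gb.
exists g, (g * b); split; first split => //.
- exact: posM.
- by rewrite mulrA gg.
- by rewrite gb -mulrA gg.
- move=> E EE Eh; split; first exact: Eg.
  by apply: calgM => //; [exact: Eg|exact: Eb].
Qed.

(** By commutation [(g - g')(g + g') = 0], and [g + g' = (1 + k g') g] is invertible because
    [1 + k g' >= 1]. *)
Lemma pos_sqrt_uniq (g g' k : A) : pos g -> pos g' -> pos k -> g * g = g' * g' ->
  g * g' = g' * g -> g * k = 1 -> k * g = 1 -> g = g'.
Proof.
move=> pg pg' pk gg cg gk kg.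
have kg' : k * g' = g' * k.
  by rewrite -[in LHS](mulr1 g') -gk !mulrA -(mulrA k) -cg mulrA kg mul1r.
have p1 : pos (1 + k * g' - sc A 1).
  by rewrite sc1 addrC addKr; exact: posM.
have [h1 [h2 [[_ _ h11 h12 _] _]]] := pos_inv_sqrt ltr01 p1.
have h : (g - g') * (1 + k * g') = 0.
  have : (g - g') * (g + g') = 0.
    transitivity (g * g - g' * g' + (g * g' - g' * g)); first by ncring R.
    by rewrite gg cg !subrr addr0.
  have -> : g + g' = (1 + k * g') * g.
    by rewrite mulrDl mul1r -mulrA -cg mulrA kg mul1r.
  move=> /(congr1 (fun z => z * k)).
  by rewrite mul0r -!mulrA gk mulr1.
have h1122 : (h1 * h1) * (h2 * h2) = 1 by rewrite mulrA -(mulrA h1) h12 mulr1 h12.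
apply/eqP; rewrite -subr_eq0; apply/eqP.
by rewrite -[LHS]mulr1 -h1122 h11 mulrA h mul0r.
Qed.

End StarPositivity.

(** * Automatic continuity of homomorphisms and characters *)

Section StarhomContractive.
Variables (R : realType) (A B : cstarAlgType R) (f : A -> B).
Hypothesis hf : starhom f.

Lemma hom_pos a : pos a -> pos (f a).
Proof.
move=> /pos_sqrt[h [[sh _] <- _]]; rewrite (homM hf).
by apply: pos_sqr; rewrite -(hom_star hf) sh.
Qed.

(** A norm bound [r] is the positivity of [r^2 - star a * a], and homomorphisms preserve positivity
    since they preserve squares of self-adjoint elements. *)
Lemma hom_norm_le a : anorm (f a) <= anorm a.
Proof.
apply: norm_le_star_mul; first exact: anorm_ge0.
rewrite -(hom_sc hf) -(hom_star hf) -(homM hf) -(homB hf).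
by apply: hom_pos; apply: star_mul_le_norm.
Qed.

Lemma hom_aconv u l : aconv u l -> aconv (fun n => f (u n)) (f l).
Proof.
move=> ul e /ul[N NP]; exists N => n Nn; rewrite -(homB hf).
by apply: le_trans (hom_norm_le _) (NP n Nn).
Qed.

Lemma closed_alg_preimage (E : B -> Prop) :
  closed_alg E -> closed_alg (fun a => E (f a)).
Proof.
move=> EE; split.
- by rewrite (hom1 hf); exact: calg1.
- by move=> a b Ea Eb; rewrite (homD hf); exact: calgD.
- by move=> k a Ea; rewrite (homZ hf); exact: calgZ.
- by move=> a b Ea Eb; rewrite (homM hf); exact: calgM.
- move=> a h; apply: (calg_lim EE) => e /h[b Eb ab]; exists (f b) => //.
  by rewrite -(homB hf); apply: le_trans ab; exact: hom_norm_le.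
Qed.

End StarhomContractive.

Section Characters.
Variables (R : realType) (A : cstarAlgType R).

Record character (chi : A -> R[i]) : Prop := Character {
  charD : forall a b, chi (a + b) = chi a + chi b;
  charZ : forall k a, chi (k *: a) = k * chi a;
  char1 : chi 1 = 1;
  charM : forall a b, chi (a * b) = chi a * chi b;
  char_star : forall a, chi (star a) = Num.conj (chi a)
}.

Variables (chi : A -> R[i]) (hchi : character chi).

Lemma charN a : chi (- a) = - chi a.
Proof. by rewrite -scaleN1r (charZ hchi) mulN1r. Qed.
Lemma charB a b : chi (a - b) = chi a - chi b.
Proof. by rewrite (charD hchi) charN. Qed.
Lemma char0 : chi 0 = 0.
Proof. by rewrite -(scale0r (0 : A)) (charZ hchi) mul0r. Qed.
Lemma char_sc r : chi (sc A r) = r%:C%C.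
Proof. by rewrite (charZ hchi) (char1 hchi) mulr1. Qed.

(* If [|chi a| > ‖a‖] then [1 - a / chi a] is both invertible and in the kernel of [chi]. *)
Lemma char_norm_le a : `|chi a| <= (anorm a)%:C%C.
Proof.
rewrite real_leNgt ?normr_real //; last first.
  by rewrite complex_real.
apply/negP => lt.
have chi0 : chi a != 0.
  apply/eqP => c0; move: lt.
  by rewrite c0 normr0 -(rmorph0 (real_complex R)) ltcR ltNge anorm_ge0.
have x1 : anorm ((chi a)^-1 *: a) < 1.
  rewrite -ltcR anormZ normfV ltr_pdivrMl ?normr_gt0 // mulr1 //.
have [b [h _ _]] := neumann x1.
move/(congr1 chi): h.
rewrite (charM hchi) charB (char1 hchi) (charZ hchi) mulVf // subrr mul0r => /eqP.
by rewrite eq_sym oner_eq0.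
Qed.

Lemma char_pos_ge0 a : pos a -> 0 <= chi a.
Proof.
move=> /pos_sqrt[h [[sh _] <- _]].
rewrite (charM hchi) -{1}sh (char_star hchi) mulrC.
exact: mul_conjC_ge0.
Qed.

End Characters.

(** Reduces the equality of two characters to their values on generators. *)
Lemma closed_alg_eq_char (R : realType) (A : cstarAlgType R) (chi chi' : A -> R[i]) :
  character chi -> character chi' -> closed_alg (fun a => chi a = chi' a).
Proof.
move=> h h'; split.
- by rewrite !char1.
- by move=> a b ea eb; rewrite !charD // ea eb.
- by move=> k a ea; rewrite !charZ // ea.
- by move=> a b ea eb; rewrite !charM // ea eb.
- move=> a H; apply/eqP; rewrite -subr_eq0 -normr_le0; apply/ler_addgt0Pl => e e0.
  rewrite addr0.
  have [r r0 er] := gt0_complexE e0.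
  have r20 : 0 < r / 2 by rewrite divr_gt0.
  have [b eb ab] := H _ r20.
  have -> : chi a - chi' a = chi (a - b) - chi' (a - b).
    by rewrite !charB // eb; ring.
  apply: (le_trans (ler_normB _ _)).
  apply: (@le_trans _ _ ((r / 2)%:C%C + (r / 2)%:C%C)).
    apply: lerD; [apply: (le_trans (char_norm_le h _))|apply: (le_trans (char_norm_le h' _))];
    by rewrite lecR.
  by rewrite -rmorphD -splitr er.
Qed.

(** * The Fock representation of the disc relation *)

Section InnerProduct.
Variables (R : realType) (U : lmodType R[i]) (form : {dot U for Num.conj}).

Lemma dot_CauchySchwarz (u v : U) : `|form u v| ^+ 2 <= form u u * form v v.
Proof.
have [->|v0] := eqVneq v 0; first by rewrite linear0r normr0 expr0n /= mulr_ge0 ?dnorm_ge0.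
pose a := form u v / form v v; pose w := u - a *: v.
have wv : form w v = 0.
  by rewrite /w linearBl /= linearZl_LR /= divfK ?subrr // dnorm_eq0.
have -> : u = w + a *: v by rewrite /w subrK.
rewrite linearDl /= wv add0r linearZl_LR /= normrM (ger0_norm (dnorm_ge0 _ _)).
have -> : form (w + a *: v) (w + a *: v) = form w w + `|a| ^+ 2 * form v v.
  have wv' : form w (a *: v) = 0 by rewrite linearZr_LR /= wv mulr0.
  rewrite dnormD /= [X in _ + (X + _)](_ : _ = 0); last exact: wv'.
  by rewrite [X in X^*](_ : _ = 0) ?conjC0 ?addr0 ?dnormZ.
rewrite exprMn.
rewrite mulrDl expr2 -[X in X <= _]add0r mulrA; apply: lerD => //.
by rewrite mulr_ge0 // dnorm_ge0.
Qed.

Lemma dot_triangle (u v : U) :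
  sqrtC (form (u + v) (u + v)) <= sqrtC (form u u) + sqrtC (form v v).
Proof.
rewrite -(@ler_pXn2r _ 2) ?nnegrE ?addr_ge0 ?sqrtC_ge0 ?dnorm_ge0 //.
rewrite sqrrD !sqrtCK dnormD addrAC lerD //.
rewrite lerD2l -mulr_natl.
apply: (@le_trans _ _ (2 * `|form u v|)); last first.
  rewrite ler_pM2l // -(@ler_pXn2r _ 2) ?nnegrE ?mulr_ge0 ?sqrtC_ge0 ?dnorm_ge0 //.
  by rewrite exprMn !sqrtCK dot_CauchySchwarz.
have -> : form u v + (form u v)^* = 2 * 'Re (form u v).
  by rewrite ReE mulrC divfK // pnatr_eq0.
by rewrite ler_pM2l // (le_trans _ (leif_Re_Creal _)) //.
Qed.

End InnerProduct.

(** * Series of complex numbers and the Hilbert space of square-summable sequences *)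

Section ComplexSums.
Variable R : realType.
Local Notation C := (R[i]).
Implicit Types (u v : nat -> C^o).

Lemma norm_Re_le (z : C) : `|complex.Re z|%:C%C <= `|z|.
Proof. exact: normc_ge_Re. Qed.

Lemma norm_Im_le (z : C) : `|complex.Im z|%:C%C <= `|z|.
Proof.
have := normc_ge_Re (z * 'i%C); rewrite ReiNIm normrN normrM.
by rewrite complexiE normCi mulr1.
Qed.

Lemma norm_le_ReIm (z : C) : `|z| <= (`|complex.Re z| + `|complex.Im z|)%:C%C.
Proof.
rewrite {1}[z]complexE (le_trans (ler_normD _ _)) // normrM complexiE normCi mul1r.
by rewrite !normc_def /= !expr0n !addr0 !sqrtr_sqr rmorphD.
Qed.

Lemma real_cauchy_cvg (x : nat -> R) :
  (forall e : R, 0 < e -> exists N, forall m n, (N <= m)%N -> (N <= n)%N ->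
     `|x m - x n| <= e) ->
  exists l, forall e : R, 0 < e -> exists N, forall n, (N <= n)%N -> `|x n - l| <= e.
Proof.
move=> xC.
have : cauchy ((fun n => x n : R^o) @ \oo).
  apply/cauchy_ballP => e e0.
  have e20 : 0 < e / 2 by rewrite divr_gt0.
  have [N NP] := xC _ e20.
  exists ([set v | exists2 n, (N <= n)%N & v = x n],
          [set v | exists2 n, (N <= n)%N & v = x n])%classic.
    by split => /=; exists N => //= n Nn; exists n.
  case=> v w /= [[m Nm ->] [n Nn ->]].
  rewrite -ball_normE /ball_ /=; apply: le_lt_trans (NP _ _ Nm Nn) _.
  by rewrite ltr_pdivrMr // ltr_pMr // ltr1n.
move=> /cauchy_cvg/cvg_ex[l /(@cvgrPdist_le R R^o _ eventually _) le].
exists l => e /le[N _ NP]; exists N => n Nn.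
by have := NP n Nn; rewrite distrC.
Qed.

Lemma complex_scauchy_cvg u : scauchy u -> exists l, sconv u l.
Proof.
move=> uC.
have [|a aP] := @real_cauchy_cvg (fun n => complex.Re (u n)).
  move=> e /uC[N NP]; exists N => m n Nm Nn.
  have := le_trans (norm_Re_le (u m - u n)) (NP m n Nm Nn).
  by rewrite lecR raddfB.
have [|b bP] := @real_cauchy_cvg (fun n => complex.Im (u n)).
  move=> e /uC[N NP]; exists N => m n Nm Nn.
  have := le_trans (norm_Im_le (u m - u n)) (NP m n Nm Nn).
  by rewrite lecR raddfB.
exists (Complex a b) => e e0.
have e20 : 0 < e / 2 by rewrite divr_gt0.
have [N1 h1] := aP _ e20; have [N2 h2] := bP _ e20.
exists (maxn N1 N2) => n; rewrite geq_max => /andP[/h1 g1 /h2 g2].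
apply: (le_trans (norm_le_ReIm _)); rewrite lecR !raddfB /=; lra.
Qed.

Lemma sconv_conj u l : sconv u l -> sconv (fun n => (u n : C)^* : C^o) ((l : C)^*).
Proof.
by move=> ul e /ul[N NP]; exists N => n /NP; rewrite -rmorphB norm_conjC.
Qed.

(** Comparable elements of [R[i]] have the same imaginary part, so this equality has to pass to the
    limit along with the inequality of real parts. *)
Lemma sconv_ge u l (x : C) N :
  sconv u l -> (forall n, (N <= n)%N -> x <= u n) -> x <= l.
Proof.
move=> ul xu; rewrite lecE; apply/andP; split.
  rewrite -subr_eq0 -normr_le0; apply/ler_addgt0Pl => e /ul[M MP]; rewrite addr0.
  have := xu (maxn M N) (leq_maxr _ _); rewrite lecE => /andP[/eqP Ix _].
  have := le_trans (norm_Im_le _) (MP _ (leq_maxl M N)).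
  by rewrite lecR raddfB /= Ix distrC.
apply/ler_addgt0Pl => e /ul[M MP].
have := xu (maxn M N) (leq_maxr _ _); rewrite lecE => /andP[_].
have := le_trans (norm_Re_le _) (MP _ (leq_maxl M N)).
rewrite lecR raddfB /= ler_norml => /andP[h1 h2] h3; lra.
Qed.

Lemma sconvN u l : sconv u l -> sconv (fun n => - u n) (- l).
Proof. by move=> /(sconvZ (-1)); rewrite scaleN1r; apply: eq_sconv => n; rewrite scaleN1r. Qed.

Lemma sconv_le u l (x : C) : sconv u l -> (forall n, u n <= x) -> l <= x.
Proof.
move=> /sconvN ul ux; rewrite -lerN2.
by apply: (sconv_ge (N := 0) ul) => n _; rewrite lerN2.
Qed.

Definition psum u n : C^o := \sum_(k < n) u k.
(** Divergent series get the value [0]; for inner products of sequences in [l2] this never happens,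
    by [l2_term_cvg]. *)
Definition csum u : C := xget 0 [set l : C^o | sconv (psum u) l].

Lemma csumE u l : sconv (psum u) l -> csum u = l.
Proof.
move=> ul; rewrite /csum; case: xgetP => [x _ ux|/(_ l)//].
exact: sconv_uniq ux ul.
Qed.

Lemma csumP u : (exists l, sconv (psum u) l) -> sconv (psum u) (csum u).
Proof. by case=> l ul; rewrite (csumE ul). Qed.

End ComplexSums.

Section L2.
Variable R : realType.
Local Notation C := (R[i]).

Definition sqsum (f : nat -> C) n : C := \sum_(k < n) `|f k| ^+ 2.

Definition square_summable (f : nat -> C) := exists M : R, forall n, sqsum f n <= M%:C%C.

Definition l2_pred : {pred (nat -> C^o)} := fun f => `[< square_summable f >].

Lemma normD_sqr_le (x y : C) : `|x + y| ^+ 2 <= 2 * `|x| ^+ 2 + 2 * `|y| ^+ 2.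
Proof.
have e : `|x + y| ^+ 2 + `|x - y| ^+ 2 = 2 * `|x| ^+ 2 + 2 * `|y| ^+ 2.
  by rewrite !normCK rmorphD rmorphB; ring.
by rewrite -e lerDl exprn_ge0.
Qed.

Lemma norm_mul_le_sqr (x y : C) : `|x * y| <= `|x| ^+ 2 + `|y| ^+ 2.
Proof.
rewrite normrM.
have [h|h] := real_leP (normr_real x) (normr_real y).
  apply: (@le_trans _ _ (`|y| * `|y|)); first by rewrite ler_wpM2r.
  by rewrite -[leLHS]expr2 lerDr exprn_ge0.
apply: (@le_trans _ _ (`|x| * `|x|)); first by rewrite ler_wpM2l // ltW.
by rewrite -[leLHS]expr2 lerDl exprn_ge0.
Qed.

Lemma l2_submod : submod_closed l2_pred.
Proof.
split.
  apply/asboolP; exists 0 => n; rewrite /sqsum big1 // => i _.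
  by rewrite normr0 expr0n.
move=> a f g /asboolP[M fM] /asboolP[N gN]; apply/asboolP.
have [r r0 ar] : exists2 r : R, 0 <= r & `|a| ^+ 2 = r%:C%C.
  have ar : (complex.Re (`|a| ^+ 2))%:C%C = `|a| ^+ 2.
    by rewrite RRe_real // realX // normr_real.
  by exists (complex.Re (`|a| ^+ 2)) => //; rewrite -lecR ar exprn_ge0.
exists (2 * (r * M) + 2 * N) => n.
apply: (@le_trans _ _ (\sum_(k < n) (2 * (r%:C%C * `|f k| ^+ 2) + 2 * `|g k| ^+ 2))).
  apply: ler_sum => k _; apply: (le_trans (normD_sqr_le _ _)).
  by rewrite normrM exprMn ar.
rewrite big_split /= -!mulr_sumr.
have -> : (2 * (r * M) + 2 * N)%:C%C = 2 * (r%:C%C * M%:C%C) + 2 * N%:C%C.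
  by rewrite rmorphD !rmorphM !rmorph_nat.
apply: lerD.
  by rewrite ler_pM2l // ler_wpM2l ?fM // -(rmorph0 (real_complex R)) lecR.
by rewrite ler_pM2l // gN.
Qed.

HB.instance Definition _ := GRing.isSubmodClosed.Build C (nat -> C^o) l2_pred l2_submod.

Record l2 := L2 { l2_fun :> nat -> C^o; l2_funP : l2_fun \in l2_pred }.
HB.instance Definition _ := [isSub for l2_fun].
HB.instance Definition _ := [Choice of l2 by <:].
HB.instance Definition _ := [SubChoice_isSubLmodule of l2 by <:].

Lemma l2_sqsum (f : l2) : square_summable f.
Proof. by apply/asboolP; exact: l2_funP. Qed.

Definition l2_term (f g : l2) (k : nat) : C^o := (f k : C) * (g k : C)^*.

(** The partial sums of [|f|^2 + |g|^2] form a bounded majorant. *)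
Lemma l2_term_cvg f g : sconv (psum (l2_term f g)) (csum (l2_term f g)).
Proof.
have [M fM] := l2_sqsum f; have [N gN] := l2_sqsum g.
apply: csumP; apply: complex_scauchy_cvg.
pose s n := sqsum f n + sqsum g n.
have s_real n : (complex.Re (s n))%:C%C = s n.
  rewrite RRe_real // realD // ger0_real // sumr_ge0 // => k _; exact: exprn_ge0.
have s_realB m n : (complex.Re (s m) - complex.Re (s n))%:C%C = s m - s n.
  by rewrite -[in RHS](s_real m) -[in RHS](s_real n) -rmorphB.
apply: (@majorant_scauchy _ _ _ (fun n => complex.Re (s n)) (M + N)).
  move=> n; rewrite s_realB /s /sqsum /psum !big_ord_recr /=.
  rewrite [_ + _ - _]addrC addKr.
  rewrite addrACA [X in _ <= X - _]addrC addrK.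
  by rewrite /l2_term (le_trans (norm_mul_le_sqr _ _)) // norm_conjC.
by move=> n; rewrite -lecR s_real rmorphD lerD.
Qed.

Definition l2_dot (f g : l2) : C := csum (l2_term f g).

Lemma l2_dot_linear g : linear_for *%R (l2_dot^~ g).
Proof.
move=> a f f'; apply: csumE.
apply: (eq_sconv _ (sconvD (sconvZ a (l2_term_cvg f g)) (l2_term_cvg f' g))).
move=> n; rewrite /psum scaler_sumr -big_split /=; apply: eq_bigr => k _.
rewrite /l2_term; have -> : (a *: f + f') k = a * f k + f' k by [].
by rewrite mulrDl -mulrA.
Qed.

Lemma l2_dot_herm f g : l2_dot f g = (-1) ^+ false * (l2_dot g f)^*.
Proof.
rewrite expr0 mul1r; apply: csumE.
apply: (eq_sconv _ (sconv_conj (l2_term_cvg g f))) => n.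
rewrite /psum rmorph_sum; apply: eq_bigr => k _.
by rewrite /l2_term rmorphM /= conjCK mulrC.
Qed.

Lemma l2_dot_bilinear : bilinear_for *%R (Num.conj \; *%R) l2_dot.
Proof.
split=> g; first exact: l2_dot_linear.
move=> a f f'; rewrite l2_dot_herm l2_dot_linear [l2_dot g f]l2_dot_herm.
by rewrite [l2_dot g f']l2_dot_herm !expr0 !mul1r rmorphD rmorphM.
Qed.

Lemma sqsum_le_dot (f : l2) n : sqsum f n <= l2_dot f f.
Proof.
apply: (sconv_ge (N := n) (l2_term_cvg f f)) => m nm.
rewrite -(subnKC nm) /psum /sqsum big_split_ord /=.
rewrite -[leLHS]addr0; apply: lerD.
  by apply: ler_sum => k _; rewrite normCK.
by rewrite sumr_ge0 // => k _; exact: mul_conjC_ge0.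
Qed.

Lemma dot_le_sqsum (f : l2) (x : C) : (forall n, sqsum f n <= x) -> l2_dot f f <= x.
Proof.
move=> h; apply: (sconv_le (l2_term_cvg f f)) => n.
apply: le_trans (h n); rewrite le_eqVlt; apply/orP; left; apply/eqP.
by apply: eq_bigr => k _; rewrite normCK.
Qed.

Lemma l2_dot_gt0 f : f != 0 -> 0 < l2_dot f f.
Proof.
move=> f0.
have [k fk] : exists k, f k != 0.
  apply: contrapT => h; move/eqP: f0; apply; apply: val_inj; apply/funext => k /=.
  by apply/eqP; apply: contrapT => /negP fk; apply: h; exists k.
apply: lt_le_trans (sqsum_le_dot f k.+1).
rewrite /sqsum big_ord_recr /=; apply: ltr_wpDl.
  by rewrite sumr_ge0 // => i _; exact: exprn_ge0.
by rewrite exprn_gt0 // normr_gt0.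
Qed.

HB.instance Definition _ :=
  bilinear_isBilinear.Build C l2 l2 C *%R (Num.conj \; *%R) l2_dot l2_dot_bilinear.
HB.instance Definition _ :=
  isHermitianSesquilinear.Build C l2 false Num.conj l2_dot l2_dot_herm.
HB.instance Definition _ := isDotProduct.Build C l2 l2_dot l2_dot_gt0.

Definition l2_norm (f : l2) : C := sqrtC (l2_dot f f).

Fact l2_normD f g : l2_norm (f + g) <= l2_norm f + l2_norm g.
Proof. exact: dot_triangle. Qed.

Fact l2_normZ (k : C) f : l2_norm (k *: f) = `|k| * l2_norm f.
Proof.
rewrite /l2_norm dnormZ sqrtCM ?nnegrE ?exprn_ge0 ?dnorm_ge0 //.
by rewrite sqrCK.
Qed.

Fact l2_norm_eq0 f : l2_norm f = 0 -> f = 0.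
Proof. by move=> /eqP; rewrite sqrtC_eq0 dnorm_eq0 => /eqP. Qed.

HB.instance Definition _ := Lmodule_isNormed.Build C l2 l2_normD l2_normZ l2_norm_eq0.

Lemma l2_normE f : `|f| ^+ 2 = l2_dot f f.
Proof. exact: sqrtCK. Qed.

Lemma l2_coord_le (f : l2) k : `|f k| <= `|f|.
Proof.
rewrite -(@ler_pXn2r _ 2) ?nnegrE //; rewrite l2_normE.
apply: le_trans (sqsum_le_dot f k.+1).
by rewrite /sqsum big_ord_recr /= lerDr sumr_ge0 // => i _; exact: exprn_ge0.
Qed.

Lemma l2_norm_le (f : l2) (r : R) : 0 <= r -> (forall n, sqsum f n <= (r ^+ 2)%:C%C) ->
  `|f| <= r%:C%C.
Proof.
move=> r0 h; rewrite -(@ler_pXn2r _ 2) ?nnegrE //; last first.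
  by rewrite -(rmorph0 (real_complex R)) lecR.
by rewrite l2_normE -rmorphXn; exact: dot_le_sqsum.
Qed.

(** The limit [g] is taken coordinatewise. On the first [n] coordinates [u m - g] is split at some
    [u p] with [p] depending on [n]; both pieces have square sum at most [e^2], and
    [2 e^2 + 2 e^2 = (2 e)^2] is independent of [n]. *)
Lemma l2_complete : forall F : set_system l2, ProperFilter F -> cauchy F -> cvg F.
Proof.
apply: sconv_complete => u uC.
have gE k : exists l : C^o, sconv (fun m => u m k) l.
  apply: complex_scauchy_cvg => e /uC[N NP].
  exists N => m n Nm Nn; apply: le_trans (NP m n Nm Nn).
  exact: (l2_coord_le (u m - u n)).
have [g gP] := choice gE.
have key (e : R) N m : 0 < e ->
    (forall m n, (N <= m)%N -> (N <= n)%N -> `|u m - u n| <= e%:C%C) -> (N <= m)%N ->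
    forall n, sqsum (fun k => u m k - g k) n <= ((2 * e) ^+ 2)%:C%C.
  move=> e0 NP Nm n.
  (* The precision [e / (n + 1)] per coordinate makes [n] squares add up to at most [e^2]. *)
  have [K KP] : exists K, forall p, (K <= p)%N -> forall k, (k < n)%N ->
      `|u p k - g k| <= (e / n.+1%:R)%:C%C.
    have en : 0 < e / n.+1%:R by rewrite divr_gt0.
    move: (e / n.+1%:R) en => d en.
    elim: n => [|i [K KP]]; first by exists 0%N.
    have [M MP] := gP i _ en.
    exists (maxn K M) => p; rewrite geq_max => /andP[Kp Mp] k; rewrite ltnS leq_eqVlt.
    by case/predU1P => [->|ki]; [exact: MP|exact: KP].
  pose p := maxn N K.
  have h1 : sqsum (u m - u p) n <= (e ^+ 2)%:C%C.
    apply: le_trans (sqsum_le_dot _ n) _; rewrite -l2_normE rmorphXn.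
    rewrite ler_pXn2r ?nnegrE //; first by rewrite NP // leq_maxl.
    by rewrite -(rmorph0 (real_complex R)) lecR ltW.
  have h2 : sqsum (fun k => u p k - g k) n <= (e ^+ 2)%:C%C.
    apply: (@le_trans _ _ (\sum_(k < n) ((e / n.+1%:R) ^+ 2)%:C%C)).
      apply: ler_sum => k _; rewrite rmorphXn ler_pXn2r ?nnegrE //.
        by apply: KP => //; exact: leq_maxr.
      by rewrite -(rmorph0 (real_complex R)) lecR divr_ge0 // ltW.
    rewrite sumr_const card_ord -(rmorphMn (real_complex R)) lecR -mulr_natr expr_div_n.
    rewrite -mulrA ler_piMr ?sqr_ge0 // mulrC ler_pdivrMr ?exprn_gt0 // mul1r.
    by rewrite -natrX ler_nat (leq_trans (leqnSn n)) // leq_pmull.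
  apply: (@le_trans _ _ (2 * sqsum (u m - u p) n + 2 * sqsum (fun k => u p k - g k) n)).
    rewrite /sqsum !mulr_sumr -big_split /=; apply: ler_sum => k _.
    apply: le_trans _ (normD_sqr_le _ _).
    have -> : u m k - g k = (u m - u p) k + (u p k - g k) :> C; last by [].
    by rewrite [(u m - u p) k]/(u m k - u p k : C) addrA subrK.
  have -> : ((2 * e) ^+ 2)%:C%C = 2 * (e ^+ 2)%:C%C + 2 * (e ^+ 2)%:C%C :> C.
    by rewrite !rmorphXn rmorphM rmorph_nat; ring.
  by apply: lerD; rewrite ler_pM2l.
have gl2 : g \in l2_pred.
  have [N NP] := uC _ (@ltr01 R).
  have h := key 1 N N ltr01 NP (leqnn _).
  have dl : (u N : nat -> C^o) - g \in l2_pred.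
    by apply/asboolP; exists ((2 * 1) ^+ 2).
  have -> : g = (u N : nat -> C^o) - ((u N : nat -> C^o) - g) by rewrite subKr.
  by rewrite rpredB // l2_funP.
exists (L2 gl2) => e e0.
have e20 : 0 < e / 2 by rewrite divr_gt0.
have [N NP] := uC _ e20; exists N => m Nm.
apply: l2_norm_le; first exact: ltW.
move=> n; have := key _ _ _ e20 NP Nm n.
by rewrite mulrC divfK.
Qed.

HB.instance Definition _ := Uniform_isComplete.Build l2 l2_complete.

Definition l2_hilbert : hilbert R := @Hilbert R l2 (l2_dot : {dot l2 for Num.conj}) l2_normE.

End L2.

Section RealEmbedding.
Variable R : realType.
Implicit Types r s : R.
Lemma Rc1 : 1%:C%C = 1 :> R[i]. Proof. by []. Qed.
Lemma RcD r s : (r + s)%:C%C = r%:C%C + s%:C%C. Proof. exact: rmorphD. Qed.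
Lemma RcB r s : (r - s)%:C%C = r%:C%C - s%:C%C. Proof. exact: rmorphB. Qed.
Lemma RcM r s : (r * s)%:C%C = r%:C%C * s%:C%C. Proof. exact: rmorphM. Qed.
Lemma RcX r n : (r ^+ n)%:C%C = r%:C%C ^+ n. Proof. exact: rmorphXn. Qed.
Lemma Rc_nat n : n%:R%:C%C = n%:R :> R[i]. Proof. exact: rmorph_nat. Qed.
Lemma Rc_ge0 r : (0 <= r%:C%C) = (0 <= r). Proof. exact: ler0c. Qed.
End RealEmbedding.

(** * The star algebra of bounded operators with adjoint *)

Section BoundedOperators.
Variables (R : realType) (H : hilbert R).
Local Notation C := (R[i]).

Definition op_bounded (f : H -> H) := exists M : R, forall v, `|f v| <= M%:C%C * `|v|.

(** The adjoint is part of the data, so the involution just swaps two fields and no representation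
    theorem for functionals is involved. Since [op_adjE] determines the adjoint, [operatorP] can
    compare operators by their action alone. *)
Record operator := Operator {
  op_fun :> H -> H;
  op_adj : H -> H;
  op_linear : linear op_fun;
  op_adj_linear : linear op_adj;
  op_bound : op_bounded op_fun;
  op_adj_bound : op_bounded op_adj;
  op_adjE : forall v w, dot H (op_fun v) w = dot H v (op_adj w)
}.

HB.instance Definition _ := gen_eqMixin operator.
HB.instance Definition _ := gen_choiceMixin operator.

Implicit Types S T : operator.

Lemma dot_conj (v w : H) : dot H v w = (dot H w v)^*.
Proof. by rewrite hermC expr0 mul1r. Qed.

Lemma dot_inj (v w : H) : (forall u, dot H u v = dot H u w) -> v = w.
Proof.
move=> h; apply/eqP; rewrite -subr_eq0 -(dnorm_eq0 (dot H)).
by rewrite linearBr /= h subrr.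
Qed.

Lemma operatorP S T : (forall v, S v = T v) -> S = T.
Proof.
move=> /funext e.
have e' : op_adj S = op_adj T.
  apply/funext => w; apply: dot_inj => u; rewrite -!op_adjE; by rewrite e.
case: S T e e' => [f f' l l' b b' a] [g g' m m' c c' d] /= e e'.
by move: l l' b b' a m m' c c' d; rewrite e e' => *; congr Operator; exact: Prop_irrelevance.
Qed.

Lemma op_boundedD (f g : H -> H) : op_bounded f -> op_bounded g ->
  op_bounded (fun v => f v + g v).
Proof.
move=> [M fM] [N gN]; exists (M + N) => v.
by rewrite rmorphD mulrDl (le_trans (ler_normD _ _)) // lerD.
Qed.

Lemma op_boundedZ (k : C) (f : H -> H) : op_bounded f ->
  op_bounded (fun v => k *: f v).
Proof.
move=> [M fM]; exists (complex.Re `|k| * M) => v.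
have -> : (complex.Re `|k| * M)%:C%C = `|k| * M%:C%C.
  by rewrite -[in RHS](RRe_real (normr_real k)) rmorphM.
by rewrite normrZ -mulrA ler_wpM2l.
Qed.

Lemma op_boundedM (f g : H -> H) : op_bounded f -> op_bounded g ->
  op_bounded (f \o g).
Proof.
move=> [M fM] [N gN]; exists (Num.max M 0 * N) => v /=.
apply: (le_trans (fM _)).
apply: (@le_trans _ _ ((Num.max M 0)%:C%C * `|g v|)).
  by rewrite ler_wpM2r // lecR le_max lexx.
rewrite rmorphM -mulrA ler_wpM2l //.
by rewrite -(rmorph0 (real_complex R)) lecR le_max lexx orbT.
Qed.

Lemma op_bounded0 : op_bounded (fun=> 0).
Proof. by exists 0 => v; rewrite normr0 mul0r. Qed.

Lemma op_bounded_id : op_bounded id.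
Proof. by exists 1 => v; rewrite rmorph1 mul1r. Qed.

Fact op_zero_linear : linear ((fun=> 0) : H -> H).
Proof. by move=> k u v; rewrite scaler0 addr0. Qed.
Fact op_zero_adj (v w : H) : dot H 0 w = dot H v 0.
Proof. by rewrite linear0l linear0r. Qed.
Definition op_zero := @Operator (fun=> 0) (fun=> 0) op_zero_linear op_zero_linear
  op_bounded0 op_bounded0 op_zero_adj.

Fact op_one_linear : linear (@id H).
Proof. by []. Qed.
Definition op_one := @Operator id id op_one_linear op_one_linear
  op_bounded_id op_bounded_id (fun v w => erefl).

Fact op_add_linear (f g : H -> H) : linear f -> linear g -> linear (fun v => f v + g v).
Proof. by move=> fl gl k u v; rewrite fl gl scalerDr addrACA. Qed.
Fact op_add_adj S T (v w : H) :
  dot H (S v + T v) w = dot H v (op_adj S w + op_adj T w).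
Proof. by rewrite linearDl linearDr /= !op_adjE. Qed.
Definition op_add S T := Operator
  (op_add_linear (op_linear S) (op_linear T))
  (op_add_linear (op_adj_linear S) (op_adj_linear T))
  (op_boundedD (op_bound S) (op_bound T))
  (op_boundedD (op_adj_bound S) (op_adj_bound T)) (op_add_adj S T).

Fact op_scale_linear (k : C) (f : H -> H) : linear f -> linear (fun v => k *: f v).
Proof. by move=> fl a u v; rewrite fl scalerDr !scalerA mulrC. Qed.
Fact op_scale_adj (k : C) S (v w : H) : dot H (k *: S v) w = dot H v (k^* *: op_adj S w).
Proof. by rewrite linearZl_LR linearZr_LR /= conjCK op_adjE. Qed.
Definition op_scale (k : C) S := Operator
  (op_scale_linear k (op_linear S)) (op_scale_linear k^* (op_adj_linear S))
  (op_boundedZ k (op_bound S)) (op_boundedZ k^* (op_adj_bound S)) (op_scale_adj k S).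

Fact op_mul_linear (f g : H -> H) : linear f -> linear g -> linear (f \o g).
Proof. by move=> fl gl k u v /=; rewrite gl fl. Qed.
Fact op_mul_adj S T (v w : H) :
  dot H ((S \o T) v) w = dot H v ((op_adj T \o op_adj S) w).
Proof. by rewrite /= !op_adjE. Qed.
Definition op_mul S T := Operator
  (op_mul_linear (op_linear S) (op_linear T))
  (op_mul_linear (op_adj_linear T) (op_adj_linear S))
  (op_boundedM (op_bound S) (op_bound T))
  (op_boundedM (op_adj_bound T) (op_adj_bound S)) (op_mul_adj S T).

Fact op_star_adj S (v w : H) : dot H (op_adj S v) w = dot H v (S w).
Proof. by rewrite dot_conj -op_adjE -dot_conj. Qed.
Definition op_star S := Operator (op_adj_linear S) (op_linear S)
  (op_adj_bound S) (op_bound S) (op_star_adj S).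

Definition op_opp S := op_scale (-1) S.

Fact op_addA : associative op_add.
Proof. by move=> S T U; apply: operatorP => v /=; rewrite addrA. Qed.
Fact op_addC : commutative op_add.
Proof. by move=> S T; apply: operatorP => v /=; rewrite addrC. Qed.
Fact op_add0 : left_id op_zero op_add.
Proof. by move=> S; apply: operatorP => v /=; rewrite add0r. Qed.
Fact op_addN : left_inverse op_zero op_opp op_add.
Proof. by move=> S; apply: operatorP => v /=; rewrite scaleN1r addNr. Qed.

HB.instance Definition _ := GRing.isZmodule.Build operator op_addA op_addC op_add0 op_addN.

Lemma op_fun0 S : S 0 = 0.
Proof. by apply: (addrI (S 0)); have := op_linear S 1 0 0; rewrite !scale1r !addr0. Qed.
Lemma op_funD S v w : S (v + w) = S v + S w.
Proof. by have := op_linear S 1 v w; rewrite !scale1r. Qed.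
Lemma op_funZ S k v : S (k *: v) = k *: S v.
Proof. by have := op_linear S k v 0; rewrite op_fun0 !addr0. Qed.

Fact op_mulA : associative op_mul.
Proof. by move=> S T U; apply: operatorP. Qed.
Fact op_mul1l : left_id op_one op_mul.
Proof. by move=> S; apply: operatorP. Qed.
Fact op_mul1r : right_id op_one op_mul.
Proof. by move=> S; apply: operatorP. Qed.
Fact op_mulDl : left_distributive op_mul +%R.
Proof. by move=> S T U; apply: operatorP. Qed.
Fact op_mulDr : right_distributive op_mul +%R.
Proof. by move=> S T U; apply: operatorP => v /=; rewrite op_funD. Qed.

(** At this stage [H] may be the zero space, so [1 = 0] is not excluded; [op_nonzero] settles it for
    [l2]. *)
HB.instance Definition _ := GRing.Zmodule_isPzRing.Build operator
  op_mulA op_mul1l op_mul1r op_mulDl op_mulDr.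

Fact op_scaleA (k l : C) S : op_scale k (op_scale l S) = op_scale (k * l) S.
Proof. by apply: operatorP => v /=; rewrite scalerA. Qed.
Fact op_scale1 : left_id 1 op_scale.
Proof. by move=> S; apply: operatorP => v /=; rewrite scale1r. Qed.
Fact op_scaleDr : right_distributive op_scale +%R.
Proof. by move=> k S T; apply: operatorP => v /=; rewrite scalerDr. Qed.
Fact op_scaleDl S : {morph op_scale^~ S : k l / k + l}.
Proof. by move=> k l; apply: operatorP => v /=; rewrite scalerDl. Qed.

HB.instance Definition _ := GRing.Zmodule_isLmodule.Build C operator
  op_scaleA op_scale1 op_scaleDr op_scaleDl.

Fact op_scaleAl (k : C) S T : k *: (S * T) = (k *: S) * T.
Proof. by apply: operatorP. Qed.
Fact op_scaleAr (k : C) S T : k *: (S * T) = S * (k *: T).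
Proof. by apply: operatorP => v /=; rewrite op_funZ. Qed.

Fact op_starK : involutive op_star.
Proof. by move=> S; apply: operatorP. Qed.
Fact op_starD : {morph op_star : S T / S + T}.
Proof. by move=> S T; apply: operatorP. Qed.
Fact op_starZ (k : C) S : op_star (k *: S) = Num.conj k *: op_star S.
Proof. by apply: operatorP. Qed.
Fact op_starM S T : op_star (S * T) = op_star T * op_star S.
Proof. by apply: operatorP. Qed.

End BoundedOperators.

Section L2Operators.
Variable R : realType.
Local Notation C := (R[i]).
Local Notation H := (l2_hilbert R).

Lemma l2_e0P : (fun k : nat => (k == 0)%N%:R : (C^o)) \in @l2_pred R.
Proof.
apply/asboolP; exists 1 => -[|n]; rewrite /sqsum ?big_ord0 ?rmorph1 ?ler01 //.
by rewrite big_ord_recl big1 ?addr0 ?normr1 ?expr1n // => k _; rewrite normr0 expr0n.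
Qed.

Definition l2_e0 : l2 R := L2 l2_e0P.

Lemma l2_e0_norm : `|l2_e0| = 1.
Proof.
apply/eqP; rewrite eq_le; apply/andP; split.
  rewrite -(rmorph1 (real_complex R)); apply: l2_norm_le => // -[|n]; rewrite /sqsum.
    by rewrite big_ord0 expr1n rmorph1 ler01.
  by rewrite big_ord_recl big1 ?addr0 ?normr1 ?expr1n ?rmorph1 // => k _; rewrite normr0 expr0n.
by have := l2_coord_le l2_e0 0; rewrite /= normr1.
Qed.

Definition op_nonzero : 1 != 0 :> operator H.
Proof.
apply/eqP => /(congr1 (fun T : operator H => T l2_e0)) /= e.
have := l2_e0_norm; rewrite [l2_e0]e normr0 => /eqP; by rewrite eq_sym oner_eq0.
Qed.

HB.instance Definition _ := GRing.PzSemiRing_isNonZero.Build (operator H) op_nonzero.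
HB.instance Definition _ := GRing.Lmodule_isLalgebra.Build C (operator H) (@op_scaleAl R H).
HB.instance Definition _ := GRing.Lalgebra_isAlgebra.Build C (operator H) (@op_scaleAr R H).
HB.instance Definition _ := isStarAlgebra.Build C (operator H)
  (@op_starK R H) (@op_starD R H) (@op_starZ R H) (@op_starM R H).

Section WeightedShift.
Variable w : nat -> R.
Hypothesis w01 : forall k, 0 <= w k <= 1.

Lemma weight_norm_le k (z : C) : `|(w k)%:C%C * z| ^+ 2 <= `|z| ^+ 2.
Proof.
have /andP[w0 w1] := w01 k.
rewrite ler_pXn2r ?nnegrE // normrM -[leRHS]mul1r ler_wpM2r //.
by rewrite ger0_norm ?lecR // -(rmorph0 (real_complex R)) lecR.
Qed.

Definition wshift_fun (f : nat -> C) : nat -> C^o :=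
  fun k => if k is k'.+1 then (w k')%:C%C * f k' else 0.
Definition wunshift_fun (f : nat -> C) : nat -> C^o := fun k => (w k)%:C%C * f k.+1.

Lemma sqsum_wshift f n : sqsum (wshift_fun f) n.+1 <= sqsum f n.
Proof.
rewrite /sqsum big_ord_recl /= normr0 expr0n add0r.
by apply: ler_sum => k _; exact: weight_norm_le.
Qed.

Lemma sqsum_wunshift f n : sqsum (wunshift_fun f) n <= sqsum f n.+1.
Proof.
rewrite /sqsum big_ord_recl -[leLHS]add0r; apply: lerD; first exact: exprn_ge0.
by apply: ler_sum => k _; exact: weight_norm_le.
Qed.

Lemma sqsumS (f : nat -> C) n : sqsum f n <= sqsum f n.+1.
Proof. by rewrite /sqsum big_ord_recr /= lerDl exprn_ge0. Qed.

Lemma wshiftP (f : l2 R) : wshift_fun f \in @l2_pred R.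
Proof.
have [M fM] := l2_sqsum f; apply/asboolP; exists M => n.
by apply: le_trans (sqsumS _ _) (le_trans (sqsum_wshift _ _) (fM n)).
Qed.

Lemma wunshiftP (f : l2 R) : wunshift_fun f \in @l2_pred R.
Proof.
have [M fM] := l2_sqsum f; apply/asboolP; exists M => n.
exact: le_trans (sqsum_wunshift _ _) (fM _).
Qed.

Definition wshift (f : H) : H := L2 (wshiftP f).
Definition wunshift (f : H) : H := L2 (wunshiftP f).

Lemma l2_norm_mono (f g : H) : (forall n, exists m, sqsum (f : l2 R) n <= sqsum (g : l2 R) m) ->
  `|f| <= 1%:C%C * `|g|.
Proof.
move=> h; rewrite Rc1 mul1r -(@ler_pXn2r _ 2) ?nnegrE //.
rewrite (l2_normE f) (l2_normE g); apply: dot_le_sqsum => n; have [m nm] := h n.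
exact: le_trans nm (sqsum_le_dot _ _).
Qed.

Fact wshift_linear : linear wshift.
Proof.
move=> k f g; apply: val_inj; apply/funext => -[|n] /=.
  by apply: esym; rewrite [LHS](_ : _ = k * 0 + 0) // mulr0 addr0.
rewrite [LHS](_ : _ = (w n)%:C%C * (k * (f : l2 R) n + (g : l2 R) n)) //.
rewrite [RHS](_ : _ = k * ((w n)%:C%C * (f : l2 R) n) + (w n)%:C%C * (g : l2 R) n) //.
by rewrite mulrDr mulrCA.
Qed.

Fact wunshift_linear : linear wunshift.
Proof.
move=> k f g; apply: val_inj; apply/funext => n /=.
rewrite [LHS](_ : _ = (w n)%:C%C * (k * (f : l2 R) n.+1 + (g : l2 R) n.+1)) //.
rewrite [RHS](_ : _ = k * ((w n)%:C%C * (f : l2 R) n.+1) + (w n)%:C%C * (g : l2 R) n.+1) //.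
by rewrite mulrDr mulrCA.
Qed.

Fact wshift_bounded : op_bounded wshift.
Proof.
exists 1 => f; apply: l2_norm_mono => n; exists n.
exact: le_trans (sqsumS _ _) (sqsum_wshift _ _).
Qed.

Fact wunshift_bounded : op_bounded wunshift.
Proof.
by exists 1 => f; apply: l2_norm_mono => n; exists n.+1; exact: sqsum_wunshift.
Qed.

Fact wshift_adj f g : dot H (wshift f) g = dot H f (wunshift g).
Proof.
apply: csumE; apply/sconv_shift.
apply: (eq_sconv _ (l2_term_cvg f (wunshift g))) => n.
rewrite /psum [RHS]big_ord_recl /= /l2_term /= mul0r add0r.
apply: eq_bigr => k _; rewrite /wunshift_fun rmorphM /= conjc_R.
by rewrite mulrCA mulrA.
Qed.

Definition shift_op : operator H := Operator wshift_linear wunshift_linear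
  wshift_bounded wunshift_bounded wshift_adj.

End WeightedShift.
End L2Operators.

(** * The weighted shift of the disc and uniform bounds over all representations *)

Section FockRepresentation.
Variables (R : realType) (q : R).
Hypothesis q01 : 0 < q < 1.
Local Notation C := (R[i]).
Local Notation H := (l2_hilbert R).

Lemma fock_weight_bounds k : 0 <= Num.sqrt (1 - q ^+ k.+1) <= 1.
Proof.
have /andP[q0 q1] := q01.
rewrite sqrtr_ge0 -[leRHS]sqrtr1 ler_wsqrtr // gerBl exprn_ge0 // ltW //.
Qed.

(** Sends [e_k] to [sqrt (1 - q^(k+1)) e_(k+1)]. The relation then reads
    [(1 - q^(k+1)) - q (1 - q^k) = 1 - q] on [e_k], and the adjoint kills [e_0]. *)
Definition fock_op : operator H := shift_op fock_weight_bounds.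

Lemma fock_relation : disc_relation q fock_op.
Proof.
have /andP[q0 q1] := q01.
apply: operatorP => f; apply: val_inj; apply/funext => k.
have sq j : (Num.sqrt (1 - q ^+ j.+1))%:C%C * (Num.sqrt (1 - q ^+ j.+1))%:C%C =
   1 - q%:C%C ^+ j.+1 :> C.
  rewrite -RcM -expr2 sqr_sqrtr ?RcB ?Rc1 ?RcX //.
  by rewrite subr_ge0 exprn_ile1 // ltW.
pose a := fun j => (Num.sqrt (1 - q ^+ j.+1))%:C%C : C.
have step (g : nat -> C) : a k * (a k * g k)
  - q%:C%C * (if k is k'.+1 then a k' * (a k' * g k'.+1) else 0) = (1 - q)%:C%C * g k.
  rewrite (mulrA (a k)) sq RcB Rc1; case: k => [|k] //=.
    by rewrite mulr0 subr0 expr1.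
  by rewrite (mulrA (a k)) sq [_ ^+ k.+2]exprS; ring.
rewrite -[RHS](step (f : l2 R)) /=.
rewrite /fock_op /= /wunshift_fun /= /wshift_fun.
rewrite [LHS](_ : _ = a k * (a k * (f : l2 R) k) +
  -1 * (q%:C%C * (if k is k'.+1 then a k' * (a k' * (f : l2 R) k'.+1) else 0))) //.
by rewrite mulN1r.
Qed.

Lemma fock_vacuum : (1 - fock_op * star fock_op) (l2_e0 R) = l2_e0 R.
Proof.
have h : (fock_op * star fock_op) (l2_e0 R) = 0.
  apply: val_inj; apply/funext => -[|k] //=.
  by rewrite /wunshift_fun /= mulr0 mulr0.
have -> : (1 - fock_op * star fock_op) (l2_e0 R) =
  l2_e0 R + (-1) *: (fock_op * star fock_op) (l2_e0 R) by [].
by rewrite h scaler0 addr0.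
Qed.

Section RepresentationBound.
Variables (P : starAlgType C) (x : P) (K : hilbert R) (rho : P -> K -> K).
Hypotheses (hx : disc_relation q x) (hrho : bounded_rep rho).

Lemma hnormE (v : K) : `|v| = (rnorm v)%:C%C.
Proof. by rewrite /rnorm RRe_real ?normr_real. Qed.

Lemma rnorm_ge0 (v : K) : 0 <= rnorm v.
Proof. by rewrite -Rc_ge0 -hnormE. Qed.

Lemma rnorm_dot (v : K) : ((rnorm v) ^+ 2)%:C%C = dot K v v.
Proof. by rewrite RcX -hnormE hilbert_norm. Qed.

Lemma rep_relation v :
  rnorm (rho x v) ^+ 2 = (1 - q) * rnorm v ^+ 2 + q * rnorm (rho (star x) v) ^+ 2.
Proof.
apply: (@complexI R); rewrite RcD (RcM (1 - q)) (RcM q) !rnorm_dot.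
rewrite (rep_star hrho) -(repM hrho) [in RHS](rep_star hrho) starK -(repM hrho).
have -> : star x * x = q%:C%C *: (x * star x) + (1 - q)%:C%C *: 1.
  by move: hx => /eqP; rewrite subr_eq => /eqP ->; rewrite addrC.
rewrite (rep_lin hrho).
have r0 : rho 0 v = 0.
  have := rep_lin hrho 1 0 0 v; rewrite !scale1r addr0.
  by move=> /eqP; rewrite -subr_eq subrr eq_sym => /eqP.
have -> : rho ((1 - q)%:C%C *: 1) v = (1 - q)%:C%C *: v.
  by have := rep_lin hrho (1 - q)%:C%C 1 0 v; rewrite !addr0 (rep1 hrho) r0 addr0.
by rewrite linearDr /= !linearZr_LR /= !conjc_R addrC.
Qed.

(** For [w = x^* v], Cauchy-Schwarz applied to [|w|^2 = (v, x w)] gives [|w|^4 <= |v|^2 M |w|^2]. *)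
Lemma rep_adjoint_bound (M : R) : 0 <= M ->
  (forall v, rnorm (rho x v) ^+ 2 <= M * rnorm v ^+ 2) ->
  forall v, rnorm (rho (star x) v) ^+ 2 <= M * rnorm v ^+ 2.
Proof.
move=> M0 h v; set w := rho (star x) v.
have [->|w0] := eqVneq (rnorm w) 0.
  by rewrite expr0n mulr_ge0 // sqr_ge0.
have w0' : 0 < rnorm w ^+ 2 by rewrite exprn_gt0 // lt_def w0 rnorm_ge0.
have e : dot K w w = dot K v (rho x w).
  by rewrite /w (rep_star hrho) starK.
have := dot_CauchySchwarz (dot K) v (rho x w).
rewrite -e -!rnorm_dot ger0_norm; last first.
  by rewrite Rc_ge0 sqr_ge0.
rewrite -RcX -RcM lecR => cs.
have {}cs := le_trans cs (ler_wpM2l (sqr_ge0 _) (h w)).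
rewrite -(ler_pM2r w0') -expr2 (le_trans cs) //.
by rewrite mulrCA mulrA.
Qed.

(* If [m] is the least constant with [‖x v‖^2 <= m ‖v‖^2], the relation gives
   [m <= 1 - q + q m], hence [m <= 1]. *)
Lemma rep_contraction v : rnorm (rho x v) <= rnorm v.
Proof.
have /andP[q0 q1] := q01.
pose B := [set M : R | 0 <= M /\ forall v, rnorm (rho x v) ^+ 2 <= M * rnorm v ^+ 2]%classic.
(* The infimum below is meaningful only once some bound exists; continuity of the linear map [rho x]
   supplies one. *)
have B0 : B !=set0.
  pose L : {linear K -> K} := HB.pack (rho x)
    (GRing.isLinear.Build _ _ _ _ (rho x) (rep_linear hrho x)).
  have /linear_bounded_continuous/linear_boundedP Lb : continuous L.
    exact: (rep_bounded hrho).
  have [r [r0 rP]] := pinfty_ex_gt0 Lb.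
  have [s s0 rs] := gt0_complexE r0.
  exists (s ^+ 2); split; first exact: sqr_ge0.
  move=> u; rewrite -exprMn ler_pXn2r ?nnegrE ?rnorm_ge0 ?mulr_ge0 ?rnorm_ge0 ?(ltW s0) //.
  by have := rP u; rewrite /= !hnormE rs -RcM lecR.
have Blb : has_lbound B by exists 0 => M [].
pose m := inf B.
have m0 : 0 <= m by apply: lb_le_inf => // M [].
have mP u : rnorm (rho x u) ^+ 2 <= m * rnorm u ^+ 2.
  have [u0|u0] := eqVneq (rnorm u) 0.
    have [M [M0 /(_ u)]] := B0; by rewrite u0 expr0n !mulr0.
  have u0' : 0 < rnorm u ^+ 2 by rewrite exprn_gt0 // lt_def u0 rnorm_ge0.
  rewrite -ler_pdivrMr //; apply: lb_le_inf => // M [M0 MP].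
  by rewrite ler_pdivrMr.
have Bm : B (1 - q + q * m).
  split; first by rewrite addr_ge0 ?mulr_ge0 ?subr_ge0 // ltW.
  move=> u; rewrite rep_relation [leRHS]mulrDl lerD // -mulrA ler_wpM2l ?(ltW q0) //.
  exact: rep_adjoint_bound.
have : m <= 1 - q + q * m by exact: ge_inf.
move=> mq; have m1 : m <= 1 by nra.
rewrite -(@ler_pXn2r _ 2) ?nnegrE ?rnorm_ge0 // (le_trans (mP v)) //.
by rewrite ler_piMl // sqr_ge0.
Qed.

Lemma rep_star_contraction v : rnorm (rho (star x) v) <= rnorm v.
Proof.
rewrite -(@ler_pXn2r _ 2) ?nnegrE ?rnorm_ge0 // -[leRHS]mul1r.
apply: rep_adjoint_bound => // u; rewrite mul1r ler_pXn2r ?nnegrE ?rnorm_ge0 //.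
exact: rep_contraction.
Qed.

(** The crude constant [2] serves to bound the sets whose suprema define [opnorm] and [rep_norm]; a
    single representation then gives a lower bound of [rep_norm]. *)
Lemma rep_defect_bound v : rnorm (rho (1 - x * star x) v) <= 2 * rnorm v.
Proof.
have -> : rho (1 - x * star x) v = v - rho x (rho (star x) v).
  have -> : 1 - x * star x = (-1) *: (x * star x) + 1 by rewrite scaleN1r addrC.
  by rewrite (rep_lin hrho) (repM hrho) (rep1 hrho) scaleN1r addrC.
rewrite -lecR RcM Rc_nat -!hnormE mulr_natl mulr2n.
rewrite (le_trans (ler_normB _ _)) // lerD // !hnormE lecR.
exact: le_trans (rep_contraction _) (rep_star_contraction _).
Qed.

Lemma opnorm_defect_le : opnorm (rho (1 - x * star x)) <= 2.
Proof.
apply: ge_sup.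
  by exists (rnorm (rho (1 - x * star x) 0)), 0 => //=; rewrite normr0.
move=> _ [v /= v1 <-]; apply: (le_trans (rep_defect_bound v)).
by rewrite -[leRHS]mulr1 ler_pM2l // -lecR -hnormE Rc1.
Qed.

Lemma opnorm_defect_ge v : `|v| <= 1 -> rnorm (rho (1 - x * star x) v) <= opnorm (rho (1 - x * star x)).
Proof.
move=> v1; apply: ub_le_sup; last by exists v.
exists 2 => _ [u /= u1 <-]; apply: (le_trans (rep_defect_bound u)).
by rewrite -[leRHS]mulr1 ler_pM2l // -lecR -hnormE Rc1.
Qed.

End RepresentationBound.

(** In the Fock representation [1 - y * star y] fixes the unit vector [e_0], so its [rep_norm],
    which is the norm in [D], is at least [1]. *)
Lemma quantum_disc_nonunitary (D : cstarAlgType R) (x : D) :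
  is_quantum_disc q x -> 1 - x * star x != 0.
Proof.
case=> P [y [iota [[ry univ] hi <- _ nrm]]].
have [f [[hf fy] _]] := univ (operator H) fock_op fock_relation.
pose rho := fun (a : P) (v : H) => f a v.
have hrho : bounded_rep rho.
  split.
  - by move=> a; exact: op_linear.
  - move=> a; pose L : {linear H -> H} := HB.pack (rho a)
      (GRing.isLinear.Build _ _ _ _ (rho a) (op_linear (f a))).
    apply: (bounded_linear_continuous (f := L)); apply/linear_boundedP.
    have [M MP] := op_bound (f a).
    exists M%:C%C; split; first by rewrite complex_real.
    move=> r Mr v; apply: (le_trans (MP v)); rewrite ler_wpM2r // ltW //.
  - by move=> k a b v; rewrite /rho; case: hf => fl _ _; rewrite fl.
  - by move=> v; rewrite /rho (hom1 hf).
  - by move=> a b v; rewrite /rho (homM hf).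
  - by move=> a v w; rewrite /rho (hom_star hf); exact: op_adjE.
have vac : rho (1 - y * star y) (l2_e0 R) = l2_e0 R.
  by rewrite /rho (homB hf) (hom1 hf) (homM hf) (hom_star hf) fy fock_vacuum.
have e0n : `|l2_e0 R : H| = 1 by exact: l2_e0_norm.
have : 1 <= rep_norm (1 - y * star y).
  apply: (@le_trans _ _ (opnorm (rho (1 - y * star y)))).
    have := opnorm_defect_ge ry hrho (v := l2_e0 R : H); rewrite vac.
    by rewrite /rnorm e0n => /(_ (lexx _)).
  apply: ub_le_sup; last by exists H, rho.
  by exists 2 => _ [K [sigma [hs ->]]]; exact: opnorm_defect_le.
rewrite -nrm (homB hi) (hom1 hi) (homM hi) (hom_star hi) => h.
by apply: contraTneq h => ->; rewrite anorm0 -ltNge ltr01.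
Qed.

End FockRepresentation.

(** * Generation of the universal algebras *)

Section SubAlgebras.
Variables (C : numClosedFieldType) (A : starAlgType C).

Record star_subalg := StarSubalg {
  ssa_set :> A -> Prop;
  ssa1 : ssa_set 1;
  ssaD : forall a b, ssa_set a -> ssa_set b -> ssa_set (a + b);
  ssaZ : forall (k : C) a, ssa_set a -> ssa_set (k *: a);
  ssaM : forall a b, ssa_set a -> ssa_set b -> ssa_set (a * b);
  ssa_star : forall a, ssa_set a -> ssa_set (star a)
}.

Variable E : star_subalg.

Definition ssa_pred : {pred A} := fun a => `[< E a >].

Fact ssa_subalg_closed : subalg_closed ssa_pred.
Proof.
split; first by apply/asboolP; exact: ssa1.
- by move=> k a b /asboolP Ea /asboolP Eb; apply/asboolP/ssaD => //; exact: ssaZ.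
- by move=> a b /asboolP Ea /asboolP Eb; apply/asboolP/ssaM.
Qed.

HB.instance Definition _ := GRing.isSubalgClosed.Build C A ssa_pred ssa_subalg_closed.

Record sub_alg := SubAlg { sub_val : A; sub_valP : sub_val \in ssa_pred }.

HB.instance Definition _ := [isSub for sub_val].
HB.instance Definition _ := [Choice of sub_alg by <:].
HB.instance Definition _ := [SubChoice_isSubAlgebra of sub_alg by <:].

Fact sub_star_subproof (a : sub_alg) : star (sub_val a) \in ssa_pred.
Proof. by apply/asboolP/ssa_star/asboolP/sub_valP. Qed.

Definition sub_star (a : sub_alg) : sub_alg := SubAlg (sub_star_subproof a).

Fact sub_starK : involutive sub_star.
Proof. by move=> a; apply: val_inj => /=; rewrite starK. Qed.
Fact sub_starD : {morph sub_star : a b / a + b}.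
Proof. by move=> a b; apply: val_inj => /=; rewrite starD. Qed.
Fact sub_starZ (k : C) a : sub_star (k *: a) = Num.conj k *: sub_star a.
Proof. by apply: val_inj => /=; rewrite starZ. Qed.
Fact sub_starM a b : sub_star (a * b) = sub_star b * sub_star a.
Proof. by apply: val_inj => /=; rewrite starM. Qed.

HB.instance Definition _ := isStarAlgebra.Build C sub_alg
  sub_starK sub_starD sub_starZ sub_starM.

End SubAlgebras.

Section SubCStarAlgebras.
Variables (R : realType) (A : cstarAlgType R) (E : star_subalg A).
Hypothesis E_closed : forall a, (forall e : R, 0 < e -> exists2 b, E b & anorm (a - b) <= e) -> E a.
Local Notation T := (sub_alg E).

Definition sub_norm (a : T) : R := anorm (sub_val a).

Fact sub_normD a b : sub_norm (a + b) <= sub_norm a + sub_norm b.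
Proof. exact: anormD. Qed.
Fact sub_normZ (k : R[i]) a : (sub_norm (k *: a))%:C%C = `|k| * (sub_norm a)%:C%C.
Proof. exact: anormZ. Qed.
Fact sub_norm_eq0 a : sub_norm a = 0 -> a = 0.
Proof. by move=> /anorm_eq0 h; apply: val_inj. Qed.
Fact sub_normM a b : sub_norm (a * b) <= sub_norm a * sub_norm b.
Proof. exact: anormM. Qed.

Let T_normed : normedStarAlgType R := HB.pack T
  (isNormedStarAlgebra.Build R T sub_normD sub_normZ sub_norm_eq0 sub_normM).

Fact sub_cstar_identity (a : T_normed) : anorm (star a * a) = anorm a ^+ 2.
Proof. exact: cstar_identity. Qed.

Fact sub_cstar_complete :
  forall F : set_system (normed_of T_normed), ProperFilter F -> cauchy F -> cvg F.
Proof.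
apply: sconv_complete => u uC.
have [l lP] : exists l : A, aconv (fun n => sub_val (u n : T)) l.
  apply: anorm_complete => e /uC[N NP]; exists N => m n Nm Nn.
  by have := NP m n Nm Nn; rewrite -lecR.
have El : l \in ssa_pred E.
  apply/asboolP/E_closed => e /lP[N NP].
  exists (sub_val (u N : T)); first by apply/asboolP; exact: sub_valP.
  by rewrite anormBC NP.
exists (SubAlg El : T) => e /lP[N NP]; exists N => n Nn.
by have := NP n Nn; rewrite -lecR.
Qed.

Definition sub_cstar_alg : cstarAlgType R := HB.pack T
  (isNormedStarAlgebra.Build R T sub_normD sub_normZ sub_norm_eq0 sub_normM)
  (isCStarAlgebra.Build R T_normed sub_cstar_identity sub_cstar_complete).

End SubCStarAlgebras.

(** The universal map into the subalgebra [E], followed by the inclusion, fixes [x]; by uniqueness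
    it is the identity of [P]. *)
Lemma disc_polynomials_generated (R : realType) (q : R) (P : starAlgType R[i]) (x : P)
    (E : star_subalg P) :
  is_disc_polynomials q x -> E x -> forall a, E a.
Proof.
case=> rx univ Ex a.
have Ex' : x \in ssa_pred E by apply/asboolP.
have [f [[hf fx] _]] : exists! f : P -> sub_alg E, starhom f /\ f x = SubAlg Ex'.
  by apply: univ; apply: val_inj; exact: rx.
have [g [_ guniq]] := univ P x rx.
have -> : a = sub_val (f a).
  have e1 : g = id by apply: guniq; split => //; split.
  have e2 : g = (fun b => sub_val (f b)).
    apply: guniq; split; last by rewrite fx.
    case: hf => fl [fM1 fM] fs; split.
    - by move=> k b c; rewrite fl.
    - by split => [|b c]; rewrite ?fM ?fM1.
    - by move=> b; rewrite fs.
  by have := congr1 (fun h : P -> P => h a) (etrans (esym e1) e2).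
by apply/asboolP; exact: sub_valP.
Qed.

(** The same comparison with the identity. Closedness of [E] is required because this universal
    property tests C*-algebras only, so the subalgebra must be complete. *)
Lemma podles_sphere_generated (R : realType) (mu c : R) (S : cstarAlgType R) (A B : S)
    (E : star_subalg S) :
  (forall a, (forall e : R, 0 < e -> exists2 b, E b & anorm (a - b) <= e) -> E a) ->
  is_podles_sphere mu c A B -> E A -> E B -> forall a, E a.
Proof.
move=> Ecl [rel univ] EA EB a.
have EA' : A \in ssa_pred E by apply/asboolP.
have EB' : B \in ssa_pred E by apply/asboolP.
have [f [[hf fA fB] _]] : exists! f : S -> sub_cstar_alg Ecl,
    [/\ starhom f, f A = SubAlg EA' & f B = SubAlg EB'].
  by apply: univ; case: rel => r1 r2 r3 r4; split; apply: val_inj.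
have [g [_ guniq]] := univ S A B rel.
have -> : a = sub_val (f a).
  have e1 : g = id by apply: guniq; split => //; split.
  have e2 : g = (fun b => sub_val (f b)).
    apply: guniq; split; [|by rewrite fA|by rewrite fB].
    case: hf => fl [fM1 fM] fs; split.
    - by move=> k b d; rewrite fl.
    - by split => [|b d]; rewrite ?fM ?fM1.
    - by move=> b; rewrite fs.
  by have := congr1 (fun h : S -> S => h a) (etrans (esym e1) e2).
by apply/asboolP; exact: sub_valP.
Qed.

(** * Words in an isometry and a defect projection *)

Section PositiveMatrices.
Variable R : realType.
Local Notation C := (R[i]).
Local Open Scope sesquilinear_scope.

Definition psd (T : nat -> nat -> C) :=
  (forall i j, T j i = (T i j)^*) /\
  forall n (v : nat -> C), 0 <= \sum_(i < n) \sum_(j < n) (v i)^* * v j * T i j.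

(** The finite section is diagonalized by a unitary [P]; the rows of [G] are the conjugated rows of
    [P], scaled by roots of the eigenvalues. *)
Lemma psd_gram (T : nat -> nat -> C) n : psd T ->
  exists G : 'I_n -> 'I_n -> C, forall i j : 'I_n, T i j = \sum_r G r i * (G r j)^*.
Proof.
move=> [Th Tp].
pose M : 'M[C]_n := \matrix_(i, j) T i j.
have Mh : M \is hermsymmx.
  apply/is_hermitianmxP; rewrite expr0 scale1r; apply/matrixP => i j.
  by rewrite !mxE.
pose P := spectralmx M; pose d := spectral_diag M.
have Pu : P \is unitarymx by exact: spectral_unitarymx.
have /orthomx_spectralP := hermitian_normalmx Mh; rewrite -/P -/d invmx_unitary // => ME.
have d0 r : 0 <= d 0 r.
  have dE : P *m M *m P ^t Num.conj = diag_mx d.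
    rewrite ME !mulmxA (unitarymxP Pu) mul1mx -mulmxA (unitarymxP Pu).
    by rewrite mulmx1.
  have -> : d 0 r = (P *m M *m P ^t Num.conj) r r.
    by rewrite dE mxE eqxx mulr1n.
  (* [psd] tests vectors indexed by [nat], so an eigenvector is extended by [0]. *)
  pose v k := if insub k is Some i then (P r i)^* else 0.
  have vE (i : 'I_n) : v i = (P r i)^* by rewrite /v valK.
  rewrite mxE (eq_bigr (fun j : 'I_n => \sum_(i < n) (v i)^* * v j * T i j)).
    by rewrite exchange_big; exact: Tp.
  move=> j _; rewrite !mxE mulr_suml; apply: eq_bigr => i _.
  by rewrite !vE conjCK mxE mulrAC.
exists (fun r i => sqrtC (d 0 r) * (P r i)^*) => i j.
have -> : T i j = M i j by rewrite mxE.
rewrite {1}ME mxE; apply: eq_bigr => r _.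
rewrite mul_mx_diag !mxE rmorphM /= conjCK (conj_Creal (x := sqrtC _)); last first.
  by rewrite ger0_real // sqrtC_ge0.
by rewrite mulrACA -expr2 sqrtCK mulrCA mulrA.
Qed.

Lemma pos_gram (A : cstarAlgType R) (T : nat -> nat -> C) (Z : nat -> A) n : psd T ->
  pos (\sum_(i < n) \sum_(j < n) T i j *: (Z i * star (Z j))).
Proof.
move=> /(@psd_gram _ n)[G TE].
have -> : \sum_(i < n) \sum_(j < n) T i j *: (Z i * star (Z j)) =
    \sum_r (\sum_i G r i *: Z i) * star (\sum_i G r i *: Z i).
  under eq_bigr => i _ do under eq_bigr => j _ do rewrite TE scaler_suml.
  under eq_bigr => i _ do rewrite exchange_big.
  rewrite exchange_big; apply: eq_bigr => r _.
  rewrite star_sum mulr_suml; apply: eq_bigr => i _.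
  rewrite mulr_sumr; apply: eq_bigr => j _.
  by rewrite starZ -scalerAl -scalerAr scalerA.
by apply: pos_sum => r _; exact: pos_mul_star.
Qed.

Lemma pos_antisym (A : cstarAlgType R) (a : A) : pos a -> pos (- a) -> a = 0.
Proof.
move=> pa pna; apply/anorm_eq0/eqP; rewrite eq_le anorm_ge0 andbT.
by apply: pos_norm_le; rewrite ?sc0 ?sub0r ?add0r //; case: pa.
Qed.

Lemma pos_scale_proj (A : cstarAlgType R) (p : A) (k : C) :
  star p = p -> p * p = p -> p != 0 -> pos (k *: p) -> 0 <= k.
Proof.
move=> sp pp p0 h.
have /complex_realP[r kr] : k \is Num.real.
  apply/CrealP; have := pos_star h; rewrite starZ sp => /eqP.
  by rewrite -subr_eq0 -scalerBl scaler_eq0 (negPf p0) orbF subr_eq0 => /eqP.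
rewrite kr Rc_ge0 leNgt; apply/negP => r0.
have p1 : pos p by rewrite -pp; exact: pos_sqr.
have : r%:C%C *: p = 0.
  apply: pos_antisym; first by rewrite -kr.
  rewrite -scaleNr -rmorphN; apply: posZ => //; rewrite oppr_ge0 ltW //.
move/eqP; rewrite scaler_eq0 (negPf p0) orbF.
by move=> /eqP/(congr1 (@complex.Re R)) /= r00; rewrite r00 ltxx in r0.
Qed.

End PositiveMatrices.

Section IsometryWords.
Variables (R : realType) (A : starAlgType R[i]).
Local Notation C := (R[i]).
Variables (w pi : A).

(** The last clause says that [pi] is a subprojection of [1 - w * star w]. The extreme cases
    [pi = 1 - w * star w] and [pi = 0] belong to the two discs, the intermediate one to the
    sphere. *)
Record isometry_pair : Prop := IsometryPair {
  isom_w : star w * w = 1;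
  isom_star_pi : star pi = pi;
  isom_pi_idem : pi * pi = pi;
  isom_star_w_pi : star w * pi = 0
}.

Definition word := (bool * (nat * nat))%type.

Definition mono (t : word) : A :=
  w ^+ t.2.1 * (if t.1 then pi else 1) * star w ^+ t.2.2.

Definition ev (l : seq (C * word)) : A := \sum_(t <- l) t.1 *: mono t.2.

Lemma ev_cat l l' : ev (l ++ l') = ev l + ev l'.
Proof. exact: big_cat. Qed.

Definition word_scale (k : C) (l : seq (C * word)) : seq (C * word) :=
  [seq (k * t.1, t.2) | t <- l].

Lemma ev_scale k l : ev (word_scale k l) = k *: ev l.
Proof.
by rewrite /ev big_map scaler_sumr; apply: eq_bigr => t _; rewrite scalerA.
Qed.

Lemma ev1 : ev [:: (1, (false, (0, 0)%N))] = 1.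
Proof. by rewrite /ev big_seq1 /mono /= scale1r !expr0 !mulr1. Qed.

Definition word_star (l : seq (C * word)) : seq (C * word) :=
  [seq (t.1^*, (t.2.1, (t.2.2.2, t.2.2.1))) | t <- l].

Hypothesis hw : isometry_pair.

Lemma pi_w : pi * w = 0.
Proof. by rewrite -(isom_star_pi hw) -[w]starK -starM isom_star_w_pi // star0. Qed.

Lemma ev_star l : ev (word_star l) = star (ev l).
Proof.
rewrite /ev big_map star_sum; apply: eq_bigr => -[k [b [i j]]] _.
rewrite starZ; congr (_ *: _); rewrite /mono /= !starM !starX starK mulrA.
by case: b; rewrite ?star1 ?isom_star_pi.
Qed.

Lemma starw_w n : star w ^+ n * w ^+ n = 1.
Proof.
elim: n => [|n IH]; first by rewrite !expr0 mulr1.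
by rewrite exprSr exprS mulrA -(mulrA _ (star w)) isom_w // mulr1.
Qed.

Lemma starw_w_le m n : (m <= n)%N -> star w ^+ m * w ^+ n = w ^+ (n - m).
Proof. by move=> mn; rewrite -{1}(subnKC mn) exprD mulrA starw_w mul1r. Qed.

Lemma starw_w_ge m n : (n <= m)%N -> star w ^+ m * w ^+ n = star w ^+ (m - n).
Proof. by move=> mn; rewrite -{1}(subnK mn) exprD -mulrA starw_w mulr1. Qed.

Lemma starw_pi n : star w ^+ n.+1 * pi = 0.
Proof. by rewrite exprSr -mulrA isom_star_w_pi // mulr0. Qed.

Lemma pi_wS n : pi * w ^+ n.+1 = 0.
Proof. by rewrite exprS mulrA pi_w mul0r. Qed.

(** The inner factor [star w ^+ b * w ^+ c] cancels to a single power; a nontrivial power is either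
    absorbed by the outer ones or killed by an adjacent [pi]. *)
Lemma mono_mul t t' : exists l, mono t * mono t' = ev l.
Proof.
case: t t' => [x [a b]] [y [c d]].
have one u : exists l, mono u = ev l.
  by exists [:: (1, u)]; rewrite /ev big_seq1 scale1r.
have zero : exists l, 0 = ev l by exists [::]; rewrite /ev big_nil.
rewrite /mono /=; set X := if x then _ else _; set Y := if y then _ else _.
have -> : w ^+ a * X * star w ^+ b * (w ^+ c * Y * star w ^+ d) =
  w ^+ a * X * (star w ^+ b * w ^+ c) * Y * star w ^+ d by rewrite !mulrA.
case: (ltngtP b c) => bc.
- rewrite starw_w_le ?(ltnW bc) //.
  have -> : (c - b)%N = (c - b).-1.+1 by rewrite prednK // subn_gt0.
  rewrite /X; case: x {X}.
    by rewrite -(mulrA (w ^+ a)) pi_wS mulr0 !mul0r.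
  rewrite mulr1 -exprD; have [l e] := one (y, ((a + (c - b).-1.+1)%N, d)).
  by exists l; rewrite -e.
- rewrite starw_w_ge ?(ltnW bc) //.
  have -> : (b - c)%N = (b - c).-1.+1 by rewrite prednK // subn_gt0.
  rewrite /Y; case: y {Y}.
    by rewrite -(mulrA (w ^+ a * X)) starw_pi mulr0 mul0r.
  rewrite mulr1 -(mulrA (w ^+ a * X)) -exprD.
  by have [l e] := one (x, (a, ((b - c).-1.+1 + d)%N)); exists l; rewrite -e.
- rewrite bc starw_w mulr1 -(mulrA (w ^+ a)).
  rewrite /X /Y; case: x {X}; case: y {Y}; rewrite ?mulr1 ?mul1r ?isom_pi_idem //.
  + by have [l e] := one (true, (a, d)); exists l; rewrite -e.
  + by have [l e] := one (true, (a, d)); exists l; rewrite -e.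
  + by have [l e] := one (true, (a, d)); exists l; rewrite -e.
  + by have [l e] := one (false, (a, d)); exists l; rewrite -e /mono /= mulr1.
Qed.

Lemma ev_mul l l' : exists l'', ev l * ev l' = ev l''.
Proof.
elim: l => [|t l [m IH]]; first by exists [::]; rewrite /ev !big_nil mul0r.
have [n nE] : exists n, mono t.2 * ev l' = ev n.
  elim: l' {IH} => [|t' l' [n IH]]; first by exists [::]; rewrite /ev !big_nil mulr0.
  have [r rE] := mono_mul t.2 t'.2.
  exists (word_scale t'.1 r ++ n).
  by rewrite ev_cat ev_scale -rE -IH /ev big_cons mulrDr -scalerAr.
exists (word_scale t.1 n ++ m); rewrite ev_cat ev_scale -nE -IH.
by rewrite {1}/ev big_cons mulrDl -scalerAl.
Qed.

End IsometryWords.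

Lemma hom_ev (R : realType) (A B : starAlgType R[i]) (f : A -> B) (w pi : A) l :
  starhom f -> f (ev w pi l) = ev (f w) (f pi) l.
Proof.
move=> hf; rewrite /ev (hom_sum hf); apply: eq_bigr => t _.
rewrite (homZ hf) /mono !(homM hf) !(homX hf) (hom_star hf).
by case: ifP; rewrite ?(hom1 hf).
Qed.

Section WordMatrices.
Variable R : realType.
Local Notation C := (R[i]).

(* Matrix entries of the words in the shift representation: [w e_k = e_(k+1)],
   with [pi] the projection onto [e_0], respectively [0]. *)
Definition shift_coef (a b i j : nat) : C := ((i + b == j + a) && (a <= i))%N%:R.
Definition unit_coef (a b i j : nat) : C := ((i == a) && (j == b))%N%:R.

Definition word_coef (flag : bool) (t : word) (i j : nat) : C :=
  if t.1 then flag%:R * unit_coef t.2.1 t.2.2 i j else shift_coef t.2.1 t.2.2 i j.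

Definition ev_coef (flag : bool) (l : seq (C * word)) (i j : nat) : C :=
  \sum_(t <- l) t.1 * word_coef flag t.2 i j.

Section Compression.
Variables (A : starAlgType C) (w : A).
Hypothesis ww : star w * w = 1.
Local Notation p := (1 - w * star w).

Lemma defect_star : star p = p.
Proof. by rewrite starB star1 starM starK. Qed.

Lemma defect_idem : p * p = p.
Proof.
rewrite mulrBr mulr1 mulrBl mul1r.
by rewrite mulrA -(mulrA w) ww mulr1 subrr subr0.
Qed.

Lemma starw_defect : star w * p = 0.
Proof. by rewrite mulrBr mulr1 mulrA ww mul1r subrr. Qed.

Lemma defect_pair : isometry_pair w p.
Proof. split; [exact: ww|exact: defect_star|exact: defect_idem|exact: starw_defect]. Qed.

Lemma zero_pair : isometry_pair w 0.
Proof. by split; rewrite ?star0 ?mulr0. Qed.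

Lemma defect_w n : p * w ^+ n.+1 = 0.
Proof. exact: pi_wS defect_pair n. Qed.

Lemma defect_starw n : star w ^+ n.+1 * p = 0.
Proof. exact: starw_pi defect_pair n. Qed.

Lemma compress0 i j : p * (star w ^+ i * w ^+ j) * p = (i == j)%:R *: p.
Proof.
have pr := defect_pair.
case: (ltngtP i j) => [ij|ij|->].
- rewrite (starw_w_le pr) ?(ltnW ij) //.
  have -> : (j - i)%N = (j - i).-1.+1 by rewrite prednK // subn_gt0.
  by rewrite defect_w mul0r scale0r.
- rewrite (starw_w_ge pr) ?(ltnW ij) //.
  have -> : (i - j)%N = (i - j).-1.+1 by rewrite prednK // subn_gt0.
  by rewrite -mulrA defect_starw mulr0 scale0r.
- by rewrite (starw_w pr) mulr1 defect_idem scale1r.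
Qed.

Lemma compress_shift a b i j :
  p * star w ^+ i * (w ^+ a * star w ^+ b) * (w ^+ j * p) = shift_coef a b i j *: p.
Proof.
have pr := defect_pair.
have -> : p * star w ^+ i * (w ^+ a * star w ^+ b) * (w ^+ j * p) =
  p * (star w ^+ i * w ^+ a) * (star w ^+ b * w ^+ j) * p by rewrite !mulrA.
rewrite /shift_coef; case: (leqP a i) => ai; last first.
  rewrite andbF scale0r (starw_w_le pr) ?(ltnW ai) //.
  have -> : (a - i)%N = (a - i).-1.+1 by rewrite prednK // subn_gt0.
  by rewrite defect_w !mul0r.
rewrite andbT (starw_w_ge pr) //.
case: (leqP b j) => bj; last first.
  rewrite (starw_w_ge pr) ?(ltnW bj) //.
  have -> : (b - j)%N = (b - j).-1.+1 by rewrite prednK // subn_gt0.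
  rewrite -mulrA defect_starw mulr0.
  case: eqP => [e|]; last by rewrite scale0r.
  by have := leq_add ai bj; rewrite addnS addnC e [(j + a)%N]addnC ltnn.
rewrite (starw_w_le pr) // -(mulrA p) compress0; congr (_%:R *: _).
by rewrite -(eqn_add2r (a + b)) addnA subnK // addnCA subnK // [(a + j)%N]addnC.
Qed.

Lemma compress_unit a b i j :
  p * star w ^+ i * (w ^+ a * p * star w ^+ b) * (w ^+ j * p) = unit_coef a b i j *: p.
Proof.
have -> : p * star w ^+ i * (w ^+ a * p * star w ^+ b) * (w ^+ j * p) =
  (p * (star w ^+ i * w ^+ a) * p) * (star w ^+ b * w ^+ j) * p by rewrite !mulrA.
rewrite compress0 -!scalerAl compress0 scalerA /unit_coef.
by rewrite [b == j]eq_sym; case: eqP; case: eqP; rewrite ?mulr0 ?mul0r ?mulr1.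
Qed.

(** Matrix entries are obtained inside the algebra: [w ^+ j * p] plays the role of the basis vector
    [e_j], and scalars appear as multiples of [p]. *)
Lemma compress_ev (flag : bool) l i j :
  p * star w ^+ i * ev w (if flag then p else 0) l * (w ^+ j * p) =
  ev_coef flag l i j *: p.
Proof.
rewrite /ev mulr_sumr mulr_suml /ev_coef scaler_suml; apply: eq_bigr => -[k [x [a b]]] _.
rewrite -scalerAr -scalerAl -scalerA; congr (_ *: _).
rewrite /mono /word_coef /=; case: x; last by rewrite mulr1 compress_shift.
case: flag; first by rewrite compress_unit mul1r.
by rewrite !(mulr0, mul0r) scale0r.
Qed.

End Compression.
End WordMatrices.

Section AveragedWords.
Variables (R : realType) (A : cstarAlgType R) (w pi : A).
Local Notation C := (R[i]).
Hypothesis hw : isometry_pair w pi.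

Lemma unit_sum N a b (F : nat -> nat -> A) :
  \sum_(i < N) \sum_(j < N) unit_coef R a b i j *: F i j =
  if ((a < N) && (b < N))%N then F a b else 0.
Proof.
rewrite /unit_coef; case: ifP => [/andP[aN bN]|/negbT h].
  rewrite (bigD1 (Ordinal aN)) //= (bigD1 (Ordinal bN)) //= !eqxx scale1r.
  rewrite !big1 ?addr0 // => [i ia|j jb].
    rewrite big1 // => j _; have /negPf -> : (i != a :> nat) by [].
    by rewrite scale0r.
  by have /negPf -> : (j != b :> nat) by []; rewrite scale0r.
rewrite big1 // => i _; rewrite big1 // => j _.
case: andP => [[/eqP ia /eqP jb]|_]; last by rewrite scale0r.
by move: h; rewrite -ia -jb !ltn_ord.
Qed.

Lemma shift_coefE a b i j N : (i < N)%N -> (j < N)%N ->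
  shift_coef R a b i j = \sum_(l < N - maxn a b) unit_coef R (a + l) (b + l) i j.
Proof.
move=> iN jN; rewrite /shift_coef /unit_coef; case: andP => [[/eqP e ai]|h].
  have bi : (b + (i - a) = j)%N.
    by apply/eqP; rewrite -(eqn_add2r a) -addnA subnK // addnC e.
  have lN : (i - a < N - maxn a b)%N.
    by rewrite ltn_subRL addn_maxl gtn_max subnKC // bi iN jN.
  rewrite (bigD1 (Ordinal lN)) //= subnKC // bi !eqxx big1 ?addr0 // => l lne.
  case: andP => // -[/eqP il _]; case/eqP: lne; apply: val_inj => /=.
  by rewrite il addKn.
rewrite big1 // => l _; case: andP => // -[/eqP il /eqP jl]; case: h.
rewrite il jl; split; last exact: leq_addr.
by apply/eqP; rewrite addnAC [RHS]addnAC [(a + b)%N]addnC.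
Qed.

Lemma shift_sum N a b (F : nat -> nat -> A) :
  \sum_(i < N) \sum_(j < N) shift_coef R a b i j *: F i j =
  \sum_(l < N - maxn a b) F (a + l)%N (b + l)%N.
Proof.
transitivity (\sum_(i < N) \sum_(j < N) \sum_(l < N - maxn a b)
    unit_coef R (a + l) (b + l) i j *: F i j).
  apply: eq_bigr => i _; apply: eq_bigr => j _.
  by rewrite (shift_coefE a b (ltn_ord i) (ltn_ord j)) scaler_suml.
under eq_bigr => i _ do rewrite exchange_big.
rewrite exchange_big; apply: eq_bigr => l _; rewrite unit_sum.
have := ltn_ord l; rewrite ltn_subRL addn_maxl gtn_max => /andP[-> ->].
by [].
Qed.

Definition defect := 1 - w * star w - pi.

Lemma defect_compl_star : star defect = defect.
Proof. by rewrite /defect !starB star1 starM starK (isom_star_pi hw). Qed.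

Lemma defect_compl_idem : defect * defect = defect.
Proof.
have h1 : w * star w * pi = 0 by rewrite -mulrA isom_star_w_pi // mulr0.
have h2 : pi * (w * star w) = 0 by rewrite mulrA (pi_w hw) mul0r.
have h3 : w * star w * (w * star w) = w * star w.
  by rewrite mulrA -(mulrA w) (isom_w hw) mulr1.
have h4 := isom_pi_idem hw.
transitivity (1 - (w * star w + w * star w - w * star w * (w * star w)) -
  (pi + pi - pi * pi) + w * star w * pi + pi * (w * star w)).
  by rewrite /defect; ncring R.
by rewrite h1 h2 h3 h4 !addr0 !addrK.
Qed.

(* The weights [1 - max(i, j) / n] telescope: averaging the corner matrices of size at most
   [n] and the one-step shifted corner reproduces each word up to the factor
   [1 - max(a, b) / n]. *)
Definition corner_sum (T T' : nat -> nat -> C) n : A :=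
  \sum_(m < n) (\sum_(i < m.+1) \sum_(j < m.+1) T i j *: (w ^+ i * pi * star w ^+ j) +
                \sum_(i < m.+1) \sum_(j < m.+1) T' i j *: (w ^+ i * defect * star w ^+ j)) +
  \sum_(i < n) \sum_(j < n) T' i j *: (w ^+ i.+1 * star w ^+ j.+1).

Lemma corner_sum_pos T T' n : psd T -> psd T' -> pos (corner_sum T T' n).
Proof.
have conv (e : A) i j : star e = e -> e * e = e ->
    w ^+ i * e * star w ^+ j = (w ^+ i * e) * star (w ^+ j * e).
  by move=> se ee; rewrite starM starX se mulrA -(mulrA _ e e) ee.
move=> pT pT'; apply: posD.
  apply: pos_sum => m _; apply: posD.
    under eq_bigr => i _ do under eq_bigr => j _ do
      rewrite (conv _ _ _ (isom_star_pi hw) (isom_pi_idem hw)).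
    exact: (pos_gram (fun i => w ^+ i * pi)).
  under eq_bigr => i _ do under eq_bigr => j _ do
    rewrite (conv _ _ _ defect_compl_star defect_compl_idem).
  exact: (pos_gram (fun i => w ^+ i * defect)).
under eq_bigr => i _ do under eq_bigr => j _ do rewrite -starX.
exact: (pos_gram (fun i => w ^+ i.+1)).
Qed.

Lemma corner_sum_linear (k : C) (T1 T1' T2 T2' T T' : nat -> nat -> C) n :
  (forall i j, T i j = k * T1 i j + T2 i j) ->
  (forall i j, T' i j = k * T1' i j + T2' i j) ->
  corner_sum T T' n = k *: corner_sum T1 T1' n + corner_sum T2 T2' n.
Proof.
move=> e e'.
have lin N (U1 U2 U : nat -> nat -> C) (F : nat -> nat -> A) :
    (forall i j, U i j = k * U1 i j + U2 i j) ->
    \sum_(i < N) \sum_(j < N) U i j *: F i j =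
    k *: (\sum_(i < N) \sum_(j < N) U1 i j *: F i j) +
    \sum_(i < N) \sum_(j < N) U2 i j *: F i j.
  move=> eU; rewrite scaler_sumr -big_split; apply: eq_bigr => i _ /=.
  rewrite scaler_sumr -big_split; apply: eq_bigr => j _ /=.
  by rewrite eU scalerDl scalerA.
rewrite /corner_sum scalerDr addrACA.
rewrite (lin _ T1' T2' T' (fun i j => w ^+ i.+1 * star w ^+ j.+1)) //; congr (_ + _).
rewrite scaler_sumr -big_split; apply: eq_bigr => m _ /=.
rewrite (lin _ T1 T2 T (fun i j => w ^+ i * pi * star w ^+ j)) //.
rewrite (lin _ T1' T2' T' (fun i j => w ^+ i * defect * star w ^+ j)) //.
by rewrite scalerDr addrACA.
Qed.

Lemma telescope_words (U : nat -> A) K : \sum_(l < K) (U l - U l.+1) = U 0%N - U K.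
Proof.
elim: K => [|K IH]; first by rewrite big_ord0 subrr.
by rewrite big_ord_recr /= IH addrA subrK.
Qed.

Lemma corner_sum_word (t : word) n :
  corner_sum (word_coef R true t) (word_coef R false t) n =
  (n - maxn t.2.1 t.2.2)%N%:R *: mono w pi t.
Proof.
case: t => [[] [a b]]; rewrite /corner_sum /word_coef /mono /=; set M := maxn a b.
  have zero N (F : nat -> nat -> A) :
      \sum_(i < N) \sum_(j < N) (0%:R * unit_coef R a b i j) *: F i j = 0.
    by rewrite big1 // => i _; rewrite big1 // => j _; rewrite mul0r scale0r.
  rewrite (zero _ (fun i j => w ^+ i.+1 * star w ^+ j.+1)) addr0.
  under eq_bigr => m _.
    rewrite (zero _ (fun i j => w ^+ i * defect * star w ^+ j)) addr0.
    under eq_bigr => i _ do under eq_bigr => j _ do rewrite mul1r.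
    rewrite (unit_sum _ _ _ (fun i j => w ^+ i * pi * star w ^+ j)).
    over.
  elim: n => [|n IH]; first by rewrite big_ord0 sub0n scale0r.
  rewrite big_ord_recr /= IH !ltnS -geq_max -/M.
  case: leqP => h; first by rewrite subSn // -natr1 scalerDl scale1r.
  by rewrite addr0 (eqP (ltnW h : (n - M == 0)%N)) (eqP (h : (n.+1 - M == 0)%N)).
(* As [pi + defect = 1 - w * star w], the block of index [m] telescopes to [U 0 - U (m.+1 - M)]. The
   final double sum of [corner_sum] restores exactly the subtracted terms, leaving [n - M] copies of
   [U 0]. *)
pose U l := w ^+ (a + l) * star w ^+ (b + l).
rewrite mulr1 (shift_sum _ _ _ (fun i j => w ^+ i.+1 * star w ^+ j.+1)) -/M.
under eq_bigr => m _.
  rewrite (shift_sum _ _ _ (fun i j => w ^+ i * pi * star w ^+ j)).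
  rewrite (shift_sum _ _ _ (fun i j => w ^+ i * defect * star w ^+ j)).
  rewrite -big_split /=.
  under eq_bigr => l _.
    have -> : w ^+ (a + l) * pi * star w ^+ (b + l) +
       w ^+ (a + l) * defect * star w ^+ (b + l) = U l - U l.+1.
      rewrite /U !addnS exprSr exprS /defect; ncring R.
    over.
  rewrite telescope_words.
  over.
have -> : \sum_(l < n - M) w ^+ (a + l).+1 * star w ^+ (b + l).+1 = \sum_(l < n - M) U l.+1.
  by apply: eq_bigr => l _; rewrite /U !addnS.
have -> : w ^+ a * star w ^+ b = U 0%N by rewrite /U !addn0.
rewrite -/M; elim: n => [|n IH]; first by rewrite !big_ord0 addr0 scale0r.
rewrite big_ord_recr /=; case: (leqP M n) => h.
  rewrite subSn // big_ord_recr /= -natr1 scalerDl scale1r -IH.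
  by rewrite addrACA subrK.
move: IH; rewrite (eqP (ltnW h : (n - M == 0)%N)) (eqP (h : (n.+1 - M == 0)%N)).
by rewrite !big_ord0 !addr0 subrr addr0.
Qed.

Lemma aconvE (u : nat -> A) (l : A) :
  aconv u l <-> sconv (u : nat -> normed_of A) (l : normed_of A).
Proof.
by split=> h e /h[N NP]; exists N => n /NP; rewrite -lecR.
Qed.

(** Each word comes back with the factor [1 - M / (n + 1)], where [M] is its larger exponent (or [0]
    past the cutoff), so the error is of order [1 / n]. *)
Lemma word_average_cvg (l : seq (C * word)) :
  aconv (fun n => (n.+1%:R^-1)%:C%C *: corner_sum (ev_coef true l) (ev_coef false l) n.+1)
        (ev w pi l).
Proof.
elim: l => [|[k t] l IH].
  rewrite /ev big_nil => e e0; exists 0%N => n _; rewrite subr0.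
  rewrite (_ : corner_sum _ _ _ = 0) ?scaler0 ?anorm0 ?ltW //.
  have z flag i j : ev_coef flag [::] i j = 0 :> C by rewrite /ev_coef big_nil.
  rewrite /corner_sum !big1 ?addr0 // => i _.
    by rewrite big1 // => j _; rewrite z scale0r.
  rewrite !big1 ?addr0 // => j _; rewrite big1 // => h _; by rewrite z scale0r.
have e flag i j : ev_coef flag ((k, t) :: l) i j = k * word_coef R flag t i j + ev_coef flag l i j.
  by rewrite /ev_coef big_cons.
rewrite /ev big_cons /=; apply/aconvE.
set M := maxn t.2.1 t.2.2.
apply: (@eq_sconv _ _ (fun n => k *: ((n.+1%:R^-1)%:C%C *: ((n.+1 - M)%N%:R *: mono w pi t : normed_of A)) +
   (n.+1%:R^-1)%:C%C *: (corner_sum (ev_coef true l) (ev_coef false l) n.+1 : normed_of A))).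
  move=> n; rewrite (corner_sum_linear _ (e true) (e false)) corner_sum_word [RHS]scalerDr.
  have swap (k1 k2 : C) (x : A) : k1 *: (k2 *: x) = k2 *: (k1 *: x).
    by rewrite !scalerA mulrC.
  by congr (_ + _); exact: swap.
apply: sconvD; last by apply/aconvE.
apply: sconvZ; apply/aconvE => d d0.
pose K := anorm (mono w pi t) * M%:R.
have K0 : 0 <= K by rewrite mulr_ge0 ?anorm_ge0.
have [N NP] : exists N : nat, K / d <= N%:R.
  by exists (Num.trunc (K / d)).+1; rewrite ltW // truncnS_gt.
exists (N + M)%N => n Nn.
have Mn : (M <= n.+1)%N by rewrite (leq_trans (leq_addl N M)) // (leq_trans Nn).
have -> : (n.+1%:R^-1)%:C%C *: ((n.+1 - M)%N%:R *: mono w pi t) - mono w pi t =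
   (- (M%:R / n.+1%:R))%:C%C *: mono w pi t.
  rewrite scalerA -{2}[mono w pi t]scale1r -scalerBl; congr (_ *: _).
  rewrite -(Rc_nat R) -RcM -(Rc1 R) -RcB natrB //; congr (_%:C)%C.
  by rewrite mulrBr mulVf ?pnatr_eq0 // addrAC subrr sub0r mulrC.
rewrite anormZr normrN ger0_norm ?divr_ge0 // mulrC mulrA -/K.
rewrite ler_pdivrMr ?ltr0n // mulrC -ler_pdivrMr // (le_trans NP) // ler_nat.
by rewrite (leq_trans (leq_addr M N)) // (leq_trans Nn).
Qed.

Lemma ev_pos (l : seq (C * word)) :
  psd (ev_coef true l) -> psd (ev_coef false l) -> pos (ev w pi l).
Proof.
move=> p1 p2; apply: pos_lim => e e0.
have [N /(_ N (leqnn _)) h] := word_average_cvg l e0.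
eexists; last by rewrite anormBC; exact: h.
apply: posZ; first by rewrite invr_ge0.
exact: corner_sum_pos.
Qed.

End AveragedWords.

Section PsdCoefficients.
Variables (R : realType) (D : cstarAlgType R) (s : D).
Local Notation C := (R[i]).
Hypothesis ss : star s * s = 1.
Local Notation p := (1 - s * star s).
Hypothesis p0 : p != 0.

(** Converse of [ev_pos]: conjugating a positive [a] by [z], the sum of the [v_j s^j p], gives the
    value of the quadratic form times [p]. Here [p != 0] is what allows the scalar to be read
    off. *)
Lemma psd_ev_coef (flag : bool) (l : seq (C * word)) :
  pos (ev s (if flag then p else 0) l) -> psd (ev_coef flag l).
Proof.
set a := ev s _ l => pa.
have cE i j : p * star s ^+ i * a * (s ^+ j * p) = ev_coef flag l i j *: p.
  exact: compress_ev.
split=> [i j|n v].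
  have h : star (ev_coef flag l i j *: p) = ev_coef flag l j i *: p.
    rewrite -(cE i j) -(cE j i) !starM !starX !starK (defect_star s) (pos_star pa).
    by rewrite !mulrA.
  have : (ev_coef flag l j i - (ev_coef flag l i j)^*) *: p = 0.
    by rewrite scalerBl -h starZ (defect_star s) subrr.
  move/eqP; rewrite scaler_eq0 (negPf p0) orbF subr_eq0 => /eqP.
  by [].
pose z := \sum_(j < n) v j *: (s ^+ j * p).
apply: (pos_scale_proj (defect_star s) (defect_idem ss) p0).
have -> : (\sum_(i < n) \sum_(j < n) (v i)^* * v j * ev_coef flag l i j) *: p =
    star z * a * z; last exact: pos_conj.
rewrite /z star_sum !mulr_suml scaler_suml; apply: eq_bigr => i _.
rewrite mulr_sumr scaler_suml; apply: eq_bigr => j _.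
rewrite -scalerA -cE starZ starM (defect_star s) starX.
by rewrite -!scalerAl -!scalerAr scalerA.
Qed.

End PsdCoefficients.

(** * Laurent elements and their symbols *)

Section RootsOfUnity.
Variable R : realType.
Local Notation C := (R[i]).

Lemma complex_prim_root n : (0 < n)%N -> exists z : C, n.-primitive_root z.
Proof.
move=> n0.
have [r rE] := closed_field_poly_normal ('X^n - 1 : {poly C}).
have lc : lead_coef ('X^n - 1 : {poly C}) = 1 by rewrite -polyC1 lead_coefXnsubC.
rewrite lc scale1r in rE.
have sr : size r = n.
  by apply/eqP; rewrite -eqSS -(size_prod_XsubC _ id) -rE -polyC1 size_XnsubC.
have /hasP[z _ zP] : has n.-primitive_root r.
  apply: has_prim_root => //; last by rewrite sr.
    by apply/allP => z zr; rewrite /root_of_unity rE root_prod_XsubC.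
  rewrite -separable_prod_XsubC -rE separable_Xn_sub_1 //.
  by rewrite pnatr_eq0 -lt0n.
by exists z.
Qed.

Lemma prim_root_norm n (z : C) : (0 < n)%N -> n.-primitive_root z -> `|z| = 1.
Proof.
move=> n0 /prim_expr_order zn.
have : `|z| ^+ n = 1 by rewrite -normrX zn normr1.
by move=> /eqP; rewrite pexpr_eq1 // => /eqP.
Qed.

Lemma norm1_conj (z : C) : `|z| = 1 -> z * z^* = 1.
Proof. by move=> z1; rewrite -normCK z1 expr1n. Qed.

(** Averages over roots of unity stand in for integrals over the circle; for exponents below [m]
    they are exact. *)
Lemma prim_root_orthogonality m (z : C) a b : m.-primitive_root z ->
  (a < m)%N -> (b < m)%N ->
  \sum_(r < m) (z ^+ r) ^+ a * ((z ^+ r)^*) ^+ b = (a == b)%N%:R * m%:R.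
Proof.
move=> pz am bm.
have m0 : (0 < m)%N by exact: leq_ltn_trans am.
have zz := norm1_conj (prim_root_norm m0 pz).
pose x := z ^+ a * z^* ^+ b.
have -> : \sum_(r < m) (z ^+ r) ^+ a * ((z ^+ r)^*) ^+ b = \sum_(r < m) x ^+ r.
  apply: eq_bigr => r _; rewrite rmorphXn /= /x exprMn -!exprM.
  by rewrite [(a * r)%N]mulnC [(b * r)%N]mulnC.
have [ab|ab] := eqVneq a b.
  have -> : x = 1 by rewrite /x ab -exprMn zz expr1n.
  under eq_bigr => r _ do rewrite expr1n.
  by rewrite sumr_const card_ord mul1r.
have x1 : x != 1.
  apply/eqP => x1; case/eqP: ab; apply/eqP.
  have : z ^+ a = z ^+ b.
    by rewrite -[RHS]mul1r -x1 /x -mulrA -exprMn [z^* * z]mulrC zz expr1n mulr1.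
  by move=> /eqP; rewrite (eq_prim_root_expr pz) !modn_small // => /eqP.
have xm : x ^+ m = 1.
  rewrite /x exprMn -!exprM ![(_ * m)%N]mulnC !exprM -rmorphXn (prim_expr_order pz).
  by rewrite rmorph1 !expr1n mul1r.
rewrite mul0r; apply: (mulfI (_ : x - 1 != 0)); first by rewrite subr_eq0.
by rewrite -subrX1 xm subrr mulr0.
Qed.

End RootsOfUnity.

Section LaurentWords.
Variables (R : realType) (D : cstarAlgType R) (t : D) (chi : R[i] -> D -> R[i]).
Local Notation C := (R[i]).
Hypothesis ht : star t * t = 1.
Hypothesis chi_char : forall z, `|z| = 1 -> character (chi z).
Hypothesis chi_t : forall z, `|z| = 1 -> chi z t = z.

Lemma charX (f : D -> C) a n : character f -> f (a ^+ n) = f a ^+ n.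
Proof.
by move=> hf; elim: n => [|n IH]; rewrite ?expr0 ?(char1 hf) // !exprS (charM hf) IH.
Qed.

Lemma chi_word z a b : `|z| = 1 -> chi z (t ^+ a * star t ^+ b) = z ^+ a * (z^*) ^+ b.
Proof.
move=> z1; have hc := chi_char z1.
by rewrite (charM hc) (charX _ _ hc) (charX _ _ hc) (char_star hc) (chi_t z1).
Qed.

(** Trigonometric polynomials in [t]: each word is a pure power of [t] or of [star t], so its
    coefficient matrix is Toeplitz. *)
Inductive laurent : D -> Prop :=
| laurent0 : laurent 0
| laurent_add (k : C) a b y : (a == 0)%N || (b == 0)%N -> laurent y ->
    laurent (k *: (t ^+ a * star t ^+ b) + y).

Lemma laurentD x y : laurent x -> laurent y -> laurent (x + y).
Proof.
by elim=> [|k a b z ab _ IH] ly; rewrite ?add0r // -addrA; apply: laurent_add => //; exact: IH.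
Qed.

Lemma laurentZ k x : laurent x -> laurent (k *: x).
Proof.
elim=> [|l a b z ab _ IH]; first by rewrite scaler0; exact: laurent0.
by rewrite scalerDr scalerA; exact: laurent_add.
Qed.

Lemma laurent_word a b : (a == 0)%N || (b == 0)%N -> laurent (t ^+ a * star t ^+ b).
Proof.
by move=> ab; rewrite -[_ * _]scale1r -[_ *: _]addr0; apply: laurent_add => //; exact: laurent0.
Qed.

Lemma laurent1 : laurent 1.
Proof. by have := @laurent_word 0 0 isT; rewrite !expr0 mulr1. Qed.

Lemma laurent_star x : laurent x -> laurent (star x).
Proof.
elim=> [|l a b z ab _ IH]; first by rewrite star0; exact: laurent0.
rewrite starD starZ starM !starX starK; apply: laurent_add => //.
by rewrite orbC.
Qed.

(* [T i j] is the Fourier coefficient of the symbol at [i - j]. *)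
Lemma laurent_coef y : laurent y -> exists l K, y = ev t 0 l /\
  forall (m : nat) (z : C), m.-primitive_root z ->
  forall i j flag, (i + K < m)%N -> (j + K < m)%N ->
    ev_coef flag l i j * m%:R = \sum_(r < m) (z ^+ r) ^+ j * ((z ^+ r)^*) ^+ i * chi (z ^+ r) y.
Proof.
elim=> [|k a b x ab _ [l [K [-> IH]]]].
  exists [::], 0%N; split; first by rewrite /ev big_nil.
  move=> m z pz i j flag im jm; rewrite /ev_coef big_nil mul0r.
  have m0 : (0 < m)%N by exact: leq_ltn_trans im.
  rewrite big1 // => r _; rewrite char0 ?mulr0 //; apply: chi_char.
  by rewrite normrX (prim_root_norm m0 pz) expr1n.
exists ((k, (false, (a, b))) :: l), (maxn K (maxn a b)); split.
  by rewrite /ev big_cons /mono /= mulr1.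
move=> m z pz i j flag im jm.
have m0 : (0 < m)%N by exact: leq_ltn_trans im.
have z1 := prim_root_norm m0 pz.
have zr1 r : `|z ^+ r| = 1 by rewrite normrX z1 expr1n.
have iK : (i + K < m)%N by rewrite (leq_ltn_trans _ im) // leq_add2l leq_maxl.
have jK : (j + K < m)%N by rewrite (leq_ltn_trans _ jm) // leq_add2l leq_maxl.
have ib : (i + b < m)%N by rewrite (leq_ltn_trans _ im) // leq_add2l !leq_max leqnn !orbT.
have ja : (j + a < m)%N by rewrite (leq_ltn_trans _ jm) // leq_add2l !leq_max leqnn !orbT.
rewrite /ev_coef big_cons /= mulrDl -/(ev_coef flag l i j) (IH m z pz i j flag iK jK).
(* The cutoff [a <= i] in [shift_coef] is automatic when one of the exponents vanishes, so only the
   diagonal [i - j] matters. *)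
have -> : word_coef R flag (false, (a, b)) i j = (j + a == i + b)%N%:R.
  rewrite /word_coef /= /shift_coef eq_sym; congr (_%:R : C).
  case: eqP => // e; rewrite [LHS]/=; case/orP: ab => /eqP ab0; first by rewrite ab0.
  by move: e; rewrite ab0 addn0 => <-; rewrite leq_addl.
rewrite -mulrA -(prim_root_orthogonality pz ja ib) mulr_sumr -big_split /=.
apply: eq_bigr => r _; have hc := chi_char (zr1 r).
rewrite (charD hc) (charZ hc) chi_word // mulrDr; congr (_ + _).
by rewrite !exprD; ring.
Qed.

(** By the quadrature, [m] times the quadratic form is the sum over [r] of [chi (z ^+ r) y] times
    the squared modulus of a polynomial at [z ^+ r]. The number [m] of nodes is chosen after the
    size of the section. *)
Lemma laurent_pos y : laurent y -> (forall z, `|z| = 1 -> 0 <= chi z y) -> pos y.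
Proof.
move=> ly y0; have [l [K [yE lP]]] := laurent_coef ly.
suff ps flag : psd (ev_coef flag l).
  by rewrite yE; apply: ev_pos => //; exact: zero_pair.
have key n : exists m (z : C), [/\ (0 < m)%N, m.-primitive_root z,
    (forall r, `|z ^+ r| = 1) & forall i j : nat, (i < n)%N -> (j < n)%N ->
    ev_coef flag l i j * m%:R = \sum_(r < m) (z ^+ r) ^+ j * ((z ^+ r)^*) ^+ i * chi (z ^+ r) y].
  have m0 : (0 < (n + K).+1)%N by [].
  have [z pz] := complex_prim_root R m0.
  exists (n + K).+1, z; split => // [r|i j iN jN].
    by rewrite normrX (prim_root_norm m0 pz) expr1n.
  by apply: lP => //; rewrite ltnS leq_add2r ltnW.
split=> [i j|n v].
  have [m [z [m0 pz zr E]]] := key (maxn i j).+1.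
  have mC : (m%:R : C) != 0 by rewrite pnatr_eq0 -lt0n.
  apply: (mulIf mC); rewrite E ?ltnS ?leq_maxl ?leq_maxr //.
  rewrite -[X in _ = _ * X](conjC_nat _ m) -rmorphM E ?ltnS ?leq_maxl ?leq_maxr //.
  rewrite rmorph_sum; apply: eq_bigr => r _.
  rewrite !rmorphM /= !rmorphXn /= !conjCK (conj_Creal (ger0_real (y0 _ (zr r)))).
  by congr (_ * _); exact: mulrC.
have [m [z [m0 pz zr E]]] := key n.
have mC : 0 < (m%:R : C) by rewrite ltr0n.
rewrite -(pmulr_lge0 _ mC) mulr_suml.
have -> : \sum_(i < n) (\sum_(j < n) (v i)^* * v j * ev_coef flag l i j) * m%:R =
  \sum_(r < m) chi (z ^+ r) y * ((\sum_(j < n) v j * (z ^+ r) ^+ j) *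
    (\sum_(j < n) v j * (z ^+ r) ^+ j)^*).
  under eq_bigr => i _.
    rewrite mulr_suml; under eq_bigr => j _ do rewrite -mulrA E // mulr_sumr.
    rewrite exchange_big; over.
  rewrite exchange_big; apply: eq_bigr => r _ /=.
  rewrite rmorph_sum [RHS]mulrC mulr_sumr mulr_suml; apply: eq_bigr => i _.
  rewrite mulr_suml mulr_suml; apply: eq_bigr => j _.
  by rewrite rmorphM !rmorphXn /=; ring.
apply: sumr_ge0 => r _; rewrite mulr_ge0 ?mul_conjC_ge0 //.
exact: y0.
Qed.

(** For self-adjoint [y] the bound is [d], by positivity of [d - y] and [d + y]; the factor [2]
    comes from adding real and imaginary parts. *)
Lemma laurent_norm_le y (d : R) : 0 <= d -> laurent y ->
  (forall z, `|z| = 1 -> `|chi z y| <= d%:C%C) -> anorm y <= 2 * d.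
Proof.
move=> d0 ly yd.
have sa x : laurent x -> star x = x -> (forall z, `|z| = 1 -> `|chi z x| <= d%:C%C) ->
    anorm x <= d.
  move=> lx sx xd.
  have lsc : laurent (sc D d) by apply: laurentZ; exact: laurent1.
  have real z : `|z| = 1 -> chi z x \is Num.real.
    by move=> z1; apply/CrealP; rewrite -(char_star (chi_char z1)) sx.
  apply: pos_norm_le => //; apply: laurent_pos.
  - by apply: laurentD => //; rewrite -scaleN1r; exact: laurentZ.
  - move=> z z1; rewrite (charB (chi_char z1)) (char_sc (chi_char z1)) subr_ge0.
    by apply: le_trans (xd z z1); exact: real_ler_norm (real z z1).
  - exact: laurentD.
  - move=> z z1; rewrite (charD (chi_char z1)) (char_sc (chi_char z1)) -lerBlDr sub0r.
    by apply: le_trans (xd z z1); rewrite -normrN; apply: real_ler_norm; rewrite realN real.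
have half (u v : C) : `|u| <= d%:C%C -> `|v| <= d%:C%C -> `|2^-1%:C%C * (u + v)| <= d%:C%C.
  move=> ud vd; rewrite normrM ger0_norm ?Rc_ge0 //.
  apply: (@le_trans _ _ (2^-1%:C%C * (d%:C%C + d%:C%C))).
    by rewrite ler_wpM2l ?Rc_ge0 // (le_trans (ler_normD _ _)) // lerD.
  by rewrite -RcD -RcM lecR; lra.
rewrite (re_im_part y); apply: (le_trans (anormD _ _)).
rewrite anormZi mulr_natl mulr2n; apply: lerD; apply: sa.
- by apply: laurentZ; apply: laurentD => //; exact: laurent_star.
- exact: star_re_part.
- move=> z z1; have hc := chi_char z1; rewrite (charZ hc) (charD hc) (char_star hc).
  by apply: half; rewrite ?norm_conjC yd.
- apply: laurentZ; apply: laurentZ; apply: laurentD; first exact: laurent_star.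
  by rewrite -scaleN1r; exact: laurentZ.
- exact: star_im_part.
- move=> z z1; have hc := chi_char z1; rewrite (charZ hc) (charZ hc) (charB hc) (char_star hc).
  by rewrite mulrDr; apply: half; rewrite normrM normCi mul1r ?normrN ?norm_conjC yd.
Qed.

End LaurentWords.

(** * The isometries of the discs and of the sphere *)

Section ClosedStarAlgebras.
Variables (R : realType) (A : cstarAlgType R).
Local Notation C := (R[i]).

Record closed_star_alg (E : A -> Prop) : Prop := ClosedStarAlg {
  csa_closed_alg :> closed_alg E;
  csa_star : forall a, E a -> E (star a)
}.

Definition csa_subalg E (EE : closed_star_alg E) : star_subalg A :=
  @StarSubalg _ A E (calg1 EE) (calgD EE) (calgZ EE) (calgM EE) (csa_star EE).

Lemma isometry_norm (w : A) : star w * w = 1 -> anorm w = 1.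
Proof.
move=> ww; apply/eqP; rewrite -(@eqrXn2 _ 2) ?anorm_ge0 //.
by rewrite -cstar_identity ww anorm1 expr1n.
Qed.

Lemma isometry_conj_norm_le (w z : A) : star w * w = 1 -> anorm (w * z * star w) <= anorm z.
Proof.
move=> /isometry_norm w1; apply: (le_trans (anormM _ _)).
rewrite anorm_star w1 mulr1; apply: (le_trans (anormM _ _)).
by rewrite w1 mul1r.
Qed.

Lemma exp_small (m K e : R) : 0 <= m < 1 -> 0 < e -> exists n, m ^+ n * K <= e.
Proof.
move=> /andP[m0 m1] e0.
have : m ^+ n * K @[n --> \oo] --> 0 * K.
  apply: cvgM; last exact: cvg_cst.
  by apply: cvg_expr; rewrite ger0_norm.
rewrite mul0r => /(@cvgrPdist_le R R^o _ eventually _)/(_ e e0)[N _ /(_ N (leqnn _))] /=.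
by rewrite sub0r normrN => h; exists N; apply: le_trans (ler_norm _) h.
Qed.

(** The affine map contracts by [m], so its iterates from [0], all in [E], approach the given
    fixpoint [z] at rate [m ^+ n]. It recovers the disc generator from [s] (with [m = q]) and [A]
    from [W], [P] (with [m = mu^2]). *)
Lemma conj_fixpoint_mem (E : A -> Prop) (w e z : A) (m : R) :
  closed_star_alg E -> star w * w = 1 -> 0 <= m < 1 -> E w -> E e ->
  z = e + m%:C%C *: (w * z * star w) -> E z.
Proof.
move=> EE ww m01 Ew Ee ze.
have step n : exists2 y, E y & anorm (z - y) <= m ^+ n * anorm z.
  elim: n => [|n [y Ey zy]].
    by exists 0; [exact: (calg0 EE)|rewrite subr0 expr0 mul1r].
  exists (e + m%:C%C *: (w * y * star w)).
    apply: (calgD EE) => //; apply: (calgZ EE); apply: (calgM EE); last exact: csa_star.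
    exact: (calgM EE).
  have -> : z - (e + m%:C%C *: (w * y * star w)) = m%:C%C *: (w * (z - y) * star w).
    by rewrite {1}ze; ncring R.
  have /andP[m0 _] := m01.
  rewrite anormZr ger0_norm // exprS -(mulrA m) ler_wpM2l //.
  exact: le_trans (isometry_conj_norm_le _ ww) zy.
apply: (calg_lim EE) => d d0.
have [n nd] := exp_small (anorm z) m01 d0.
by have [y Ey zy] := step n; exists y => //; apply: le_trans nd.
Qed.

Lemma closed_star_alg_words (w pi : A) : isometry_pair w pi ->
  closed_star_alg (fun a => forall e : R, 0 < e -> exists l, anorm (a - ev w pi l) <= e).
Proof.
move=> hw; split; first split.
- by move=> e e0; exists [:: (1, (false, (0, 0)%N))]; rewrite ev1 subrr anorm0 ltW.
- move=> a b ha hb e e0; have e20 : 0 < e / 2 by rewrite divr_gt0.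
  have [l al] := ha _ e20; have [l' bl] := hb _ e20; exists (l ++ l').
  rewrite ev_cat opprD addrACA (le_trans (anormD _ _)) //; lra.
- move=> k a ha e e0.
  pose r := complex.Re `|k| + 1.
  have k0 : 0 <= complex.Re `|k| by rewrite -Rc_ge0 RRe_real ?normr_real.
  have r0 : 0 < r by rewrite /r; lra.
  have [l al] := ha _ (divr_gt0 e0 r0); exists (word_scale k l).
  rewrite ev_scale -scalerBr anormZc.
  apply: (@le_trans _ _ (r * (e / r))).
    by rewrite ler_pM ?anorm_ge0 // /r lerDl.
  by rewrite mulrC divfK // gt_eqF.
- move=> a b ha hb e e0.
  pose K := anorm a + anorm b + 1.
  have := anorm_ge0 a; have := anorm_ge0 b => b0 a0.
  have K0 : 0 < K by rewrite /K; lra.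
  (* The cap by [1] bounds [y] by [anorm b + 1]; the choice of [K] then makes both error terms fit
     into [e]. *)
  pose d := Num.min 1 (e / K).
  have d0 : 0 < d by rewrite lt_min ltr01 divr_gt0.
  have [l al] := ha _ d0; have [l' bl] := hb _ d0.
  have [l'' l''E] := ev_mul hw l l'; exists l''; rewrite -l''E.
  set x := ev w pi l in al *; set y := ev w pi l' in bl *.
  have -> : a * b - x * y = (a - x) * y + a * (b - y).
    by ncring R.
  have yb : anorm y <= anorm b + 1.
    have := anorm_dist y b 0; rewrite !subr0 anormBC.
    by move: bl; rewrite le_min => /andP[]; lra.
  have de : d * K <= e by rewrite -ler_pdivlMr // ge_min lexx orbT.
  apply: (le_trans (anormD _ _)); apply: le_trans de.
  have h1 : anorm ((a - x) * y) <= d * (anorm b + 1).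
    by apply: (le_trans (anormM _ _)); rewrite ler_pM ?anorm_ge0.
  have h2 : anorm (a * (b - y)) <= anorm a * d.
    by apply: (le_trans (anormM _ _)); rewrite ler_wpM2l.
  have -> : d * K = d * (anorm b + 1) + anorm a * d by rewrite /K; ring.
  exact: lerD.
- move=> a h e e0; have e20 : 0 < e / 2 by rewrite divr_gt0.
  have [b hb ab] := h _ e20; have [l bl] := hb _ e20; exists l.
  by apply: (le_trans (anorm_dist _ b _)); lra.
- move=> a h e e0; have [l al] := h _ e0; exists (word_star l).
  by rewrite (ev_star hw) -starB anorm_star.
Qed.

End ClosedStarAlgebras.

Lemma closure_approx (R : realType) (D : cstarAlgType R) (X : set (normed_of D)) (a : D) :
  closure X (a : normed_of D) -> forall e : R, 0 < e -> exists2 b : D, X b & anorm (a - b) <= e.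
Proof.
move=> cl e e0.
have [b [Xb]] := cl _ (nbhsx_ballx (a : normed_of D) e%:C%C (eq_ind_r is_true e0 (ltcR 0 e))).
rewrite -ball_normE /ball_ /= => h; exists b => //.
by apply: ltW; rewrite -ltcR.
Qed.

Section DiscIsometry.
Variables (R : realType) (q : R) (D : cstarAlgType R) (x : D).
Hypotheses (q01 : 0 < q < 1) (hD : is_quantum_disc q x).

Lemma quantum_disc_relation : disc_relation q x.
Proof.
case: hD => P [y [iota [[ry _] hi <- _ _]]].
move: ry; rewrite /disc_relation => /(congr1 iota).
by rewrite (homB hi) !(homZ hi) !(homM hi) !(hom_star hi) (hom1 hi).
Qed.

(** The preimage of [E] in the polynomial algebra is everything; closedness and density of [iota] do
    the rest. *)
Lemma quantum_disc_generated E : closed_star_alg E -> E x -> forall a : D, E a.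
Proof.
case: hD => P [y [iota [py hi ix dense _]]] EE Ex a.
pose F : star_subalg P := @StarSubalg _ P (fun b => E (iota b))
  (eq_ind_r E (calg1 EE) (hom1 hi))
  (fun b c Eb Ec => eq_ind_r E (calgD EE Eb Ec) (homD hi b c))
  (fun k b Eb => eq_ind_r E (calgZ EE k Eb) (homZ hi k b))
  (fun b c Eb Ec => eq_ind_r E (calgM EE Eb Ec) (homM hi b c))
  (fun b Eb => eq_ind_r E (csa_star EE Eb) (hom_star hi b)).
have Fall : forall b, E (iota b).
  by apply: (disc_polynomials_generated (E := F) py); rewrite /= ix.
apply: (calg_lim EE) => e e0.
have ca : closure (range iota : set (normed_of D)) (a : normed_of D) by rewrite dense.
have [b [c _ <-] ab] := closure_approx ca e0.
by exists (iota c).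
Qed.

(* The defect [y = 1 - x^* x] is the fixpoint of [y |-> q (1 - s s^* ) + q s y s^*], so [s]
   generates [x]; and if [1 - s s^*] vanished, then so would [y], making [x] unitary. *)
Lemma quantum_disc_isometry : exists s k : D,
  [/\ star s * s = 1, 1 - s * star s != 0, s = x * k, pos k & k * k * (star x * x) = 1] /\
  forall E, closed_star_alg E -> E s -> forall a, E a.
Proof.
have /andP[q0 q1] := q01.
have rx := quantum_disc_relation.
pose h := star x * x.
have hE : h = q%:C%C *: (x * star x) + sc D (1 - q).
  by rewrite -[LHS](subrK (q%:C%C *: (x * star x))) rx addrC.
have q10 : 0 < 1 - q by rewrite subr_gt0.
have ph : pos (h - sc D (1 - q)).
  by rewrite hE addrK; apply: posZ; [exact: ltW|exact: pos_mul_star].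
have [g [k [[pg pk gg gk kg] Egk]]] := pos_inv_sqrt q10 ph.
have sg := pos_star pg; have sk := pos_star pk.
pose s := x * k.
have ss : star s * s = 1.
  rewrite /s starM sk mulrA -(mulrA k) -/h -gg mulrA kg mul1r.
  by rewrite gk.
have xsg : x = s * g by rewrite /s -mulrA kg mulr1.
pose y := 1 - h.
have yE : y = q%:C%C *: (1 - s * star s) + q%:C%C *: (s * y * star s).
  have e1 : x * star x = s * h * star s.
    by rewrite {1 2}xsg starM sg -gg !mulrA.
  have -> : s * y * star s = s * star s - s * h * star s by rewrite /y; ncring R.
  by rewrite -e1 /y hE; ncring R.
have khk : k * k * (star x * x) = 1.
  by rewrite -/h -gg mulrA -(mulrA k) kg mulr1 kg.
exists s, k; split; first split => //.
  apply/eqP => p0.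
  have ys : y = q%:C%C *: (s * y * star s) by rewrite {1}yE p0 scaler0 add0r.
  have y0 : y = 0.
    apply/anorm_eq0/eqP; rewrite eq_le anorm_ge0 andbT.
    have := isometry_conj_norm_le y ss; have := anorm_ge0 y.
    have : anorm y = q * anorm (s * y * star s) by rewrite {1}ys anormZr ger0_norm // ltW.
    by move=> -> ? ?; nra.
  have /eqP := quantum_disc_nonunitary q01 hD; apply.
  have : q%:C%C *: (1 - x * star x) = 0.
    by rewrite -y0 /y hE; ncring R.
  move/eqP; rewrite scaler_eq0 => /orP[/eqP/(congr1 (@complex.Re R)) /= q00|/eqP //].
  by rewrite q00 ltxx in q0.
move=> E EE Es; apply: quantum_disc_generated => //.
have Ess : E (star s) by exact: csa_star.
have Ey : E y.
  apply: (conj_fixpoint_mem EE ss _ Es _ yE); first by rewrite ltW.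
  by apply: (calgZ EE); apply: (calgB EE); [exact: (calg1 EE)|exact: (calgM EE)].
have Eh : E h.
  by rewrite -[h](subKr 1) -/y; apply: (calgB EE) => //; exact: (calg1 EE).
have [Eg _] := Egk E EE Eh.
by rewrite xsg; exact: (calgM EE).
Qed.

(** The number [chi k] is nonnegative with square [1], hence is [1]: on the circle [s] cannot be
    told from [x]. *)
Lemma disc_isometry_char (s k : D) (chi : D -> R[i]) : s = x * k -> pos k ->
  k * k * (star x * x) = 1 -> character chi -> `|chi x| = 1 -> chi s = chi x.
Proof.
move=> -> pk kk hc x1; rewrite (charM hc).
have k0 := char_pos_ge0 hc pk.
have := congr1 chi kk; rewrite !(charM hc) (char1 hc) (char_star hc).
rewrite [_^* * _]mulrC -normCK x1 expr1n mulr1 => k2.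
have /eqP : chi k ^+ 2 = 1 by [].
by rewrite sqrp_eq1 // => /eqP ->; rewrite mulr1.
Qed.

End DiscIsometry.

(** * Passing between sphere relations and isometry pairs *)

Section PodlesPairs.
Variables (R : realType) (mu c : R).
Hypotheses (mu1 : `|mu| < 1) (c0 : 0 < c).
Local Notation C := (R[i]).

(** Half the distance of the roots of [t^2 - t = c]. Completing the square, [star B * B =
    podles_radius^2 - (A - 1/2)^2], so it also bounds the norm of [A - 1/2]. *)
Definition podles_radius := Num.sqrt (c + 4^-1).
Definition podles_plus := 2^-1 + podles_radius.
Definition podles_minus := 2^-1 - podles_radius.
Local Notation m := (mu ^+ 2).
Local Notation rho := podles_radius.
Local Notation u := podles_plus.
Local Notation v := podles_minus.

Lemma podles_radius_sqr : rho ^+ 2 = c + 4^-1.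
Proof. by rewrite sqr_sqrtr //; have := c0; lra. Qed.

Lemma podles_radius_gt : 2^-1 < rho.
Proof.
have r0 : 0 <= rho by exact: sqrtr_ge0.
have := podles_radius_sqr; have := c0; nra.
Qed.

Lemma podles_m : 0 <= m < 1.
Proof.
rewrite sqr_ge0 /= -[ltRHS](expr1n _ 2) -[ltLHS]ger0_norm ?sqr_ge0 // normrX.
by rewrite ltr_pXn2r ?nnegrE.
Qed.

Lemma podles_minus_lt0 : v < 0.
Proof. by have := podles_radius_gt; rewrite /podles_minus; lra. Qed.

Lemma podles_plus_gt0 : 0 < u.
Proof. by have := podles_radius_gt; rewrite /podles_plus; lra. Qed.

Lemma podles_sum : u + v = 1.
Proof. by rewrite /podles_plus /podles_minus; lra. Qed.

Lemma podles_prod : u * v = - c.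
Proof.
have := podles_radius_sqr; rewrite /podles_plus /podles_minus expr2 => e.
have -> : (2^-1 + rho) * (2^-1 - rho) = 4^-1 - rho * rho by field.
by rewrite e; lra.
Qed.

Lemma podles_gap : u - v != 0.
Proof.
by rewrite gt_eqF //; have := podles_minus_lt0; have := podles_plus_gt0; lra.
Qed.

Lemma podles_factor (A : cstarAlgType R) (a : A) :
  (sc A u - m%:C%C *: a) * (m%:C%C *: a - sc A v) =
  (mu ^+ 2)%:C%C *: a - (mu ^+ 4)%:C%C *: a ^+ 2 + c%:C%C *: 1.
Proof.
have -> : c = - (u * v) by rewrite podles_prod opprK.
have e : m%:C%C *: a = (m * (u + v))%:C%C *: a by rewrite podles_sum mulr1.
rewrite [in RHS]e; ncring R.
Qed.

Section FromIsometry.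
Variables (D : cstarAlgType R) (w pi : D).
Hypothesis hw : isometry_pair w pi.
Local Notation p := (1 - w * star w).
Local Notation pi' := (p - pi).

Let e0 : D := u%:C%C *: pi + v%:C%C *: pi'.

Let ww : star w * w = 1 := isom_w hw.

Lemma pos_pi : pos pi.
Proof. by rewrite -(isom_pi_idem hw); apply: pos_sqr; exact: isom_star_pi hw. Qed.

Lemma pos_pi' : pos pi'.
Proof.
by rewrite -[X in pos X](defect_compl_idem hw); apply: pos_sqr; exact: defect_compl_star hw.
Qed.

Lemma pi_defect : pi * p = pi.
Proof. by rewrite mulrBr mulr1 mulrA (pi_w hw) mul0r subr0. Qed.

(** The second clause is an induction principle for the fixpoint: a closed predicate true at [0] and
    stable under the map holds at [z]. *)
Lemma conj_fixpoint_exists (m' : R) (e : D) : 0 <= m' < 1 ->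
  exists z, z = e + m'%:C%C *: (w * z * star w) /\
   forall Q : D -> Prop, (forall a, (forall d : R, 0 < d -> exists2 b, Q b & anorm (a - b) <= d) -> Q a) ->
    Q 0 -> (forall a, Q a -> Q (e + m'%:C%C *: (w * a * star w))) -> Q z.
Proof.
move=> /andP[m0 m1].
pose x := fix x n := if n is n'.+1 then e + m'%:C%C *: (w * x n' * star w) else 0 : D.
pose eta := fix eta n := if n is n'.+1 then anorm e + m' * eta n' else 0 : R.
have xS n : x n.+1 = e + m'%:C%C *: (w * x n * star w) by [].
have etaS n : eta n.+1 = anorm e + m' * eta n by [].
have dx n : anorm (x n.+1 - x n) <= eta n.+1 - eta n.
  elim: n => [|n IH].
    by rewrite /= !mulr0 mul0r scaler0 addr0 !subr0 addr0.
  have -> : x n.+2 - x n.+1 = m'%:C%C *: (w * (x n.+1 - x n) * star w).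
    by rewrite (xS n.+1) [X in _ - X = _]xS; ncring R.
  have -> : eta n.+2 - eta n.+1 = m' * (eta n.+1 - eta n).
    by rewrite (etaS n.+1) [X in _ - X = _]etaS; ring.
  rewrite anormZr ger0_norm // ler_wpM2l //.
  exact: le_trans (isometry_conj_norm_le _ ww) IH.
have eta_le n : eta n <= anorm e / (1 - m').
  have ae := anorm_ge0 e.
  elim: n => [|n IH] /=; first by rewrite divr_ge0 // subr_ge0 ltW.
  have : m' * eta n <= m' * (anorm e / (1 - m')) by rewrite ler_wpM2l.
  have : (1 - m') * (anorm e / (1 - m')) = anorm e.
    by rewrite mulrC divfK // subr_eq0 gt_eqF.
  lra.
have [z xz] := majorant_cvg dx eta_le.
exists z; split.
  apply: (@aconv_eq _ _ (fun n => x n.+1) (fun n => x n.+1)).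
  - by move=> d /xz[N NP]; exists N => n Nn; apply: NP; exact: leqW.
  - move=> d d0; have [N NP] := xz d d0; exists N => n Nn.
    have -> : x n.+1 - (e + m'%:C%C *: (w * z * star w)) = m'%:C%C *: (w * (x n - z) * star w).
      by rewrite xS; ncring R.
    rewrite anormZr ger0_norm // -[leRHS]mul1r ler_pM ?anorm_ge0 ?(ltW m1) //.
    exact: le_trans (isometry_conj_norm_le _ ww) (NP n Nn).
  - by move=> d d0; exists 0%N => n _; rewrite subrr anorm0 ltW.
move=> Q Qcl Q0 Qs; apply: Qcl => d /xz[N NP]; exists (x N); last by rewrite anormBC NP.
by elim: (N) => [|n IH] //=; exact: Qs.
Qed.

(** [A] acts as [m^k u] on the range of [w^k pi] and as [m^k v] on that of [w^k pi']. It lies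
    between [v] and [u], so [(u - m A)(m A - v)] is positive; [G] is its root, and [B = G * star w]
    is prescribed in polar form. *)
Lemma podles_of_isometry : exists A B G : D,
  [/\ podles_relations mu c A B, A * p = e0, pos G,
      G * G = (mu ^+ 2)%:C%C *: A - (mu ^+ 4)%:C%C *: A ^+ 2 + c%:C%C *: 1 &
      B = G * star w].
Proof.
have m01 := podles_m; have /andP[m0 m1] := m01.
have u0 := podles_plus_gt0; have v0 := podles_minus_lt0.
have [A [AE Aind]] := conj_fixpoint_exists e0 m01.
have plim (f : D -> D) : (forall a b, f a - f b = a - b \/ f a - f b = b - a) ->
    forall a, (forall d : R, 0 < d -> exists2 b, pos (f b) & anorm (a - b) <= d) -> pos (f a).
  move=> fiso a h; apply: pos_lim => d /h[b fb ab]; exists (f b) => //.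
  by case: (fiso a b) => ->; rewrite // anormBC.
(* Each bound survives one step of the iteration: with [1 = w * star w + pi + pi'], the new gap is a
   nonnegative multiple of [pi'] (below, of [pi]) plus a conjugate by [w] of a positive element. *)
have uA : pos (sc D u - A).
  apply: (Aind (fun a => pos (sc D u - a))).
  - apply: (plim (fun a => sc D u - a)) => a b; right; ncring R.
  - by rewrite subr0; apply: pos_sc; exact: ltW.
  - move=> a pa.
    have -> : sc D u - (e0 + m%:C%C *: (w * a * star w)) =
        (u - v)%:C%C *: pi' + w * (m%:C%C *: (sc D u - a) + ((1 - m) * u)%:C%C *: 1) * star w.
      by rewrite /e0; ncring R.
    apply: posD; first by apply: posZ; [lra|exact: pos_pi'].
    apply: pos_conjr; apply: posD; first exact: posZ.
    by apply: posZ; [rewrite mulr_ge0 ?subr_ge0 ?ltW|exact: pos1].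
have vA : pos (A - sc D v).
  apply: (Aind (fun a => pos (a - sc D v))).
  - apply: (plim (fun a => a - sc D v)) => a b; left; ncring R.
  - by rewrite sub0r /sc -scaleNr -rmorphN; apply: posZ; [lra|exact: pos1].
  - move=> a pa.
    have -> : (e0 + m%:C%C *: (w * a * star w)) - sc D v =
        (u - v)%:C%C *: pi + w * (m%:C%C *: (a - sc D v) + ((1 - m) * (- v))%:C%C *: 1) * star w.
      by rewrite /e0; ncring R.
    apply: posD; first by apply: posZ; [lra|exact: pos_pi].
    apply: pos_conjr; apply: posD; first exact: posZ.
    by apply: posZ; [rewrite mulr_ge0 ?subr_ge0 ?oppr_ge0 ?ltW|exact: pos1].
have sA : star A = A.
  by have := pos_star vA; rewrite starB star_sc => /addIr.
pose X := sc D u - m%:C%C *: A; pose Y := m%:C%C *: A - sc D v.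
have pX : pos X.
  have -> : X = m%:C%C *: (sc D u - A) + ((1 - m) * u)%:C%C *: 1 by rewrite /X; ncring R.
  apply: posD; first exact: posZ.
  by apply: posZ; [rewrite mulr_ge0 ?subr_ge0 ?ltW|exact: pos1].
have pY : pos Y.
  have -> : Y = m%:C%C *: (A - sc D v) + ((1 - m) * (- v))%:C%C *: 1 by rewrite /Y; ncring R.
  apply: posD; first exact: posZ.
  by apply: posZ; [rewrite mulr_ge0 ?subr_ge0 ?oppr_ge0 ?ltW|exact: pos1].
have AX : GRing.comm A X.
  by apply: commrB; [apply: commZ; exact: commr1|exact: commZ].
have AY : GRing.comm A Y.
  by apply: commrB; [exact: commZ|apply: commZ; exact: commr1].
have XY : GRing.comm X Y.
  by rewrite /GRing.comm /X /Y; ncring R.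
have [G [pG GG EG]] := pos_sqrt (posM pX pY XY).
have GE : G * G = (mu ^+ 2)%:C%C *: A - (mu ^+ 4)%:C%C *: A ^+ 2 + c%:C%C *: 1.
  by rewrite GG -podles_factor.
have AG : A * G = G * A by apply: (EG _ (closed_alg_comm _)); exact: commrM.
have wp : star w * p = 0 by rewrite mulrBr mulr1 mulrA ww mul1r subrr.
have pw : p * w = 0 by rewrite mulrBl mul1r -mulrA ww mulr1 subrr.
have pp : p * p = p by exact: defect_idem.
have pip := pi_defect.
have Ap : A * p = e0.
  rewrite AE mulrDl -scalerAl -(mulrA (w * A)) wp mulr0 scaler0 addr0.
  by rewrite /e0 mulrDl -!scalerAl mulrBl pip pp.
have Aw : A * w = m%:C%C *: (w * A).
  have e0w : e0 * w = 0.
    by rewrite /e0 mulrDl -!scalerAl mulrBl (pi_w hw) pw subrr !scaler0 addr0.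
  by rewrite {1}AE mulrDl e0w add0r -scalerAl -(mulrA _ (star w)) ww mulr1.
have wA : star w * A = m%:C%C *: (A * star w).
  by rewrite -[in LHS]sA -starM Aw starZr starM sA.
have sG := pos_star pG.
exists A, (G * star w), G; split => //; split => //.
- by rewrite -mulrA wA -scalerAr mulrA -AG mulrA.
- rewrite starM starK sG -mulrA (mulrA G) GE.
  have mA2 : m%:C%C *: (w * A * star w) = A * w * star w by rewrite Aw -scalerAl.
  have -> : w * (((mu ^+ 2)%:C%C *: A - (mu ^+ 4)%:C%C *: A ^+ 2 + c%:C%C *: 1) * star w) =
     m%:C%C *: (w * A * star w) - m%:C%C *: (m%:C%C *: (w * A) * A * star w) + c%:C%C *: (w * star w).
    by ncring R.
  rewrite mA2 -Aw.
  have -> : m%:C%C *: (A * w * A * star w) = A * (m%:C%C *: (w * A)) * star w by ncring R.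
  rewrite -Aw.
  (* Up to here [star B * B] is [(A - A^2 + c) w w^*]. The missing part, multiplied by [p], vanishes
     since on [pi] and [pi'] the element [A] takes the roots [u] and [v] of this quadratic. *)
  have Ap2 : (A - A ^+ 2 + c%:C%C *: 1) * p = 0.
    have Api : A * pi = u%:C%C *: pi.
      have pp' : p * pi = pi.
        by rewrite -(isom_star_pi hw) -{1}(defect_star w) -starM pip.
      rewrite -[in LHS]pp' mulrA Ap /e0 mulrDl -!scalerAl mulrBl pp' (isom_pi_idem hw).
      by rewrite subrr scaler0 addr0.
    have Api' : A * pi' = v%:C%C *: pi'.
      by rewrite mulrBr Ap Api /e0; ncring R.
    have -> : (A - A ^+ 2 + c%:C%C *: 1) * p = A * p - A * (A * p) + c%:C%C *: p.
      by ncring R.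
    rewrite Ap /e0 mulrDr -!scalerAr Api Api'.
    have cE : c = - (u * v) by rewrite podles_prod opprK.
    have u2 : u = 1 - v by have := podles_sum; lra.
    by rewrite cE u2; ncring R.
  apply/eqP; rewrite -subr_eq0 -[X in _ == X]oppr0 -{}Ap2; apply/eqP.
  by ncring R.
- by rewrite starM starK sG -mulrA (mulrA (star w)) ww mul1r GE.
Qed.

End FromIsometry.

(** Positivity of [star B * B] confines [A] between [v] and [u]; this bounds [B * star B] below, so
    that [star B] has a polar decomposition. [P] is the part of [1 - W * star W] on which [A] is
    [u]. *)
Lemma isometry_of_podles (S : cstarAlgType R) (A B : S) :
  podles_relations mu c A B ->
  exists W P g k : S, [/\ isometry_pair W P, W = star B * k &
     P = (u - v)^-1%:C%C *: ((A - sc S v) * (1 - W * star W))] /\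
   [/\ pos g, pos k, g * g = B * star B, g * k = 1 & k * g = 1] /\
   (forall E, closed_alg E -> E (B * star B) -> E g /\ E k) /\
   (forall E, closed_star_alg E -> E W -> E P -> E A /\ E B).
Proof.
case=> /esym sA BA BB1 BB2.
have m01 := podles_m; have /andP[m0 m1] := m01.
have u0 := podles_plus_gt0; have v0 := podles_minus_lt0.
have rho0 : 0 <= rho by exact: sqrtr_ge0.
have sh : star (A - sc S 2^-1) = A - sc S 2^-1 by rewrite starB star_sc sA.
have nA : anorm (A - sc S 2^-1) <= rho.
  apply: norm_le_star_mul => //; rewrite sh podles_radius_sqr.
  have -> : sc S (c + 4^-1) - (A - sc S 2^-1) * (A - sc S 2^-1) = star B * B.
    by rewrite BB1; ncfield R.
  exact: pos_star_mul.
have uA : pos (sc S u - A).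
  have -> : sc S u - A = sc S rho - (A - sc S 2^-1) by rewrite /podles_plus; ncring R.
  exact: norm_le_pos.
have vA : pos (A - sc S v).
  have -> : A - sc S v = sc S rho + (A - sc S 2^-1) by rewrite /podles_minus; ncring R.
  exact: norm_le_posD.
(* Lower bounds of the two factors of [B * star B]: [u - m A = m (u - A) + x0] and
   [m A - v = m (A - v) + y0]. *)
pose x0 := (1 - m) * u; pose y0 := (1 - m) * (- v).
have x00 : 0 < x0 by rewrite mulr_gt0 ?subr_gt0.
have y00 : 0 < y0 by rewrite mulr_gt0 ?subr_gt0 ?oppr_gt0.
have pBB : pos (B * star B - sc S (x0 * y0)).
  pose X := m%:C%C *: (sc S u - A); pose Y := m%:C%C *: (A - sc S v).
  have -> : B * star B - sc S (x0 * y0) = X * Y + x0%:C%C *: Y + y0%:C%C *: X.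
    by rewrite BB2 -podles_factor /X /Y /x0 /y0; ncring R.
  have pX : pos X by exact: posZ.
  have pY : pos Y by exact: posZ.
  apply: posD; [apply: posD|]; [apply: posM => //|exact: posZ (ltW x00) pY|exact: posZ (ltW y00) pX].
  by rewrite /GRing.comm /X /Y; ncring R.
have [g [k [[pg pk gg gk kg] Egk]]] := pos_inv_sqrt (mulr_gt0 x00 y00) pBB.
have sg := pos_star pg; have sk := pos_star pk.
pose W := star B * k.
have sW : star W = k * B by rewrite /W starM starK sk.
have WW : star W * W = 1.
  rewrite sW /W mulrA -(mulrA k B) -gg mulrA kg mul1r.
  by rewrite gk.
have Ak : A * k = k * A.
  apply: (proj2 (Egk _ (closed_alg_comm A) _)).
  by rewrite BB2 -podles_factor /GRing.comm; ncring R.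
have AsB : A * star B = m%:C%C *: (star B * A).
  have := congr1 star BA; rewrite starZr !starM sA => ->.
  by [].
have AW : A * W = m%:C%C *: (W * A).
  by rewrite /W mulrA AsB -scalerAl -(mulrA (star B) A) Ak mulrA.
have WA : star W * A = m%:C%C *: (A * star W).
  by rewrite -[in LHS]sA -starM AW starZr starM sA.
pose Q := 1 - W * star W.
have sQ : star Q = Q by exact: defect_star.
have QQ : Q * Q = Q by exact: defect_idem.
have WQ : star W * Q = 0 by exact: starw_defect.
have AQ : A * Q = Q * A.
  rewrite /Q mulrBr mulrBl mulr1 mul1r mulrA AW -(mulrA W) WA.
  by congr (_ - _); ncring R.
have BgW : B = g * star W by rewrite sW mulrA gk mul1r.
have BQ : B * Q = 0 by rewrite BgW -mulrA WQ mulr0.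
(* [B] kills [Q], hence so does [star B * B], which is minus this quadratic in [A]. On [Q] the only
   values of [A] are thus [u] and [v], and [P] below is the corresponding Lagrange interpolation. *)
have quad : (A - sc S u) * (A - sc S v) * Q = 0.
  have : star B * B * Q = 0 by rewrite -mulrA BQ mulr0.
  rewrite BB1 => e0; apply: oppr_inj; rewrite oppr0 -[RHS]e0.
  have cE : c = - (u * v) by rewrite podles_prod opprK.
  have u2 : u = 1 - v by have := podles_sum; lra.
  by rewrite cE u2; ncring R.
pose P := (u - v)^-1%:C%C *: ((A - sc S v) * Q).
have gap := podles_gap.
have AvQ : (A - sc S v) * Q = Q * (A - sc S v).
  apply: commr_sym; apply: commrB; first exact: esym AQ.
  by apply: commZ; exact: commr1.
have sP : star P = P.
  by rewrite /P starZr starM sQ starB star_sc sA AvQ.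
have PP : P * P = P.
  have e1 : (A - sc S v) * Q * ((A - sc S v) * Q) = (u - v)%:C%C *: ((A - sc S v) * Q).
    rewrite mulrA -(mulrA _ Q) -AvQ.
    have -> : (A - sc S v) * ((A - sc S v) * Q) * Q =
      (A - sc S u) * (A - sc S v) * (Q * Q) + (u - v)%:C%C *: ((A - sc S v) * (Q * Q)).
      by ncring R.
    by rewrite QQ quad add0r.
  rewrite /P -scalerAl -scalerAr e1 !realZA; congr (_%:C%C *: _).
  by rewrite divfK.
have WP : star W * P = 0.
  by rewrite /P -scalerAr AvQ mulrA WQ mul0r scaler0.
have AE : A = (u%:C%C *: P + v%:C%C *: (Q - P)) + m%:C%C *: (W * A * star W).
  have -> : u%:C%C *: P + v%:C%C *: (Q - P) = A * Q.
    transitivity ((u - v)%:C%C *: P + v%:C%C *: Q); first by ncring R.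
    rewrite /P realZA mulfV // scale1r; ncring R.
  by rewrite scalerAl -AW /Q; ncring R.
exists W, P, g, k; split; first by split.
split => //; split => // E EE EW EP.
have EsW : E (star W) by exact: csa_star.
have EA : E A.
  apply: (conj_fixpoint_mem EE WW m01 EW _ AE).
  have EQ : E Q by apply: (calgB EE); [exact: (calg1 EE)|exact: (calgM EE)].
  apply: (calgD EE); apply: (calgZ EE) => //.
  exact: (calgB EE).
split => //; rewrite BgW; apply: (calgM EE) => //.
apply: (proj1 (Egk E EE _)); rewrite BB2 -podles_factor.
apply: (calgM EE); apply: (calgB EE); try exact: (calg_sc EE); exact: (calgZ EE).
Qed.

End PodlesPairs.

(** * The pullback *)

Section SphereToDisc.
Variables (R : realType) (mu c : R) (S D : cstarAlgType R) (A B W P g k : S).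
Variables (f : S -> D) (w pi A' B' G : D).
Hypotheses (mu1 : `|mu| < 1) (c0 : 0 < c).
Local Notation u := (podles_plus c).
Local Notation v := (podles_minus c).
Hypotheses (hf : starhom f) (fA : f A = A') (fB : f B = B').
Hypotheses (rel : podles_relations mu c A B) (hw : isometry_pair w pi).
Hypotheses (WE : W = star B * k)
  (PE : P = (u - v)^-1%:C%C *: ((A - sc S v) * (1 - W * star W))).
Hypotheses (pg : pos g) (pk : pos k) (gg : g * g = B * star B) (gk : g * k = 1) (kg : k * g = 1).
Hypothesis Egk : forall E, closed_alg E -> E (B * star B) -> E g /\ E k.
Hypotheses (Ap : A' * (1 - w * star w) =
    u%:C%C *: pi + v%:C%C *: (1 - w * star w - pi))
  (pG : pos G)
  (GG : G * G = (mu ^+ 2)%:C%C *: A' - (mu ^+ 4)%:C%C *: A' ^+ 2 + c%:C%C *: 1)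
  (BE : B' = G * star w).

(** Both are positive roots of the image of [B * star B]. They commute because [g] is a limit of
    polynomials in [B * star B], whose image [G * G] commutes with [G]. *)
Lemma sphere_hom_sqrt : f g = G.
Proof.
have fBB : f (B * star B) = G * G.
  by case: rel => _ _ _ ->; rewrite (homD hf) (homB hf) !(homZ hf) (hom1 hf) (homX hf) fA GG.
apply: (pos_sqrt_uniq (hom_pos hf pg) pG (hom_pos hf pk)).
- by rewrite -(homM hf) gg fBB.
- apply: esym; apply: (proj1 (Egk (closed_alg_preimage hf (closed_alg_comm G)) _)).
  by rewrite fBB; exact: commrM.
- by rewrite -(homM hf) gk (hom1 hf).
- by rewrite -(homM hf) kg (hom1 hf).
Qed.

Lemma sphere_hom_isometry : f W = w.
Proof.
rewrite WE (homM hf) (hom_star hf) fB BE starM starK (pos_star pG).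
by rewrite -sphere_hom_sqrt -mulrA -(homM hf) gk (hom1 hf) mulr1.
Qed.

Lemma sphere_hom_proj : f P = pi.
Proof.
rewrite PE (homZ hf) (homM hf) !(homB hf) (homM hf) (hom_star hf) (hom1 hf) (hom_sc hf).
rewrite sphere_hom_isometry fA mulrBl Ap.
have -> : u%:C%C *: pi + v%:C%C *: (1 - w * star w - pi) - sc D v * (1 - w * star w) =
   (u - v)%:C%C *: pi by ncring R.
by rewrite realZA mulVf ?rmorph1 ?scale1r // podles_gap.
Qed.

End SphereToDisc.

Section CircleCharacters.
Variable R : realType.
Local Notation C := (R[i]).

Lemma circle_mem (z : C) : `|z| = 1 -> (z : C^o) \in @circle R.
Proof. by move=> z1; rewrite inE. Qed.

(** Evaluation at a bare complex number instead of a point of the subtype; the value [0] off the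
    circle is a mere default. *)
Definition circle_eval (z : C) (h : circle_alg R) : C :=
  match pselect (`|z| = 1) with
  | left z1 => h (exist (fun z : C^o => z \in @circle R) z (circle_mem z1))
  | right _ => 0
  end.

Lemma circle_eval_val (h : circle_alg R) (z : @circle R) : circle_eval (\val z) h = h z.
Proof.
rewrite /circle_eval; case: pselect => [z1|].
  by congr (h _); apply: val_inj.
by case; have := valP z; rewrite inE.
Qed.

Lemma circle_eval_char (D : cstarAlgType R) (phi : D -> circle_alg R) (z : C) :
  starhom phi -> `|z| = 1 -> character (fun d => circle_eval z (phi d)).
Proof.
move=> hphi z1; rewrite /circle_eval; case: pselect => // z1'.
split.
- by move=> a b; rewrite (homD hphi).
- by move=> l a; rewrite (homZ hphi).
- by rewrite (hom1 hphi).
- by move=> a b; rewrite (homM hphi).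
- by move=> a; rewrite (hom_star hphi).
Qed.

Lemma circle_eval_gen (z : C) : `|z| = 1 -> circle_eval z (circle_gen R) = z.
Proof. by move=> z1; rewrite /circle_eval; case: pselect. Qed.

Lemma circle_ext (h h' : circle_alg R) :
  (forall z, `|z| = 1 -> circle_eval z h = circle_eval z h') -> h = h'.
Proof.
move=> e; apply/continuousEP => z; rewrite -!circle_eval_val; apply: e.
by have := valP z; rewrite inE.
Qed.

End CircleCharacters.

(** * Isometry onto the pullback *)

Section PullbackIsomorphism.
Variables (R : realType) (S Dp Dq : cstarAlgType R).
Variables (W P : S) (s : Dp) (t : Dq).
Variables (f1 : S -> Dp) (f2 : S -> Dq).
Variables (phip : Dp -> circle_alg R) (phiq : Dq -> circle_alg R).
Local Notation C := (R[i]).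
Hypotheses (hW : isometry_pair W P) (ss : star s * s = 1) (tt1 : star t * t = 1).
Hypotheses (s0 : 1 - s * star s != 0) (t0 : 1 - t * star t != 0).
Hypotheses (hf1 : starhom f1) (hf2 : starhom f2).
Hypotheses (f1W : f1 W = s) (f1P : f1 P = 1 - s * star s) (f2W : f2 W = t) (f2P : f2 P = 0).
Hypotheses (hphip : starhom phip) (hphiq : starhom phiq).
Hypotheses (chis : forall z, `|z| = 1 -> circle_eval z (phip s) = z)
  (chit : forall z, `|z| = 1 -> circle_eval z (phiq t) = z).
Hypothesis genS : forall E, closed_star_alg E -> E W -> E P -> forall a : S, E a.
Hypothesis genDp : forall E, closed_star_alg E -> E s -> forall a : Dp, E a.
Hypothesis genDq : forall E, closed_star_alg E -> E t -> forall a : Dq, E a.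

(** The element [M^2 - star a * a] is again a combination of words. Its image under [f1] controls
    the matrix with flag [true], its image under [f2] the one with flag [false], and [ev_pos]
    returns positivity in [S]. *)
Lemma word_norm_le l (M : R) : 0 <= M -> anorm (f1 (ev W P l)) <= M ->
  anorm (f2 (ev W P l)) <= M -> anorm (ev W P l) <= M.
Proof.
move=> M0 m1 m2; apply: norm_le_star_mul => //.
have [l' l'E] := ev_mul hW (word_star l) l.
pose L := word_scale (M ^+ 2)%:C%C [:: (1, (false, (0, 0)%N))] ++ word_scale (-1) l'.
have LE : sc S (M ^+ 2) - star (ev W P l) * ev W P l = ev W P L.
  by rewrite /L ev_cat !ev_scale ev1 scaleN1r -l'E (ev_star hW).
rewrite LE; apply: ev_pos => //.
  apply: (psd_ev_coef ss s0); rewrite -f1P -f1W -(hom_ev _ _ _ hf1) -LE.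
  rewrite (homB hf1) (homM hf1) (hom_star hf1) (hom_sc hf1).
  exact: star_mul_le_norm.
apply: (psd_ev_coef (flag := false) tt1 t0); rewrite -f2P -f2W -(hom_ev _ _ _ hf2) -LE.
rewrite (homB hf2) (homM hf2) (hom_star hf2) (hom_sc hf2).
exact: star_mul_le_norm.
Qed.

Lemma words_dense a : forall e : R, 0 < e -> exists l, anorm (a - ev W P l) <= e.
Proof.
apply: (genS (closed_star_alg_words hW)) => e e0.
  exists [:: (1, (false, (1, 0)%N))].
  by rewrite /ev big_seq1 /mono /= scale1r expr1 expr0 !mulr1 subrr anorm0 ltW.
exists [:: (1, (true, (0, 0)%N))].
by rewrite /ev big_seq1 /mono /= scale1r !expr0 mul1r mulr1 subrr anorm0 ltW.
Qed.

Lemma isometry_words_dense (D : cstarAlgType R) (w : D) : star w * w = 1 ->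
  (forall E, closed_star_alg E -> E w -> forall a : D, E a) ->
  forall a (e : R), 0 < e -> exists l, anorm (a - ev w 0 l) <= e.
Proof.
move=> ww gen a; apply: (gen _ (closed_star_alg_words (zero_pair ww))) => e e0.
exists [:: (1, (false, (1, 0)%N))].
by rewrite /ev big_seq1 /mono /= scale1r expr1 expr0 !mulr1 subrr anorm0 ltW.
Qed.

Lemma pair_norm_le a (M : R) : 0 <= M -> anorm (f1 a) <= M -> anorm (f2 a) <= M ->
  anorm a <= M.
Proof.
move=> M0 m1 m2; apply/ler_addgt0Pr => e e0.
have e20 : 0 < e / 2 by rewrite divr_gt0.
have [l al] := words_dense a e20.
have near (D : cstarAlgType R) (f : S -> D) : starhom f -> anorm (f a) <= M ->
    anorm (f (ev W P l)) <= M + e / 2.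
  move=> hf fM; have := anorm_dist (f (ev W P l)) (f a) 0; rewrite !subr0 -(homB hf).
  by have := hom_norm_le hf (ev W P l - a); rewrite (anormBC (ev W P l)); lra.
have : anorm (ev W P l) <= M + e / 2.
  apply: word_norm_le; [lra|exact: near|exact: near].
have := anorm_dist a (ev W P l) 0; rewrite !subr0; lra.
Qed.

(** It suffices to compare characters on generators: [W] goes to [z] on both sides, and [P] to
    [1 - |z|^2 = 0]. *)
Lemma pullback_range a : phip (f1 a) = phiq (f2 a).
Proof.
apply: circle_ext => z z1.
have h1 : starhom (fun a => phip (f1 a)).
  split.
  - by move=> k x y; rewrite (homD hf1) (homZ hf1) (homD hphip) (homZ hphip).
  - by split=> [|x y]; rewrite ?(hom1 hf1) ?(hom1 hphip) // (homM hf1) (homM hphip).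
  - by move=> x; rewrite (hom_star hf1) (hom_star hphip).
have h2 : starhom (fun a => phiq (f2 a)).
  split.
  - by move=> k x y; rewrite (homD hf2) (homZ hf2) (homD hphiq) (homZ hphiq).
  - by split=> [|x y]; rewrite ?(hom1 hf2) ?(hom1 hphiq) // (homM hf2) (homM hphiq).
  - by move=> x; rewrite (hom_star hf2) (hom_star hphiq).
have c1 := circle_eval_char h1 z1; have c2 := circle_eval_char h2 z1.
apply: (genS (E := fun a => circle_eval z (phip (f1 a)) = circle_eval z (phiq (f2 a)))).
- split; first exact: closed_alg_eq_char c1 c2.
  by move=> x e; rewrite (char_star c1) (char_star c2) e.
- by rewrite f1W f2W chis // chit.
- have cp := circle_eval_char hphip z1; have cq := circle_eval_char hphiq z1.
  rewrite f1P f2P (char0 cq) (charB cp) (char1 cp) (charM cp) (char_star cp) chis //.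
  by rewrite norm1_conj // subrr.
Qed.

(* The kernel of [f1] covers [t^i (1 - t t^* ) t^*j], so modulo its image under [f2] every
   word in [t] collapses to a power of [t] or of [star t]. *)
Lemma laurent_decomposition l : exists b y,
  [/\ f1 b = 0, laurent t y & ev t 0 l = y + f2 b].
Proof.
have word_case i j : exists b y, [/\ f1 b = 0, laurent t y & t ^+ i * star t ^+ j = y + f2 b].
  have flat m n : laurent t (t ^+ m * star t ^+ n) -> exists b y,
      [/\ f1 b = 0, laurent t y & t ^+ m * star t ^+ n = y + f2 b].
    by move=> lmn; exists 0, (t ^+ m * star t ^+ n); rewrite (hom0 hf1) (hom0 hf2) addr0.
  elim: i j => [|i IH] [|j]; try by apply: flat; exact: laurent_word.
  have [b [y [b0 ly e]]] := IH j.
  pose d := W ^+ i * (1 - W * star W - P) * star W ^+ j.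
  exists (b - d), y; split => //.
    rewrite (homB hf1) b0 /d !(homM hf1) !(homX hf1) !(homB hf1) (homM hf1) (hom1 hf1).
    by rewrite (hom_star hf1) f1W f1P subrr mulr0 mul0r subrr.
  rewrite (homB hf2) addrA -e /d !(homM hf2) !(homX hf2) !(homB hf2) (homM hf2) (hom1 hf2).
  by rewrite (hom_star hf2) f2W f2P subr0 exprSr exprS mulrBr mulrBl mulr1 subKr !mulrA.
elim: l => [|[k [x [i j]]] l [b [y [b0 ly e]]]].
  by exists 0, 0; rewrite (hom0 hf1) (hom0 hf2) addr0 /ev big_nil; split => //; exact: laurent0.
rewrite /ev big_cons -/(ev t 0 l) e /mono /=; case: x.
  by exists b, y; rewrite mulr0 mul0r scaler0 add0r.
have [b' [y' [b'0 ly' e']]] := word_case i j.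
exists (k *: b' + b), (k *: y' + y); split.
- by rewrite (homD hf1) (homZ hf1) b'0 b0 scaler0 addr0.
- by apply: laurentD => //; exact: laurentZ.
- by rewrite mulr1 e' (homD hf2) (homZ hf2) scalerDr addrACA.
Qed.

(** First [d1] is matched by [a1], then the second coordinate is corrected by [b] in the kernel of
    [f1]. What remains is a Laurent element [y], small because its symbol is a difference of symbols
    of the two approximation errors. *)
Lemma pullback_approx d1 d2 (e : R) : 0 < e -> phip d1 = phiq d2 ->
  exists a, anorm (d1 - f1 a) <= e /\ anorm (d2 - f2 a) <= e.
Proof.
move=> e0 d12.
(* The symbol of [y] is at most [2 e / 5], its norm at most [4 e / 5], and one more [e / 5] comes
   from approximating by [ev t 0 l2]. *)
have e50 : 0 < e / 5 by rewrite divr_gt0.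
have [l1 h1] := isometry_words_dense ss genDp d1 e50.
(* The same words, with [W] in place of [s] and [0] in place of the projection, lift the approximant
   through [f1]. *)
pose a1 := ev W 0 l1.
have f1a1 : f1 a1 = ev s 0 l1 by rewrite /a1 (hom_ev _ _ _ hf1) f1W (hom0 hf1).
have [l2 h2] := isometry_words_dense tt1 genDq (d2 - f2 a1) e50.
have [b [y [b0 ly ye]]] := laurent_decomposition l2.
have y_le z : `|z| = 1 -> `|circle_eval z (phiq y)| <= (2 * (e / 5))%:C%C.
  move=> z1; have cp := circle_eval_char hphip z1; have cq := circle_eval_char hphiq z1.
  have -> : circle_eval z (phiq y) =
      circle_eval z (phip (d1 - f1 a1)) - circle_eval z (phiq (d2 - f2 a1 - ev t 0 l2)).
    have -> : y = ev t 0 l2 - f2 b by rewrite ye addrK.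
    rewrite (charB cq) -pullback_range b0 (char0 cp) subr0.
    by rewrite (charB cp) (charB cq) (charB cq) d12 pullback_range; ring.
  apply: (le_trans (ler_normB _ _)).
  have -> : (2 * (e / 5))%:C%C = (e / 5)%:C%C + (e / 5)%:C%C :> C.
    by rewrite -RcD; congr (_%:C)%C; lra.
  apply: lerD.
    by apply: (le_trans (char_norm_le cp _)); rewrite lecR f1a1.
  by apply: (le_trans (char_norm_le cq _)); rewrite lecR.
have y_norm : anorm y <= 2 * (2 * (e / 5)).
  apply: (laurent_norm_le (chi := fun z d => circle_eval z (phiq d))) => //.
  - exact: tt1.
  - by move=> z z1; exact: circle_eval_char.
  - exact: chit.
  - lra.
  - exact: ly.
exists (a1 + b); rewrite (homD hf1) (homD hf2) b0 addr0 f1a1; split.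
  by apply: (le_trans h1); lra.
have -> : d2 - (f2 a1 + f2 b) = (d2 - f2 a1 - ev t 0 l2) + y by rewrite ye; ncring R.
by apply: (le_trans (anormD _ _)); lra.
Qed.

(** The approximants are Cauchy in [S] by [pair_norm_le], since both their images are Cauchy;
    continuity of [f1] and [f2] identifies the images of the limit. *)
Lemma pullback_surjective d1 d2 : phip d1 = phiq d2 -> exists a, f1 a = d1 /\ f2 a = d2.
Proof.
move=> d12.
have eps n : 0 < (n.+1%:R^-1 : R) by rewrite invr_gt0.
have [a aP] := choice (fun n => pullback_approx (eps n) d12).
have small (e : R) : 0 < e -> exists N, forall n, (N <= n)%N -> (n.+1%:R^-1 : R) <= e.
  move=> e0; have [N _ NP] := near_infty_natSinv_lt (PosNum e0).
  by exists N => n Nn; apply: ltW; exact: NP.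
have [x ax] : exists x, aconv a x.
  apply: anorm_complete => e e0; have e20 : 0 < e / 2 by rewrite divr_gt0.
  have [N NP] := small _ e20; exists N => m n Nm Nn.
  have [/le_trans/(_ (NP m Nm)) h1 /le_trans/(_ (NP m Nm)) h2] := aP m.
  have [/le_trans/(_ (NP n Nn)) h3 /le_trans/(_ (NP n Nn)) h4] := aP n.
  apply: pair_norm_le; first exact: ltW.
    rewrite (homB hf1); have := anorm_dist (f1 (a m)) d1 (f1 (a n)).
    by rewrite (anormBC (f1 (a m)) d1); lra.
  rewrite (homB hf2); have := anorm_dist (f2 (a m)) d2 (f2 (a n)).
  by rewrite (anormBC (f2 (a m)) d2); lra.
exists x; split.
  apply: (aconv_uniq (hom_aconv hf1 ax)) => e e0.
  have [N NP] := small _ e0; exists N => n Nn; have [h1 _] := aP n.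
  by rewrite anormBC; apply: le_trans h1 (NP n Nn).
apply: (aconv_uniq (hom_aconv hf2 ax)) => e e0.
have [N NP] := small _ e0; exists N => n Nn; have [_ h2] := aP n.
by rewrite anormBC; apply: le_trans h2 (NP n Nn).
Qed.

Lemma pullback_isomorphism : star_isomorphic_to_sub S (disc_pullback phip phiq).
Proof.
exists (fun a => (f1 a, f2 a)); split.
- split.
  + by move=> k x y; rewrite (homD hf1) (homZ hf1) (homD hf2) (homZ hf2).
  + by split=> [|x y]; rewrite ?(hom1 hf1) ?(hom1 hf2) // (homM hf1) (homM hf2).
  + by move=> x; rewrite (hom_star hf1) (hom_star hf2).
- move=> x y [e1 e2]; apply/eqP; rewrite -subr_eq0; apply/eqP/anorm_eq0/eqP.
  rewrite eq_le anorm_ge0 andbT; apply: pair_norm_le => //.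
    by rewrite (homB hf1) e1 subrr anorm0.
  by rewrite (homB hf2) e2 subrr anorm0.
- apply/seteqP; split => [_ [a _ <-]|[d1 d2] /= h]; first exact: pullback_range.
  by have [a [e1 e2]] := pullback_surjective h; exists a => //; rewrite e1 e2.
Qed.

End PullbackIsomorphism.

Theorem proposition16 (R : realType) (mu c p q : R)
  (S Dp Dq : cstarAlgType R) (A B : S) (xp : Dp) (xq : Dq)
  (phip : Dp -> circle_alg R) (phiq : Dq -> circle_alg R) :
  `|mu| < 1 -> 0 < c -> 0 < p < 1 -> 0 < q < 1 ->
  is_podles_sphere mu c A B ->
  is_quantum_disc p xp -> is_quantum_disc q xq ->
  starhom phip -> phip xp = circle_gen R ->
  starhom phiq -> phiq xq = circle_gen R ->
  star_isomorphic_to_sub S (disc_pullback phip phiq).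
Proof.
move=> mu1 c0 p01 q01 hS hDp hDq hphip phipx hphiq phiqx.
have [s [ks [[ss s0 sE pks kss] genDp]]] := quantum_disc_isometry p01 hDp.
have [t [kt [[tt1 t0 tE pkt ktt] genDq]]] := quantum_disc_isometry q01 hDq.
have rel := hS.1.
have [W [P [g [k [[hW WE PE] [[pg pk gg gk kg] [Egk EAB]]]]]]] := isometry_of_podles mu1 c0 rel.
(* The two discs get opposite pairs: with [pi] the whole defect, [A1] is built from the positive
   root [u]; with [pi = 0], [A2] is built from the negative root [v]. *)
have [A1 [B1 [G1 [rel1 Ap1 pG1 GG1 BE1]]]] := podles_of_isometry mu1 c0 (defect_pair ss).
have [A2 [B2 [G2 [rel2 Ap2 pG2 GG2 BE2]]]] := podles_of_isometry mu1 c0 (zero_pair tt1).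
have [f1 [[hf1 f1A f1B] _]] := hS.2 _ _ _ rel1.
have [f2 [[hf2 f2A f2B] _]] := hS.2 _ _ _ rel2.
have chi_isom (r : R) (D : cstarAlgType R) (x w k' : D) (phi : D -> circle_alg R) :
    w = x * k' -> pos k' -> k' * k' * (star x * x) = 1 -> starhom phi ->
    phi x = circle_gen R -> forall z, `|z| = 1 -> circle_eval z (phi w) = z.
  move=> wE pk' kk hphi phix z z1.
  have hc := circle_eval_char hphi z1.
  have xz : circle_eval z (phi x) = z by rewrite phix circle_eval_gen.
  by rewrite (disc_isometry_char wE pk' kk hc) // xz.
apply: (pullback_isomorphism hW ss tt1 s0 t0 hf1 hf2) => //.
- exact: (sphere_hom_isometry hf1 f1A f1B rel WE pg pk gg gk kg Egk pG1 GG1 BE1).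
- exact: (sphere_hom_proj c0 hf1 f1A f1B rel WE PE pg pk gg gk kg Egk Ap1 pG1 GG1 BE1).
- exact: (sphere_hom_isometry hf2 f2A f2B rel WE pg pk gg gk kg Egk pG2 GG2 BE2).
- exact: (sphere_hom_proj c0 hf2 f2A f2B rel WE PE pg pk gg gk kg Egk Ap2 pG2 GG2 BE2).
- exact: (chi_isom p _ _ _ _ _ sE pks kss).
- exact: (chi_isom q _ _ _ _ _ tE pkt ktt).
- move=> E EE EW EP; have [EA EB] := EAB E EE EW EP.
  exact: (podles_sphere_generated (E := csa_subalg EE) (calg_lim EE) hS EA EB).
Qed.
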